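(* Let $h\in C_0^\infty(\mathbb{R}_+)'$ be real, i.e. $\overline{\langle h,F\rangle}=\langle h,\overline F\rangle$ for all $F\in C_0^\infty(\mathbb{R}_+)$. Suppose that its sigma-function $\sigma$ satisfies $\operatorname{supp}\sigma\subset[0,\infty)$ and $\sigma\in\mathcal{S}_0'$. Then $$N_\pm(h;C_0^\infty(\mathbb{R}_+))=N_\pm(\sigma;C_0^\infty(\mathbb{R}_+)).$$
   Context: $\mathbb{R}_+=(0,\infty)$. For a space of test functions $X$, $X'$ denotes the space of continuous antilinear functionals on $X$; the duality $\langle h,F\rangle$ is linear in the first and antilinear in the second argument, so that $\langle h,F\rangle=\int h(t)\overline{F(t)}\,dt$ when $h$ is a locally integrable function. The space $\mathcal{Y}$ consists of entire functions $\varphi(\lambda)$ satisfying, for all $\lambda\in\mathbb{C}$, the bounds $|\varphi(\lambda)|\le C_n(1+|\lambda|)^{-n}e^{r_\pm|\operatorname{Re}\lambda|}$ for $\pm\operatorname{Re}\lambda\ge 0$, for all $n$, with some $r_+=r_+(\varphi)<0$ and some $r_-=r_-(\varphi)\in\mathbb{R}$; $\varphi_k\to0$ in $\mathcal{Y}$ if all $\varphi_k$ satisfy these bounds with the same constants and $\varphi_k\to0$ uniformly on compact subsets of $\mathbb{C}$. The Laplace transform $(\mathsf{L}f)(\lambda)=\int_0^\infty e^{-t\lambda}f(t)\,dt$ is an isomorphism $C_0^\infty(\mathbb{R}_+)\to\mathcal{Y}$, hence $\mathsf{L}^*:\mathcal{Y}'\to C_0^\infty(\mathbb{R}_+)'$,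 $\langle\mathsf{L}^*\sigma,F\rangle=\langle\sigma,\mathsf{L}F\rangle$, is an isomorphism. The sigma-function of $h$ is $\sigma=(\mathsf{L}^* )^{-1}h\in\mathcal{Y}'$. $\mathcal{S}_\gamma$, $\gamma\in\mathbb{R}$, is the space of $g\in C^\infty(\mathbb{R}_+)$ satisfying $|g^{(k)}(\lambda)|\le C_{\varkappa,k}\lambda^{\gamma-1/2-k}(1+|\ln\lambda|)^{-\varkappa}$ for all $k=0,1,2,\dots$ and all $\varkappa\in\mathbb{R}$, with the corresponding natural topology (so $g\in\mathcal{S}_0$ iff $x\mapsto e^{x/2}g(e^x)$ is in the Schwartz space $\mathcal{S}(\mathbb{R})$). Restrictions of functions from $\mathcal{Y}$ to $\mathbb{R}_+$ belong to $\mathcal{S}_0$ and form a dense subset; $\operatorname{supp}\sigma\subset[0,\infty)$, $\sigma\in\mathcal{S}_0'$ means that $\sigma$ acts on $w\in\mathcal{Y}$ through the restriction $w|_{\mathbb{R}_+}$ as a continuous antilinear functional on $\mathcal{S}_0$ (also denoted $\sigma$). The Laplace convolution is $(\bar f_1\star f_2)(t)=\int_0^t\overline{f_1(s)}f_2(t-s)\,ds$. For a real quadratic form $\mathsf{h}$ on a linear set $\mathsf{D}$, $N_\pm(\mathsf{h};\mathsf{D})\in\{0,1,\dots,\infty\}$ is the maximal dimension of linear sets $\mathcal{M}_\pm\subset\mathsf{D}$ such that $\pm\mathsf{h}[\varphi,\varphi]>0$ for all $0\ne\varphi\in\mathcal{M}_\pm$. $N_\pm(h;C_0^\infty(\mathbb{R}_+))$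 refers to $h[f,f]=\langle h,\bar f\star f\rangle$, $f\in C_0^\infty(\mathbb{R}_+)$; $N_\pm(\sigma;C_0^\infty(\mathbb{R}_+))$ refers to $\sigma[w,w]=\langle\sigma,|w|^2\rangle$, $w\in C_0^\infty(\mathbb{R}_+)$. *)

(* Defs.v *)
From Stdlib Require Import Reals.
From Coquelicot Require Import Coquelicot.
Open Scope R_scope.

Definition Cexp (z : C) : C :=
  (exp (Re z) * cos (Im z), exp (Re z) * sin (Im z)).

Definition CDerive_n (f : R -> C) (k : nat) (x : R) : C :=
  (Derive_n (fun t => Re (f t)) k x, Derive_n (fun t => Im (f t)) k x).

Definition smooth_on (A : R -> Prop) (f : R -> C) : Prop :=
  forall (k : nat) (x : R), A x ->
    ex_derive_n (fun t => Re (f t)) k x /\ ex_derive_n (fun t => Im (f t)) k x.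

(* A space of functions [X -> C] is given by its membership predicate [D] and
    by the predicate [null] singling out the sequences that converge to 0.
    Functionals are total functions of which only the values on [D] matter. *)

Definition antilinear_on {X : Type} (D : (X -> C) -> Prop) (T : (X -> C) -> C)
  : Prop :=
  (forall f g, D f -> D g -> T (fun x => Cplus (f x) (g x)) = Cplus (T f) (T g)) /\
  (forall (a : C) f, D f -> T (fun x => Cmult a (f x)) = Cmult (Cconj a) (T f)).

(* Sequential continuity, which for antilinear functionals is the same as
   continuity, both on the strict inductive limit of Frechet spaces [Cc] and on
   the Frechet space [Sgam gamma] below; the topology of [Yspace] is only
   specified through its convergent sequences. *)
Definition dual {X : Type} (D : (X -> C) -> Prop)
    (null : (nat -> X -> C) -> Prop) (T : (X -> C) -> C) : Prop :=
  antilinear_on D T /\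
  forall u : nat -> X -> C, (forall n, D (u n)) -> null u ->
    is_lim_seq (fun n => Cmod (T (u n))) 0.

(* C_0^infty(R_+), its elements being extended by zero to R. *)
Definition Cc (f : R -> C) : Prop :=
  smooth_on (fun _ => True) f /\
  exists a b : R, 0 < a < b /\ forall t, t < a \/ b < t -> f t = RtoC 0.

Definition Cc_null (u : nat -> R -> C) : Prop :=
  (exists a b : R, 0 < a < b /\
     forall n t, t < a \/ b < t -> u n t = RtoC 0) /\
  forall (k : nat) (eps : R), 0 < eps ->
    eventually (fun n => forall t, Cmod (CDerive_n (u n) k t) <= eps).

Definition Cc_dual : ((R -> C) -> C) -> Prop := dual Cc Cc_null.

Definition real_functional (h : (R -> C) -> C) : Prop :=
  forall F, Cc F -> Cconj (h F) = h (fun t => Cconj (F t)).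

Definition entire (phi : C -> C) : Prop :=
  forall z : C, ex_derive (K := C_AbsRing) (V := C_NormedModule) phi z.

Definition Ybound (A : nat -> R) (rp rm : R) (phi : C -> C) : Prop :=
  forall (n : nat) (z : C),
    (0 <= Re z ->
       Cmod (phi z) <= A n * / (1 + Cmod z) ^ n * exp (rp * Rabs (Re z))) /\
    (Re z <= 0 ->
       Cmod (phi z) <= A n * / (1 + Cmod z) ^ n * exp (rm * Rabs (Re z))).

Definition Yspace (phi : C -> C) : Prop :=
  entire phi /\
  exists (A : nat -> R) (rp rm : R), rp < 0 /\ Ybound A rp rm phi.

Definition Y_null (u : nat -> C -> C) : Prop :=
  (exists (A : nat -> R) (rp rm : R), rp < 0 /\ forall n, Ybound A rp rm (u n)) /\
  forall rho eps : R, 0 < eps ->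
    eventually (fun n => forall z, Cmod z <= rho -> Cmod (u n z) <= eps).

Definition Y_dual : ((C -> C) -> C) -> Prop := dual Yspace Y_null.

Definition laplace (f : R -> C) (z : C) : C :=
  RInt_gen (V := C_R_CompleteNormedModule)
    (fun t : R => Cmult (Cexp (Cmult (RtoC (- t)) z)) (f t))
    (at_right 0) (Rbar_locally p_infty).

Definition laplace_adj (sigma : (C -> C) -> C) (F : R -> C) : C :=
  sigma (laplace F).

(* sigma = (L^* )^{-1} h, where L^* : Y' -> C_0^infty(R_+)' is bijective *)
Definition is_sigma_function (h : (R -> C) -> C) (sigma : (C -> C) -> C) : Prop :=
  Y_dual sigma /\ forall F, Cc F -> laplace_adj sigma F = h F.

(* In the spaces S_gamma, functions on R_+ are represented by total functions on R whose values
    outside R_+ are irrelevant: two functions that agree on R_+ differ by an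
    element whose constant sequence is null, so that elements of the dual take
    the same value on both. *)

Definition Sweight (gamma kappa : R) (k : nat) (x : R) : R :=
  Rpower x (gamma - 1 / 2 - INR k) * Rpower (1 + Rabs (ln x)) (- kappa).

Definition Sgam (gamma : R) (g : R -> C) : Prop :=
  smooth_on (fun x => 0 < x) g /\
  forall (kappa : R) (k : nat), exists A : R, forall x, 0 < x ->
    Cmod (CDerive_n g k x) <= A * Sweight gamma kappa k x.

Definition Sgam_null (gamma : R) (u : nat -> R -> C) : Prop :=
  forall (kappa : R) (k : nat) (eps : R), 0 < eps ->
    eventually (fun n => forall x, 0 < x ->
      Cmod (CDerive_n (u n) k x) <= eps * Sweight gamma kappa k x).

Definition Sgam_dual (gamma : R) : ((R -> C) -> C) -> Prop :=
  dual (Sgam gamma) (Sgam_null gamma).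

(* "supp sigma is contained in [0, infty) and sigma belongs to S_gamma'", with
   [sigma0] the functional on S_gamma through which sigma acts (and which is
   again denoted by sigma in the usual notation). *)
Definition acts_through_Sgam (gamma : R)
    (sigma : (C -> C) -> C) (sigma0 : (R -> C) -> C) : Prop :=
  Sgam_dual gamma sigma0 /\
  forall w, Yspace w -> sigma w = sigma0 (fun x : R => w (RtoC x)).

Definition laplace_conv (f1 f2 : R -> C) (t : R) : C :=
  RInt (V := C_R_CompleteNormedModule)
    (fun s : R => Cmult (Cconj (f1 s)) (f2 (t - s))) 0 t.

Definition hankel_form (h : (R -> C) -> C) (f : R -> C) : C :=
  h (laplace_conv f f).

Definition sigma_form (sigma0 : (R -> C) -> C) (w : R -> C) : C :=
  sigma0 (fun x => RtoC (Cmod (w x) ^ 2)).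

Definition linear_set (M : (R -> C) -> Prop) : Prop :=
  M (fun _ => RtoC 0) /\
  (forall f g, M f -> M g -> M (fun x => Cplus (f x) (g x))) /\
  (forall (a : C) f, M f -> M (fun x => Cmult a (f x))).

Fixpoint Csum (c : nat -> C) (n : nat) : C :=
  match n with
  | O => RtoC 0
  | S m => Cplus (Csum c m) (c m)
  end.

Definition lin_indep (n : nat) (v : nat -> R -> C) : Prop :=
  forall c : nat -> C,
    (forall x, Csum (fun i => Cmult (c i) (v i x)) n = RtoC 0) ->
    forall i, (i < n)%nat -> c i = RtoC 0.

(* n <= dim M, where M may be infinite-dimensional *)
Definition dim_ge (M : (R -> C) -> Prop) (n : nat) : Prop :=
  exists v : nat -> R -> C, (forall i, (i < n)%nat -> M (v i)) /\ lin_indep n v.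

(* s q > 0 on M \ {0}; for a complex number z, "z > 0" means that z is real and
   positive. *)
Definition form_positive (s : R) (q : (R -> C) -> C) (M : (R -> C) -> Prop)
  : Prop :=
  forall f, M f -> (exists x, f x <> RtoC 0) ->
    Im (q f) = 0 /\ 0 < s * Re (q f).

(* The supremum, in {0, 1, ..., infty}, of the dimensions of the linear sets M
   contained in D on which s q is positive. *)
Definition inertia (s : R) (q : (R -> C) -> C) (D : (R -> C) -> Prop) : Rbar :=
  Lub_Rbar (fun r : R => exists (n : nat) (M : (R -> C) -> Prop),
    r = INR n /\ linear_set M /\ (forall f, M f -> D f) /\
    form_positive s q M /\ dim_ge M n).

Definition N_plus (q : (R -> C) -> C) (D : (R -> C) -> Prop) : Rbar :=
  inertia 1 q D.

Definition N_minus (q : (R -> C) -> C) (D : (R -> C) -> Prop) : Rbar :=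
  inertia (-1) q D.

(* Main.v *)
(** Write [L] for the Laplace transform. The transform of the Laplace convolution
    of [conj f] and [f] equals [|L f|^2] on the real line, so the Hankel form is
    [sigma0 (|L f|^2)], and both forms of the theorem are [sigma0 (|T f|^2)], with
    [T = L] and with [T] the identity. Since a product of two elements of
    [S_{1/4}] lies in [S_0], these forms are continuous in [T f] for the topology
    of [S_{1/4}] (not [S_0]). Hence it suffices that each of the sets
    [{L f : f in C_0^infty}] and [C_0^infty] can be approximated by the other one
    in [S_{1/4}]: a subspace on which one form is definite has a basis that is
    orthogonal for this form, and close approximants of the basis vectors still
    span a subspace on which the other form is definite.

    Truncation approximates [L f]. Conversely, let [w] be a test function and
    [e = L rho > 0] for a bump function [rho]. Bernstein polynomials in [exp (- x)]
    approximate the [K]-th derivative of [w / e]; integrating [K] times from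
    infinity gives exponential sums that are close to [w / e] together with [K]
    derivatives, and [e] times an exponential sum with exponents in
    [{1, 2, ...}] is the Laplace transform of a combination of translates of
    [rho]. *)

Require Import Defs.
From Stdlib Require Import Reals Lra Lia Psatz FunctionalExtensionality Classical IndefiniteDescription List.
From Coquelicot Require Import Coquelicot.
Import ListNotations.
Open Scope R_scope.

(** * Derivatives of complex-valued functions *)

(** Neither of the two sets contains the other: [L f] is the restriction of an entire function, so
    it has compact support only when it vanishes. Hence definite subspaces cannot be carried over,
    only approximated; this is enough because an index is tested on finitely many vectors and strict
    definiteness survives small changes of the Gram matrix.

    The index 1/4 is forced by the weights: a product of elements of S_a and S_b lies in
    S_{a+b-1/2}, so both factors are taken in S_a with 2a - 1/2 = 0. Elements of S_0 may grow almost
    like x^{-1/2} at 0, and their products need not be in S_0. Both sets lie in S_{1/4} since their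
    elements are bounded near 0 and decay exponentially.

    An exponential sum is the transform of a sum of point masses, not of a test function; the factor
    [e] mollifies these masses into translates of [rho]. Starting the exponents at 1 keeps a factor
    exp (- x) in every error term; this factor is dominated by all weights of S_{1/4}, and it makes
    the integration from infinity cost no constant. *)

Notation is_deriveC f x l :=
  (@is_derive R_AbsRing C_R_NormedModule f x l) (only parsing).

Lemma locally_Rabs (P : R -> Prop) x d : 0 < d ->
  (forall t, Rabs (t - x) < d -> P t) -> locally x P.
Proof. intros Hd H. exists (mkposreal d Hd). exact H. Qed.

Lemma exp_le x y : x <= y -> exp x <= exp y.
Proof. intros [H| ->]; [left; now apply exp_increasing | lra]. Qed.

Lemma C_eq (a b : C) : Re a = Re b -> Im a = Im b -> a = b.
Proof. destruct a, b; cbn; intros; subst; auto. Qed.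

Lemma is_deriveC_pair (f : R -> C) x l :
  is_derive (fun t => Re (f t)) x (Re l) ->
  is_derive (fun t => Im (f t)) x (Im l) -> is_deriveC f x l.
Proof.
  intros H1 H2.
  assert (H : @is_derive R_AbsRing C_R_NormedModule
    (fun t => plus (scal (Re (f t)) ((1, 0) : C_R_NormedModule))
               (scal (Im (f t)) ((0, 1) : C_R_NormedModule))) x
    (plus (scal (Re l) ((1, 0) : C_R_NormedModule))
               (scal (Im l) ((0, 1) : C_R_NormedModule)))).
  { apply (is_derive_plus (K := R_AbsRing) (V := C_R_NormedModule)).
    - apply (is_derive_scal_l (K := R_AbsRing) (V := C_R_NormedModule)); exact H1.
    - apply (is_derive_scal_l (K := R_AbsRing) (V := C_R_NormedModule)); exact H2. }
  assert (E : forall z : C, plus (scal (Re z) ((1, 0) : C_R_NormedModule))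
               (scal (Im z) ((0, 1) : C_R_NormedModule)) = z).
  { intros [u v]; apply C_eq; cbn; unfold mult, plus; cbn; ring. }
  rewrite E in H.
  eapply is_derive_ext; [|exact H]. intros t; apply E.
Qed.

Lemma is_deriveC_Re (f : R -> C) x l :
  is_deriveC f x l -> is_derive (fun t => Re (f t)) x (Re l).
Proof.
  intros H.
  apply (filterdiff_comp f (fun z : C_R_NormedModule => fst z)
     _ (fun z : C_R_NormedModule => fst z) H).
  apply filterdiff_linear. apply (is_linear_fst (U := R_NormedModule) (V := R_NormedModule)).
Qed.

Lemma is_deriveC_Im (f : R -> C) x l :
  is_deriveC f x l -> is_derive (fun t => Im (f t)) x (Im l).
Proof.
  intros H.
  apply (filterdiff_comp f (fun z : C_R_NormedModule => snd z)
     _ (fun z : C_R_NormedModule => snd z) H).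
  apply filterdiff_linear. apply (is_linear_snd (U := R_NormedModule) (V := R_NormedModule)).
Qed.

Lemma is_deriveC_ext (f g : R -> C) x (l l' : C) :
  (forall t, f t = g t) -> l = l' -> is_deriveC f x l -> is_deriveC g x l'.
Proof. intros E -> H. eapply is_derive_ext; [|exact H]. exact E. Qed.

Lemma is_deriveC_plus (f g : R -> C) x a b :
  is_deriveC f x a -> is_deriveC g x b ->
  is_deriveC (fun t => Cplus (f t) (g t)) x (Cplus a b).
Proof. intros; apply (is_derive_plus (K := R_AbsRing) (V := C_R_NormedModule)); auto. Qed.

Lemma is_deriveC_mult (f g : R -> C) x a b :
  is_deriveC f x a -> is_deriveC g x b ->
  is_deriveC (fun t => Cmult (f t) (g t)) x (Cplus (Cmult a (g x)) (Cmult (f x) b)).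
Proof.
  intros Hf Hg.
  assert (Hf1 := is_deriveC_Re _ _ _ Hf). assert (Hf2 := is_deriveC_Im _ _ _ Hf).
  assert (Hg1 := is_deriveC_Re _ _ _ Hg). assert (Hg2 := is_deriveC_Im _ _ _ Hg).
  assert (M : forall u v : R -> R, forall du dv, is_derive u x du -> is_derive v x dv ->
     is_derive (fun t => u t * v t) x (du * v x + u x * dv)).
  { intros u v du dv Hu Hv. apply (is_derive_mult u v x du dv Hu Hv Rmult_comm). }
  apply is_deriveC_pair.
  - apply (is_derive_ext (fun t => minus (Re (f t) * Re (g t)) (Im (f t) * Im (g t)))).
    { intros t; reflexivity. }
    match goal with |- is_derive _ _ ?l => replace l with
      (minus (Re a * Re (g x) + Re (f x) * Re b) (Im a * Im (g x) + Im (f x) * Im b)) end.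
    { apply (is_derive_minus (K := R_AbsRing) (V := R_NormedModule)); apply M; auto. }
    { unfold minus, plus, opp; cbn; unfold Re, Im; ring. }
  - apply (is_derive_ext (fun t => plus (Re (f t) * Im (g t)) (Im (f t) * Re (g t)))).
    { intros t; reflexivity. }
    match goal with |- is_derive _ _ ?l => replace l with
      (plus (Re a * Im (g x) + Re (f x) * Im b) (Im a * Re (g x) + Im (f x) * Re b)) end.
    { apply (is_derive_plus (K := R_AbsRing) (V := R_NormedModule)); apply M; auto. }
    { unfold plus; cbn; unfold Re, Im; ring. }
Qed.

Lemma is_deriveC_const (c : C) x : is_deriveC (fun _ => c) x (RtoC 0).
Proof. apply (is_derive_const (K := R_AbsRing) (V := C_R_NormedModule)). Qed.

Lemma is_deriveC_conj (f : R -> C) x a :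
  is_deriveC f x a -> is_deriveC (fun t => Cconj (f t)) x (Cconj a).
Proof.
  intros H. apply is_deriveC_pair.
  - apply (is_derive_ext (fun t => Re (f t))); [reflexivity|].
    rewrite re_conj. now apply is_deriveC_Re.
  - apply (is_derive_ext (fun t => opp (Im (f t)))); [reflexivity|].
    rewrite im_conj. apply (is_derive_opp (K := R_AbsRing) (V := R_NormedModule)).
    now apply is_deriveC_Im.
Qed.

Lemma is_deriveC_comp (f : R -> C) (u : R -> R) x a b :
  is_deriveC f (u x) a -> is_derive u x b ->
  is_deriveC (fun t => f (u t)) x (Cmult (RtoC b) a).
Proof.
  intros Hf Hu.
  apply (is_deriveC_ext (fun t => f (u t)) _ x (scal b a)); [reflexivity| |].
  - apply C_eq; unfold scal; cbn; unfold mult, scal; cbn; unfold mult, Re, Im; cbn; ring.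
  - apply (is_derive_comp (K := R_AbsRing) (V := C_R_NormedModule)); auto.
Qed.

Lemma is_deriveC_RtoC (u : R -> R) x b :
  is_derive u x b -> is_deriveC (fun t => RtoC (u t)) x (RtoC b).
Proof.
  intros H. apply is_deriveC_pair; cbn; auto.
  apply (is_derive_const (K := R_AbsRing) (V := R_NormedModule)).
Qed.

Lemma is_deriveC_continuous (f : R -> C) x l :
  is_deriveC f x l -> continuous (U := C_R_NormedModule) f x.
Proof.
  intros H. apply (ex_derive_continuous (K := R_AbsRing) (V := C_R_NormedModule)).
  eexists; exact H.
Qed.

(** [Derive_n] is total, so smoothness has to be proved apart from the values. A candidate sequence
    of successive derivatives settles both at once, through [jet_of]. *)
Definition jet (F : nat -> R -> C) : Prop :=
  forall k x, is_deriveC (F k) x (F (S k) x).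

Lemma jet_Derive_n F k x : jet F ->
  Derive_n (fun t => Re (F O t)) k x = Re (F k x) /\
  Derive_n (fun t => Im (F O t)) k x = Im (F k x).
Proof.
  intros J; revert x; induction k as [|k IH]; intros x; [split; reflexivity|].
  cbn [Derive_n]. split; apply is_derive_unique.
  - eapply is_derive_ext; [intros t; symmetry; apply (proj1 (IH t))|].
    apply is_deriveC_Re, J.
  - eapply is_derive_ext; [intros t; symmetry; apply (proj2 (IH t))|].
    apply is_deriveC_Im, J.
Qed.

Lemma jet_CDerive_n F k x : jet F -> CDerive_n (F O) k x = F k x.
Proof.
  intros J. destruct (jet_Derive_n F k x J) as [E1 E2].
  apply C_eq; cbn; auto.
Qed.

Lemma jet_smooth_on F A : jet F -> smooth_on A (F O).
Proof.
  intros J k x _. destruct k as [|k]; [split; exact I|]. cbn. split.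
  - exists (Re (F (S k) x)). eapply is_derive_ext;
      [intros t; symmetry; apply (proj1 (jet_Derive_n F k t J))|].
    apply is_deriveC_Re, J.
  - exists (Im (F (S k) x)). eapply is_derive_ext;
      [intros t; symmetry; apply (proj2 (jet_Derive_n F k t J))|].
    apply is_deriveC_Im, J.
Qed.

Definition smooth (f : R -> C) : Prop := smooth_on (fun _ => True) f.

Lemma smooth_jet f : smooth f -> jet (CDerive_n f).
Proof.
  intros S k x. apply is_deriveC_pair; cbn.
  - apply (Derive_correct (Derive_n (fun t => Re (f t)) k)).
    apply (proj1 (S (Datatypes.S k) x I)).
  - apply (Derive_correct (Derive_n (fun t => Im (f t)) k)).
    apply (proj2 (S (Datatypes.S k) x I)).
Qed.

Lemma CDerive_n_0 f x : CDerive_n f 0 x = f x.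
Proof. apply C_eq; reflexivity. Qed.

Lemma jet_of f F : jet F -> (forall x, F O x = f x) ->
  smooth f /\ forall k x, CDerive_n f k x = F k x.
Proof.
  intros J E. assert (F O = f) as <- by (apply functional_extensionality; exact E).
  split; [now apply jet_smooth_on | intros; now apply jet_CDerive_n].
Qed.

Lemma CDerive_n_ext_loc f g k x :
  locally x (fun t => f t = g t) -> CDerive_n f k x = CDerive_n g k x.
Proof.
  intros H. unfold CDerive_n. f_equal; apply Derive_n_ext_loc;
    revert H; apply filter_imp; intros t ->; reflexivity.
Qed.

Lemma smooth_shift f : smooth f ->
  smooth (CDerive_n f 1) /\
  forall k x, CDerive_n (CDerive_n f 1) k x = CDerive_n f (S k) x.
Proof.
  intros S. apply jet_of with (F := fun k => CDerive_n f (Datatypes.S k)); auto.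
  intros k x. apply (smooth_jet f S).
Qed.

Lemma smooth_plus f g : smooth f -> smooth g ->
  smooth (fun x => Cplus (f x) (g x)) /\
  forall k x, CDerive_n (fun x => Cplus (f x) (g x)) k x
     = Cplus (CDerive_n f k x) (CDerive_n g k x).
Proof.
  intros Hf Hg.
  apply jet_of with (F := fun k x => Cplus (CDerive_n f k x) (CDerive_n g k x)).
  - intros k x. apply is_deriveC_plus; apply smooth_jet; auto.
  - intros x; now rewrite !CDerive_n_0.
Qed.

Lemma smooth_const c : smooth (fun _ => c) /\
  forall k x, CDerive_n (fun _ => c) (S k) x = RtoC 0.
Proof.
  assert (H : smooth (fun _ => c) /\ forall k x, CDerive_n (fun _ => c) k x =
    match k with O => c | S _ => RtoC 0 end).
  { apply jet_of with (F := fun k _ => match k with O => c | S _ => RtoC 0 end); auto.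
    intros [|k] x; apply is_deriveC_const. }
  destruct H as [H1 H2]; split; [exact H1 | intros; apply H2].
Qed.

Lemma smooth_scal a f : smooth f ->
  smooth (fun x => Cmult a (f x)) /\
  forall k x, CDerive_n (fun x => Cmult a (f x)) k x = Cmult a (CDerive_n f k x).
Proof.
  intros Hf.
  apply jet_of with (F := fun k x => Cmult a (CDerive_n f k x)).
  - intros k x. eapply is_deriveC_ext; [reflexivity| |
      apply is_deriveC_mult; [apply is_deriveC_const | apply smooth_jet; auto]].
    cbn beta; ring.
  - intros x; now rewrite !CDerive_n_0.
Qed.

Lemma smooth_minus f g : smooth f -> smooth g ->
  smooth (fun x => Cminus (f x) (g x)) /\
  forall k x, CDerive_n (fun x => Cminus (f x) (g x)) k x
     = Cminus (CDerive_n f k x) (CDerive_n g k x).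
Proof.
  intros Hf Hg.
  destruct (smooth_scal (RtoC (-1)) g Hg) as [S1 E1].
  destruct (smooth_plus f _ Hf S1) as [S2 E2].
  assert (E : (fun x => Cplus (f x) (Cmult (RtoC (-1)) (g x))) =
              (fun x => Cminus (f x) (g x))).
  { apply functional_extensionality; intros x; unfold Cminus; f_equal.
    apply C_eq; cbn; unfold Re, Im; ring. }
  rewrite E in S2, E2. split; auto. intros k x. rewrite E2, E1.
  unfold Cminus; f_equal. apply C_eq; cbn; unfold Re, Im; ring.
Qed.

Lemma smooth_conj f : smooth f ->
  smooth (fun x => Cconj (f x)) /\
  forall k x, CDerive_n (fun x => Cconj (f x)) k x = Cconj (CDerive_n f k x).
Proof.
  intros Hf.
  apply jet_of with (F := fun k x => Cconj (CDerive_n f k x)).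
  - intros k x. apply is_deriveC_conj, smooth_jet; auto.
  - intros x; now rewrite !CDerive_n_0.
Qed.

Lemma smooth_affine f c d : smooth f ->
  smooth (fun x => f (c * x + d)) /\
  forall k x, CDerive_n (fun x => f (c * x + d)) k x =
    Cmult (RtoC (c ^ k)) (CDerive_n f k (c * x + d)).
Proof.
  intros Hf.
  apply jet_of with (F := fun k x => Cmult (RtoC (c ^ k)) (CDerive_n f k (c * x + d))).
  - intros k x. eapply is_deriveC_ext; [reflexivity| |
      apply is_deriveC_mult; [apply is_deriveC_const |
        apply is_deriveC_comp with (u := fun x => c * x + d);
         [apply smooth_jet; auto | auto_derive; [auto| reflexivity]]]].
    replace (c * 1) with c by ring. cbn [pow]. rewrite !RtoC_mult. ring.
  - intros x; rewrite !CDerive_n_0. cbn [pow]. ring.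
Qed.

(** The Leibniz rule as a recursion without binomial coefficients: order [k] unfolds into 2^k
    products. *)
Fixpoint prodjet (F G : nat -> R -> C) (k : nat) (x : R) : C :=
  match k with
  | O => Cmult (F O x) (G O x)
  | S k => Cplus (prodjet (fun j => F (S j)) G k x) (prodjet F (fun j => G (S j)) k x)
  end.

Lemma jet_prodjet F G : jet F -> jet G -> jet (prodjet F G).
Proof.
  intros HF HG k; revert F G HF HG; induction k as [|k IH]; intros F G HF HG x.
  - cbn. apply is_deriveC_mult; auto.
  - apply is_deriveC_plus; apply IH; auto; intros j y; auto.
Qed.

Lemma smooth_mult f g : smooth f -> smooth g ->
  smooth (fun x => Cmult (f x) (g x)) /\
  forall k x, CDerive_n (fun x => Cmult (f x) (g x)) k x
     = prodjet (CDerive_n f) (CDerive_n g) k x.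
Proof.
  intros Hf Hg. apply jet_of.
  - apply jet_prodjet; now apply smooth_jet.
  - intros x; cbn [prodjet]; now rewrite !CDerive_n_0.
Qed.

(** Geometric bounds are stable under the recursion: shifting a jet replaces [A] by [A * r]. The
    ratio [r] is [/ x] for the weights of S_gamma and 1 for plain sup bounds. *)
Lemma prodjet_bound k : forall F G A B r x,
  0 <= A -> 0 <= B -> 0 <= r ->
  (forall j, (j <= k)%nat -> Cmod (F j x) <= A * r ^ j) ->
  (forall j, (j <= k)%nat -> Cmod (G j x) <= B * r ^ j) ->
  Cmod (prodjet F G k x) <= 2 ^ k * (A * B) * r ^ k.
Proof.
  induction k as [|k IH]; intros F G A B r x HA HB Hr HF HG; cbn [prodjet].
  - rewrite Cmod_mult. specialize (HF O (le_n _)). specialize (HG O (le_n _)).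
    cbn [pow] in *. pose proof (Cmod_ge_0 (F O x)). pose proof (Cmod_ge_0 (G O x)). nra.
  - eapply Rle_trans; [apply Cmod_triangle|].
    assert (H1 : Cmod (prodjet (fun j => F (S j)) G k x) <= 2 ^ k * ((A * r) * B) * r ^ k).
    { apply IH; auto; try nra.
      - intros j Hj. specialize (HF (S j) ltac:(lia)). cbn [pow] in HF. nra. }
    assert (H2 : Cmod (prodjet F (fun j => G (S j)) k x) <= 2 ^ k * (A * (B * r)) * r ^ k).
    { apply IH; auto; try nra.
      - intros j Hj. specialize (HG (S j) ltac:(lia)). cbn [pow] in HG. nra. }
    cbn [pow]. nra.
Qed.

(** * Integrals of complex-valued functions *)

Definition contC (f : R -> C) : Prop := forall t, continuous (U := C_R_NormedModule) f t.

Notation is_RIntC := (@is_RInt C_R_NormedModule).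
Notation RIntC := (@RInt C_R_CompleteNormedModule).

Lemma contC_of_derive f f' : (forall t, is_deriveC f t (f' t)) -> contC f.
Proof. intros H t. eapply is_deriveC_continuous, H. Qed.

Lemma smooth_contC f k : smooth f -> contC (CDerive_n f k).
Proof. intros S. apply contC_of_derive with (CDerive_n f (Datatypes.S k)). apply smooth_jet, S. Qed.

Lemma contC_ext f g : (forall t, f t = g t) -> contC f -> contC g.
Proof. intros E. now replace g with f by (apply functional_extensionality; auto). Qed.

Lemma smooth_contC0 f : smooth f -> contC f.
Proof. intros S. apply (contC_ext (CDerive_n f 0)); [apply CDerive_n_0|]. now apply smooth_contC. Qed.

Lemma contC_RInt f a b : contC f -> is_RIntC f a b (RIntC f a b).
Proof.
  intros H. apply (RInt_correct (V := C_R_CompleteNormedModule)).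
  apply (ex_RInt_continuous (V := C_R_CompleteNormedModule)). auto.
Qed.

Lemma contC_Re f : contC f -> forall t, continuous (fun t => Re (f t)) t.
Proof.
  intros H t. apply (continuous_comp f (fun z : C_R_NormedModule => fst z)); [apply H|].
  apply (continuous_fst (U := R_UniformSpace) (V := R_UniformSpace)).
Qed.

Lemma contC_Im f : contC f -> forall t, continuous (fun t => Im (f t)) t.
Proof.
  intros H t. apply (continuous_comp f (fun z : C_R_NormedModule => snd z)); [apply H|].
  apply (continuous_snd (U := R_UniformSpace) (V := R_UniformSpace)).
Qed.

Lemma contC_pair f : (forall t, continuous (fun t => Re (f t)) t) ->
  (forall t, continuous (fun t => Im (f t)) t) -> contC f.
Proof.
  intros H1 H2 t.
  apply (continuous_ext (fun t => (Re (f t), Im (f t)) : C_R_NormedModule)).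
  - intros u. now destruct (f u).
  - apply (continuous_comp_2 (fun t => Re (f t)) (fun t => Im (f t))
      (fun x y => (x, y) : prod_UniformSpace R_UniformSpace R_UniformSpace)); auto.
    apply (continuous_ext (fun z => z)); [now intros []|apply continuous_id].
Qed.

Lemma contC_mult f g : contC f -> contC g -> contC (fun t => Cmult (f t) (g t)).
Proof.
  intros Hf Hg.
  assert (f1 := contC_Re f Hf). assert (f2 := contC_Im f Hf).
  assert (g1 := contC_Re g Hg). assert (g2 := contC_Im g Hg).
  apply contC_pair; intros t.
  - apply (continuous_minus (V := R_NormedModule) (fun t => Re (f t) * Re (g t)) (fun t => Im (f t) * Im (g t)));
    apply (continuous_mult (K := R_AbsRing)); auto.
  - apply (continuous_plus (V := R_NormedModule) (fun t => Re (f t) * Im (g t)) (fun t => Im (f t) * Re (g t)));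
    apply (continuous_mult (K := R_AbsRing)); auto.
Qed.

Lemma contC_conj f : contC f -> contC (fun t => Cconj (f t)).
Proof.
  intros Hf. apply contC_pair; intros t.
  - apply (contC_Re f Hf).
  - apply (continuous_opp (V := R_NormedModule) (fun t => Im (f t))). apply (contC_Im f Hf).
Qed.

Lemma contC_comp f (u : R -> R) : contC f -> (forall t, continuous u t) -> contC (fun t => f (u t)).
Proof. intros Hf Hu t. apply (continuous_comp u f); auto. Qed.

Lemma Cmod_le_Re_Im z : Cmod z <= Rabs (Re z) + Rabs (Im z).
Proof.
  rewrite <- !Cmod_R. replace z with (Cplus (RtoC (Re z)) (Cmult Ci (RtoC (Im z)))) at 1.
  - eapply Rle_trans; [apply Cmod_triangle|]. rewrite Cmod_mult, Cmod_Ci. lra.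
  - apply C_eq; cbn; ring.
Qed.

Lemma im_le_Cmod z : Rabs (Im z) <= Cmod z.
Proof. eapply Rle_trans; [apply Rmax_r|apply Rmax_Cmod]. Qed.

Lemma contC_bounded_on f a b : contC f -> a <= b ->
  exists M, 0 <= M /\ forall t, a <= t <= b -> Cmod (f t) <= M.
Proof.
  intros Hc Hab.
  assert (B : forall u : R -> R, (forall t, continuous u t) ->
    exists M, forall t, a <= t <= b -> Rabs (u t) <= M).
  { intros u Hu. destruct (continuity_ab_maj (fun t => Rabs (u t)) a b Hab) as (m & Hm & _).
    - intros t _. apply (continuity_pt_comp u Rabs); [|apply Rcontinuity_abs].
      apply continuity_pt_filterlim, Hu.
    - exists (Rabs (u m)). auto. }
  destruct (B _ (contC_Re f Hc)) as (M1 & H1). destruct (B _ (contC_Im f Hc)) as (M2 & H2).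
  exists (M1 + M2). split.
  - specialize (H1 a ltac:(lra)). specialize (H2 a ltac:(lra)).
    pose proof (Rabs_pos (Re (f a))). pose proof (Rabs_pos (Im (f a))). lra.
  - intros t Ht. eapply Rle_trans; [apply Cmod_le_Re_Im|].
    specialize (H1 t Ht). specialize (H2 t Ht). lra.
Qed.

Definition vanishes_outside (f : R -> C) (a b : R) : Prop :=
  forall t, t < a \/ b < t -> f t = RtoC 0.

Lemma CDerive_n_vanishes f a b k :
  vanishes_outside f a b -> vanishes_outside (CDerive_n f k) a b.
Proof.
  intros H t Ht.
  rewrite (CDerive_n_ext_loc f (fun _ => RtoC 0)).
  - destruct k as [|k]; [now rewrite CDerive_n_0|]. apply smooth_const.
  - destruct Ht as [Ht|Ht].
    + apply locally_Rabs with (a - t); [lra|]. intros u Hu. apply H. left.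
      apply Rabs_def2 in Hu. lra.
    + apply locally_Rabs with (t - b); [lra|]. intros u Hu. apply H. right.
      apply Rabs_def2 in Hu. lra.
Qed.

Lemma contC_bounded f a b : contC f -> a <= b -> vanishes_outside f a b ->
  exists M, 0 <= M /\ forall t, Cmod (f t) <= M.
Proof.
  intros Hc Hab V. destruct (contC_bounded_on f a b Hc Hab) as (M & HM & H).
  exists M; split; auto. intros t.
  destruct (Rlt_dec t a); [|destruct (Rlt_dec b t); [|apply H; lra]];
    rewrite V, Cmod_0 by auto; auto.
Qed.

Lemma is_RIntC_scal f a b c l : is_RIntC f a b l ->
  is_RIntC (fun t => Cmult c (f t)) a b (Cmult c l).
Proof.
  intros H.
  pose proof (is_RInt_fct_extend_fst (U := R_NormedModule) (V := R_NormedModule) f a b l H) as H1.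
  pose proof (is_RInt_fct_extend_snd (U := R_NormedModule) (V := R_NormedModule) f a b l H) as H2.
  apply (is_RInt_fct_extend_pair (U := R_NormedModule) (V := R_NormedModule)
    (fun t => Cmult c (f t)) a b (Re (Cmult c l)) (Im (Cmult c l))).
  - apply (is_RInt_minus (V := R_NormedModule) (fun t => fst c * fst (f t)) (fun t => snd c * snd (f t)));
    apply (is_RInt_scal (V := R_NormedModule)); auto.
  - apply (is_RInt_plus (V := R_NormedModule) (fun t => fst c * snd (f t)) (fun t => snd c * fst (f t)));
    apply (is_RInt_scal (V := R_NormedModule)); auto.
Qed.

Lemma is_RIntC_conj f a b l : is_RIntC f a b l ->
  is_RIntC (fun t => Cconj (f t)) a b (Cconj l).
Proof.
  intros H.
  pose proof (is_RInt_fct_extend_fst (U := R_NormedModule) (V := R_NormedModule) f a b l H) as H1.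
  pose proof (is_RInt_fct_extend_snd (U := R_NormedModule) (V := R_NormedModule) f a b l H) as H2.
  apply (is_RInt_fct_extend_pair (U := R_NormedModule) (V := R_NormedModule)
    (fun t => Cconj (f t)) a b (Re (Cconj l)) (Im (Cconj l))).
  - exact H1.
  - apply (is_RInt_opp (V := R_NormedModule) (fun t => snd (f t))). exact H2.
Qed.

Lemma is_RIntC_plus f g a b l m : is_RIntC f a b l -> is_RIntC g a b m ->
  is_RIntC (fun t => Cplus (f t) (g t)) a b (Cplus l m).
Proof. intros; now apply (is_RInt_plus (V := C_R_NormedModule)). Qed.

Lemma is_RIntC_unique f a b l : is_RIntC f a b l -> RIntC f a b = l.
Proof. apply (is_RInt_unique (V := C_R_CompleteNormedModule)). Qed.

Lemma is_RIntC_minus f g a b l m : is_RIntC f a b l -> is_RIntC g a b m ->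
  is_RIntC (fun t => Cminus (f t) (g t)) a b (Cminus l m).
Proof. intros; now apply (is_RInt_minus (V := C_R_NormedModule)). Qed.

Lemma is_RIntC_ext (f g : R -> C) a b l : (forall t, Rmin a b < t < Rmax a b -> f t = g t) ->
  is_RIntC f a b l -> is_RIntC g a b l.
Proof. apply (is_RInt_ext (V := C_R_NormedModule)). Qed.

Lemma is_RIntC_zero f a b : (forall t, Rmin a b < t < Rmax a b -> f t = RtoC 0) ->
  is_RIntC f a b (RtoC 0).
Proof.
  intros H. apply (is_RIntC_ext (fun _ => RtoC 0)); [intros; symmetry; auto|].
  pose proof (is_RInt_const (V := C_R_NormedModule) a b (RtoC 0)) as H0.
  pose proof (scal_zero_r (K := R_AbsRing) (V := C_R_NormedModule) (b - a)) as E.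
  exact (eq_ind _ (is_RIntC (fun _ => RtoC 0) a b) H0 _ E).
Qed.

Lemma norm_C_R (z : C) : norm (V := C_R_NormedModule) z = Cmod z.
Proof.
  unfold norm, Cmod; cbn. unfold prod_norm, norm; cbn. unfold abs; cbn.
  now rewrite !Rmult_1_r, <- !Rabs_mult, !(Rabs_pos_eq (_ * _)) by nra.
Qed.

Lemma Cmod_RIntC_le f a b l M : a <= b -> (forall t, a <= t <= b -> Cmod (f t) <= M) ->
  is_RIntC f a b l -> Cmod l <= (b - a) * M.
Proof.
  intros Hab H Hl. rewrite <- norm_C_R. apply (norm_RInt_le_const (V := C_R_NormedModule) f a b l M); auto.
  intros t Ht. rewrite norm_C_R. auto.
Qed.

Lemma is_RIntC_derive f f' a b : (forall t, is_deriveC f t (f' t)) -> contC f' ->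
  is_RIntC f' a b (Cminus (f b) (f a)).
Proof. intros H Hc. apply (is_RInt_derive (V := C_R_CompleteNormedModule) f f'); auto. Qed.

(** Complex values admit no intermediate point, so the increment is estimated as the integral of the
    derivative. *)
Lemma mean_value_C f f' a b M : (forall t, is_deriveC f t (f' t)) -> contC f' ->
  (forall t, Rmin a b <= t <= Rmax a b -> Cmod (f' t) <= M) ->
  Cmod (Cminus (f b) (f a)) <= Rabs (b - a) * M.
Proof.
  intros H Hc HM. rewrite <- norm_C_R.
  apply (norm_RInt_le_const_abs (V := C_R_NormedModule) f' a b _ M); auto.
  - intros t Ht. rewrite norm_C_R. auto.
  - now apply is_RIntC_derive.
Qed.

Lemma taylor1_C f f1 f2 M : (forall t, is_deriveC f t (f1 t)) ->
  (forall t, is_deriveC f1 t (f2 t)) -> contC f2 -> forall u h,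
  (forall t, Rmin u (u + h) <= t <= Rmax u (u + h) -> Cmod (f2 t) <= M) ->
  Cmod (Cminus (Cminus (f (u + h)) (f u)) (Cmult (RtoC h) (f1 u))) <= M * h ^ 2.
Proof.
  intros H1 H2 Hc u h HM.
  (* Its derivative [f1 s - f1 u] is at most [M * Rabs h] between [u] and [u + h], so two mean value
     estimates give the remainder, with [M] in place of [M / 2]. *)
  set (g := fun s => Cminus (f s) (Cmult (RtoC s) (f1 u))).
  assert (D : forall s, is_deriveC g s (Cminus (f1 s) (f1 u))).
  { intros s. unfold g, Cminus. eapply is_deriveC_ext; [reflexivity| |apply is_deriveC_plus; [apply H1|]].
    2:{ eapply is_deriveC_ext; [| |apply (is_deriveC_mult (fun s => RtoC (- s)) (fun _ => f1 u));
          [apply is_deriveC_RtoC; auto_derive; [auto|reflexivity]|apply is_deriveC_const]].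
        - intros t; cbn beta. rewrite RtoC_opp. ring.
        - reflexivity. }
    cbn beta. rewrite RtoC_opp. ring. }
  assert (Cc1 : contC (fun s => Cminus (f1 s) (f1 u))).
  { apply contC_of_derive with f2. intros s. unfold Cminus.
    eapply is_deriveC_ext; [reflexivity| |apply is_deriveC_plus; [apply H2|apply is_deriveC_const]]. ring. }
  replace (Cminus _ _) with (Cminus (g (u + h)) (g u)).
  2:{ unfold g. rewrite RtoC_plus. ring. }
  replace (M * h ^ 2) with (Rabs (u + h - u) * (M * Rabs h)).
  2:{ replace (u + h - u) with h by ring. rewrite <- (pow2_abs h). ring. }
  apply (mean_value_C g _ u (u + h) (M * Rabs h) D Cc1).
  intros t Ht.
  eapply Rle_trans; [apply (mean_value_C f1 f2 u t M); auto|].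
  { intros v Hv. apply HM. revert Hv Ht. unfold Rmin, Rmax.
    destruct (Rle_dec u (u + h)), (Rle_dec u t); intros; lra. }
  rewrite Rmult_comm. apply Rmult_le_compat_l.
  - eapply Rle_trans; [apply Cmod_ge_0|apply (HM t Ht)].
  - revert Ht. unfold Rmin, Rmax, Rabs. destruct (Rle_dec u (u + h)); repeat destruct Rcase_abs; intros; lra.
Qed.

Lemma is_derive_CC_eps (f : C -> C) z l :
  (forall eps, 0 < eps -> exists delta, 0 < delta /\ forall y, Cmod (Cminus y z) < delta ->
    Cmod (Cminus (Cminus (f y) (f z)) (Cmult (Cminus y z) l)) <= eps * Cmod (Cminus y z)) ->
  is_derive (K := C_AbsRing) (V := C_NormedModule) f z l.
Proof.
  intros H. split.
  - apply (is_linear_scal_l (K := C_AbsRing) (V := C_NormedModule)).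
  - intros x Hx.
    apply (is_filter_lim_locally_unique (K := C_AbsRing) (V := AbsRing_NormedModule C_AbsRing)) in Hx.
    subst x. intros eps. destruct (H eps (cond_pos eps)) as (d & Hd & P).
    exists (mkposreal d Hd). intros y Hy. apply (P y Hy).
Qed.

Lemma is_deriveC_eps (f : R -> C) x l :
  (forall eps, 0 < eps -> exists delta, 0 < delta /\ forall y, Rabs (y - x) < delta ->
    Cmod (Cminus (Cminus (f y) (f x)) (Cmult (RtoC (y - x)) l)) <= eps * Rabs (y - x)) ->
  is_deriveC f x l.
Proof.
  intros H. split.
  - apply (is_linear_scal_l (K := R_AbsRing) (V := C_R_NormedModule)).
  - intros x' Hx. apply (is_filter_lim_locally_unique (K := R_AbsRing) (V := R_NormedModule)) in Hx. subst x'.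
    intros eps. destruct (H eps (cond_pos eps)) as (d & Hd & P).
    exists (mkposreal d Hd). intros y Hy. specialize (P y Hy).
    rewrite norm_C_R. change (norm (minus y x)) with (Rabs (y - x)).
    change (minus (minus (f y) (f x)) (scal (minus y x) l)) with (Cminus (Cminus (f y) (f x)) (scal (y - x) (l : C_R_NormedModule))).
    replace (scal (y - x) (l : C_R_NormedModule)) with (Cmult (RtoC (y - x)) l); auto.
    apply C_eq; unfold scal; cbn; unfold scal; cbn; unfold mult, Re, Im; cbn; ring.
Qed.

(** * Definite subspaces and perturbation of forms *)

Lemma Csum_ext c d n :
  (forall i, (i < n)%nat -> c i = d i) -> Csum c n = Csum d n.
Proof.
  induction n as [|n IH]; intros H; cbn; auto.
  rewrite IH, H; auto with arith.
Qed.

Lemma Csum_plus c d n :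
  Csum (fun i => Cplus (c i) (d i)) n = Cplus (Csum c n) (Csum d n).
Proof. induction n as [|n IH]; cbn; [ring|]. rewrite IH; ring. Qed.

Lemma Csum_scal a c n :
  Csum (fun i => Cmult a (c i)) n = Cmult a (Csum c n).
Proof. induction n as [|n IH]; cbn; [ring|]. rewrite IH; ring. Qed.

Lemma Csum_zero n : Csum (fun _ => RtoC 0) n = RtoC 0.
Proof. induction n as [|n IH]; cbn; [ring|]. rewrite IH; ring. Qed.

Lemma Csum_single c n i : (i < n)%nat ->
  (forall j, (j < n)%nat -> j <> i -> c j = RtoC 0) -> Csum c n = c i.
Proof.
  induction n as [|n IH]; intros Hi H; [lia|]. cbn.
  destruct (Nat.eq_dec i n) as [->|Hn].
  - rewrite (Csum_ext c (fun _ => RtoC 0)), Csum_zero; [ring|].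
    intros j Hj; apply H; lia.
  - rewrite IH by (auto; try lia; intros; apply H; lia).
    rewrite (H n) by lia. ring.
Qed.

Fixpoint Rsum (c : nat -> R) (n : nat) : R :=
  match n with O => 0 | S m => Rsum c m + c m end.

Lemma Rsum_le c d n :
  (forall i, (i < n)%nat -> c i <= d i) -> Rsum c n <= Rsum d n.
Proof.
  induction n as [|n IH]; intros H; cbn; [lra|].
  specialize (IH ltac:(auto with arith)). specialize (H n ltac:(lia)). lra.
Qed.

Lemma Rsum_scal a c n : Rsum (fun i => a * c i) n = a * Rsum c n.
Proof. induction n as [|n IH]; cbn; [ring|]. rewrite IH; ring. Qed.

Lemma Rsum_nonneg c n : (forall i, 0 <= c i) -> 0 <= Rsum c n.
Proof. intros H; induction n as [|n IH]; cbn; [lra|]. specialize (H n); lra. Qed.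

Lemma Rsum_pos c n i : (forall j, 0 <= c j) -> (i < n)%nat -> 0 < c i -> 0 < Rsum c n.
Proof.
  intros H Hi Hc; induction n as [|n IH]; [lia|]. cbn.
  pose proof (Rsum_nonneg c n H). pose proof (H n).
  destruct (Nat.eq_dec i n) as [->|Hn]; [lra|]. specialize (IH ltac:(lia)); lra.
Qed.

(** Cauchy-Schwarz against the constant vector. [H] sums [(a - c i) ^ 2 >= 0]; with [a = c n] it
    absorbs the cross term of the induction step. *)
Lemma Rsum_sqr c n : (Rsum c n) ^ 2 <= INR n * Rsum (fun i => c i ^ 2) n.
Proof.
  assert (H : forall a m, 2 * a * Rsum c m <= Rsum (fun i => c i ^ 2) m + INR m * a ^ 2).
  { intros a m; induction m as [|m IH]; [cbn; lra|].
    cbn [Rsum]. rewrite S_INR. pose proof (pow2_ge_0 (a - c m)). nra. }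
  induction n as [|n IH]; [cbn; lra|].
  cbn [Rsum]. rewrite S_INR. specialize (H (c n) n). nra.
Qed.

Lemma Cmod_Csum c n : Cmod (Csum c n) <= Rsum (fun i => Cmod (c i)) n.
Proof.
  induction n as [|n IH]; cbn; [rewrite Cmod_0; lra|].
  eapply Rle_trans; [apply Cmod_triangle|]. lra.
Qed.

Lemma Re_Csum c n : Re (Csum c n) = Rsum (fun i => Re (c i)) n.
Proof. induction n as [|n IH]; cbn; auto. now rewrite <- IH. Qed.

Definition comb (n : nat) (c : nat -> C) (e : nat -> R -> C) : R -> C :=
  fun x => Csum (fun i => Cmult (c i) (e i x)) n.

Lemma comb_mem M n c e : linear_set M ->
  (forall i, (i < n)%nat -> M (e i)) -> M (comb n c e).
Proof.
  intros [M0 [Mp Ms]]; unfold comb; induction n as [|n IH]; intros H; cbn; auto.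
  apply Mp; [apply IH; auto with arith | apply Ms; auto with arith].
Qed.

(** Antilinear in the first argument because [sigma0] is antilinear and is evaluated at T f times
    the conjugate of T g. *)
Definition sesquilinear (D : (R -> C) -> Prop) (B : (R -> C) -> (R -> C) -> C) : Prop :=
  (forall f g h, D f -> D g -> D h ->
     B (fun x => Cplus (f x) (g x)) h = Cplus (B f h) (B g h)) /\
  (forall f g h, D f -> D g -> D h ->
     B h (fun x => Cplus (f x) (g x)) = Cplus (B h f) (B h g)) /\
  (forall a f h, D f -> D h ->
     B (fun x => Cmult a (f x)) h = Cmult (Cconj a) (B f h)) /\
  (forall a f h, D f -> D h ->
     B h (fun x => Cmult a (f x)) = Cmult a (B h f)).

Lemma Cmult_0_fun (f : R -> C) : (fun x => Cmult (RtoC 0) (f x)) = (fun _ => RtoC 0).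
Proof. apply functional_extensionality; intros; cbn beta; ring. Qed.

Lemma sesquilinear_comb_l D B n c e h : linear_set D -> sesquilinear D B -> D h ->
  (forall i, (i < n)%nat -> D (e i)) ->
  B (comb n c e) h = Csum (fun i => Cmult (Cconj (c i)) (B (e i) h)) n.
Proof.
  intros LD (Bp & _ & Bs & _) Dh; induction n as [|n IH]; intros He.
  - unfold comb; cbn. rewrite <- (Cmult_0_fun h), Bs by auto.
    apply C_eq; cbn; unfold Re, Im; ring.
  - cbn [Csum]. rewrite <- IH by auto with arith. rewrite <- Bs by auto with arith.
    rewrite <- Bp; auto.
    + apply comb_mem; auto with arith.
    + apply LD; auto with arith.
Qed.

Lemma sesquilinear_comb_r D B n c e h : linear_set D -> sesquilinear D B -> D h ->
  (forall i, (i < n)%nat -> D (e i)) ->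
  B h (comb n c e) = Csum (fun i => Cmult (c i) (B h (e i))) n.
Proof.
  intros LD (_ & Bp & _ & Bs) Dh; induction n as [|n IH]; intros He.
  - unfold comb; cbn. rewrite <- (Cmult_0_fun h), Bs by auto.
    apply C_eq; cbn; unfold Re, Im; ring.
  - cbn [Csum]. rewrite <- IH by auto with arith. rewrite <- Bs by auto with arith.
    rewrite <- Bp; auto.
    + apply comb_mem; auto with arith.
    + apply LD; auto with arith.
Qed.

(** Polarization: reality at [f + a g] makes [a B(f,g) + conj(a) B(g,f)] real for every [a]; the
    values 1 and [Ci] of [a] suffice. *)
Lemma sesquilinear_hermitian D B : linear_set D -> sesquilinear D B ->
  (forall f, D f -> Im (B f f) = 0) ->
  forall f g, D f -> D g -> B g f = Cconj (B f g).
Proof.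
  intros LD SB Hr f g Df Dg.
  assert (H : forall a, Im (Cplus (Cmult a (B f g)) (Cmult (Cconj a) (B g f))) = 0).
  { intros a. pose proof (proj2 (proj2 LD) a g Dg) as Dag.
    pose proof (Hr _ (proj1 (proj2 LD) f _ Df Dag)) as E.
    destruct SB as (B1 & B2 & B3 & B4).
    rewrite B1 in E by (auto; apply LD; auto). rewrite !B2, !B3, !B4 in E by auto.
    pose proof (Hr f Df) as E1. pose proof (Hr _ Dag) as E2.
    rewrite B4, B3 in E2 by auto.
    revert E E1 E2. 
    cbn; unfold Re, Im; cbn. lra. }
  pose proof (H (RtoC 1)) as H1. pose proof (H Ci) as H2.
  revert H1 H2. cbn; unfold Re, Im; cbn. intros.
  apply C_eq; cbn; unfold Re, Im; lra.
Qed.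

Lemma positive_subset s q M M' :
  (forall f, M' f -> M f) -> form_positive s q M -> form_positive s q M'.
Proof. intros H P f Hf. apply P; auto. Qed.

(** Gram-Schmidt: split off [w = v n] and pass to its orthogonal complement in [M]. Projecting along
    [w] needs [B w w <> 0], which definiteness gives, and leaves [n] independent vectors. *)
Lemma orthogonal_family D B s : linear_set D -> sesquilinear D B ->
  (forall f, D f -> Im (B f f) = 0) ->
  forall n M, linear_set M -> (forall f, M f -> D f) ->
  form_positive s (fun f => B f f) M -> dim_ge M n ->
  exists e : nat -> R -> C,
    (forall i, (i < n)%nat -> M (e i) /\ exists x, e i x <> RtoC 0) /\
    (forall i j, (i < n)%nat -> (j < n)%nat -> i <> j -> B (e i) (e j) = RtoC 0).
Proof.
  intros LD SB Hr n; induction n as [|n IH]; intros M LM MD PM (v & Mv & Iv).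
  { exists v; split; intros; lia. }
  set (w := v n).
  assert (Mw : M w) by (apply Mv; lia).
  (* Otherwise the relation with coefficient 1 at [n] and 0 elsewhere contradicts independence. *)
  assert (Hw : exists x, w x <> RtoC 0).
  { apply not_all_ex_not. intros Hw.
    assert (E : RtoC 1 = RtoC 0).
    { pose proof (Iv (fun i => if Nat.eq_dec i n then RtoC 1 else RtoC 0)) as E'.
      cbn beta in E'.
      assert (Hs : forall x, Csum (fun i => Cmult
         (if Nat.eq_dec i n then RtoC 1 else RtoC 0) (v i x)) (S n) = RtoC 0).
      { intros x. rewrite (Csum_single _ (S n) n); [|lia|].
        - cbn beta. change (v n x) with (w x). rewrite Hw. ring.
        - intros j _ Hj. destruct (Nat.eq_dec j n); [contradiction|ring]. }
      specialize (E' Hs n ltac:(lia)). destruct (Nat.eq_dec n n); [auto|contradiction]. }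
    apply (f_equal Re) in E. cbn in E. lra. }
  set (b := B w w).
  assert (Hb : b <> RtoC 0).
  { intros E. destruct (PM w Mw Hw) as [_ P]. fold b in P. rewrite E in P. cbn in P. lra. }
  (* Only [B w f = 0] is recorded; [B f w = 0] follows by hermitian symmetry. *)
  set (M' := fun f => M f /\ B w f = RtoC 0).
  assert (SB' := SB). destruct SB as (B1 & B2 & B3 & B4).
  assert (LM' : linear_set M').
  { destruct LM as (L0 & L1 & L2). repeat split; auto.
    - rewrite <- (Cmult_0_fun w), B4 by auto. ring.
    - apply L1; [apply H | apply H0].
    - destruct H, H0. rewrite B2, H1, H2 by auto. ring.
    - apply L2, H.
    - destruct H. rewrite B4, H0 by auto. ring. }
  assert (PM' : form_positive s (fun f => B f f) M')
    by (apply (positive_subset _ _ M); auto; intros f [? _]; auto).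
  set (t := fun i => Copp (Cdiv (B w (v i)) b)).
  assert (DM' : dim_ge M' n).
  { exists (fun i x => Cplus (v i x) (Cmult (t i) (w x))). split.
    - intros i Hi. pose proof (Mv i ltac:(lia)) as Mi.
      destruct LM as (L0 & L1 & L2). split.
      + apply L1; auto.
      + rewrite B2, B4 by auto. fold b. unfold t. field. auto.
    - intros c Hc i Hi.
      (* A relation among the projected vectors is a relation among [v 0, ..., v n]: the multiples
         of [w] collect into the coefficient of [v n]. *)
      set (d := fun i => if Nat.eq_dec i n then Csum (fun i => Cmult (c i) (t i)) n else c i).
      assert (Ed : forall j, (j < n)%nat -> d j = c j).
      { intros j Hj; unfold d. destruct (Nat.eq_dec j n); [lia|auto]. }
      rewrite <- Ed by auto. apply Iv; [|lia].
      intros x. cbn [Csum].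
      rewrite (Csum_ext _ (fun i => Cmult (c i) (v i x))) by (intros; rewrite Ed; auto).
      unfold d at 1. destruct (Nat.eq_dec n n); [|contradiction].
      rewrite <- (Hc x). fold w. rewrite Cmult_comm, <- Csum_scal, <- Csum_plus.
      apply Csum_ext. intros; cbn beta; ring. }
  destruct (IH M' LM' ltac:(intros f [? _]; auto) PM' DM') as (e & He & Oe).
  exists (fun i => if Nat.eq_dec i n then w else e i). split.
  - intros i Hi. destruct (Nat.eq_dec i n); [auto|].
    destruct (He i ltac:(lia)) as [[? _] ?]. auto.
  - intros i j Hi Hj Hij.
    destruct (Nat.eq_dec i n), (Nat.eq_dec j n); try lia.
    + apply He; lia.
    + destruct (He i ltac:(lia)) as [[? E] ?].
      rewrite (sesquilinear_hermitian D B LD SB' Hr w (e i)), E by auto.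
      apply C_eq; cbn; unfold Re, Im; cbn; ring.
    + apply Oe; lia.
Qed.

Lemma uniform_positive (d : nat -> R) n :
  (forall i, (i < n)%nat -> 0 < d i) ->
  exists m, 0 < m /\ forall i, (i < n)%nat -> m <= d i.
Proof.
  induction n as [|n IH]; intros H; [exists 1; split; [lra | intros; lia]|].
  destruct IH as (m & Hm & Hd); auto with arith.
  exists (Rmin m (d n)). split; [apply Rmin_pos; auto|].
  intros i Hi. destruct (Nat.eq_dec i n) as [->|]; [apply Rmin_r|].
  eapply Rle_trans; [apply Rmin_l|]. apply Hd; lia.
Qed.

(* Diagonal dominance: the Gram matrix of [g] is a small perturbation of a
   definite diagonal matrix. *)
Lemma perturbed_diagonal_positive D B' s n g (b : nat -> C) d eps c :
  linear_set D -> sesquilinear D B' -> Rabs s = 1 ->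
  (forall i, (i < n)%nat -> D (g i)) ->
  (forall i, (i < n)%nat -> Im (b i) = 0 /\ d <= s * Re (b i)) ->
  (forall i j, (i < n)%nat -> (j < n)%nat ->
     Cmod (Cminus (B' (g i) (g j)) (if Nat.eq_dec i j then b i else RtoC 0)) <= eps) ->
  0 <= eps -> INR n * eps < d ->
  (exists i, (i < n)%nat /\ c i <> RtoC 0) ->
  0 < s * Re (B' (comb n c g) (comb n c g)).
Proof.
  intros LD SB Hs Dg Hb He Heps Hd (i0 & Hi0 & Hc0).
  set (S1 := Rsum (fun i => Cmod (c i)) n).
  set (S2 := Rsum (fun i => Cmod (c i) ^ 2) n).
  assert (HS2 : 0 < S2).
  { apply (Rsum_pos _ n i0); auto. intros; apply pow2_ge_0.
    apply pow_lt. now apply Cmod_gt_0. }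
  assert (HS1 : S1 ^ 2 <= INR n * S2) by apply Rsum_sqr.
  assert (HS1' : 0 <= S1) by (apply Rsum_nonneg; intros; apply Cmod_ge_0).
  set (T := Csum (fun i => Cmult (Cconj (c i)) (Cmult (c i) (b i))) n).
  assert (HT : d * S2 <= s * Re T).
  { unfold T. rewrite Re_Csum. unfold S2. rewrite <- !Rsum_scal.
    apply Rsum_le. intros i Hi. destruct (Hb i Hi) as [Hi1 Hi2].
    rewrite Cmod2_alt.
    replace (Re (Cmult (Cconj (c i)) (Cmult (c i) (b i)))) with
      ((Re (c i) ^ 2 + Im (c i) ^ 2) * Re (b i)).
    2:{ cbn. unfold Re, Im in *. rewrite Hi1. cbn. ring. }
    pose proof (pow2_ge_0 (Re (c i))). pose proof (pow2_ge_0 (Im (c i))). nra. }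
  (* An entrywise error [eps] contributes [eps * S1 ^ 2], at most [INR n * eps * S2] by [HS1], which
     is less than the [d * S2] provided by the diagonal form [T]. *)
  assert (HE : Cmod (Cminus (B' (comb n c g) (comb n c g)) T) <= eps * S1 ^ 2).
  { assert (Dc : D (comb n c g)) by (apply comb_mem; auto).
    rewrite (sesquilinear_comb_l D B') by auto. unfold T.
    replace (Cminus _ _) with (Csum (fun i => Cmult (Cconj (c i))
      (Cminus (B' (g i) (comb n c g)) (Cmult (c i) (b i)))) n).
    2:{ unfold Cminus at 2.
        replace (Copp (Csum (fun i => Cmult (Cconj (c i)) (Cmult (c i) (b i))) n)) with
        (Cmult (Copp (RtoC 1)) (Csum (fun i => Cmult (Cconj (c i)) (Cmult (c i) (b i))) n)) by ring.
        rewrite <- Csum_scal, <- Csum_plus. apply Csum_ext; intros; cbn beta; ring. }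
    eapply Rle_trans; [apply Cmod_Csum|].
    replace (eps * S1 ^ 2) with ((eps * S1) * S1) by ring.
    unfold S1 at 2. rewrite <- Rsum_scal. apply Rsum_le. intros i Hi.
    rewrite Cmod_mult, Cmod_conj, Rmult_comm.
    apply Rmult_le_compat_r; [apply Cmod_ge_0|].
    rewrite (sesquilinear_comb_r D B') by auto.
    replace (Cminus _ _) with (Csum (fun j => Cmult (c j)
      (Cminus (B' (g i) (g j)) (if Nat.eq_dec i j then b i else RtoC 0))) n).
    2:{ transitivity (Cplus (Csum (fun j => Cmult (c j) (B' (g i) (g j))) n)
          (Cmult (Copp (RtoC 1)) (Csum (fun j => Cmult (c j)
             (if Nat.eq_dec i j then b i else RtoC 0)) n))).
        - rewrite <- Csum_scal, <- Csum_plus. apply Csum_ext; intros; cbn beta; ring.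
        - rewrite (Csum_single (fun j => Cmult (c j) (if Nat.eq_dec i j then b i else RtoC 0)) n i); auto.
          + cbn beta. destruct (Nat.eq_dec i i); [ring|contradiction].
          + intros j _ Hj. cbn beta. destruct (Nat.eq_dec i j); [congruence|ring]. }
    eapply Rle_trans; [apply Cmod_Csum|].
    unfold S1. rewrite <- Rsum_scal. apply Rsum_le. intros j Hj.
    rewrite Cmod_mult, Rmult_comm.
    apply Rmult_le_compat_r; [apply Cmod_ge_0|]. auto. }
  set (Q := B' (comb n c g) (comb n c g)) in *.
  pose proof (re_le_Cmod (Cminus Q T)) as HR.
  replace (Re (Cminus Q T)) with (Re Q - Re T) in HR by reflexivity.
  assert (HR' : Rabs (s * (Re Q - Re T)) <= eps * S1 ^ 2).
  { rewrite Rabs_mult, Hs. lra. }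
  apply Rabs_le_between in HR'.
  assert (eps * S1 ^ 2 <= eps * (INR n * S2)) by (apply Rmult_le_compat_l; auto).
  nra.
Qed.

(** No topology enters: the approximants have to reproduce only the finite Gram matrix of an
    orthogonal family. *)
Lemma inertia_transfer D B B' q q' s : linear_set D ->
  sesquilinear D B -> sesquilinear D B' ->
  (forall f, D f -> q f = B f f) -> (forall f, D f -> q' f = B' f f) ->
  (forall f, D f -> Im (B f f) = 0) -> (forall f, D f -> Im (B' f f) = 0) ->
  Rabs s = 1 ->
  (forall n e eps, 0 < eps -> (forall i, (i < n)%nat -> D (e i)) ->
    exists g, (forall i, (i < n)%nat -> D (g i)) /\
      forall i j, (i < n)%nat -> (j < n)%nat ->
        Cmod (Cminus (B' (g i) (g j)) (B (e i) (e j))) <= eps) ->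
  forall n M, linear_set M -> (forall f, M f -> D f) -> form_positive s q M -> dim_ge M n ->
  exists M', linear_set M' /\ (forall f, M' f -> D f) /\ form_positive s q' M' /\ dim_ge M' n.
Proof.
  intros LD SB SB' Eq Eq' Rq Rq' Hs App n M LM MD PM DM.
  assert (PM' : form_positive s (fun f => B f f) M).
  { intros f Mf Hf. rewrite <- Eq by auto. apply PM; auto. }
  destruct (orthogonal_family D B s LD SB Rq n M LM MD PM' DM) as (e & He & Oe).
  destruct (uniform_positive (fun i => s * Re (B (e i) (e i))) n) as (d & Hd & Hde).
  { intros i Hi. destruct (He i Hi) as [Me Ne]. apply (PM' (e i) Me Ne). }
  pose proof (pos_INR n) as Hn.
  (* The [+ 1] covers [n = 0]; in all cases [INR n * eps <= d / 2]. *)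
  set (eps := d / (2 * (INR n + 1))).
  assert (Heps : 0 < eps) by (unfold eps; apply Rdiv_lt_0_compat; lra).
  assert (Hne : INR n * eps < d).
  { assert (E : eps * (2 * (INR n + 1)) = d) by (unfold eps; field; lra). nra. }
  destruct (App n e eps Heps) as (g & Dg & Ag).
  { intros i Hi. apply MD. now apply He. }
  (* Positivity is stated in terms of the coefficients, before [g] is known to be independent: it
     yields the definiteness of the span as well as the independence. *)
  assert (Pos : forall c, (exists i, (i < n)%nat /\ c i <> RtoC 0) ->
    0 < s * Re (B' (comb n c g) (comb n c g))).
  { intros c Hc.
    apply (perturbed_diagonal_positive D B' s n g (fun i => B (e i) (e i)) d eps c); auto; try lra.
    - intros i Hi. split; [|apply Hde; auto]. apply Rq, MD. now apply He.
    - intros i j Hi Hj. destruct (Nat.eq_dec i j) as [<-|Hij]; auto.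
      rewrite <- (Oe i j) by auto. auto. }
  exists (fun f => exists c, f = comb n c g). split; [|split; [|split]].
  - split; [|split].
    + exists (fun _ => RtoC 0). apply functional_extensionality; intros x. unfold comb.
      rewrite Csum_scal. ring.
    + intros f1 f2 (c1 & ->) (c2 & ->). exists (fun i => Cplus (c1 i) (c2 i)).
      apply functional_extensionality; intros x. unfold comb.
      rewrite <- Csum_plus. apply Csum_ext; intros; cbn beta; ring.
    + intros a f1 (c1 & ->). exists (fun i => Cmult a (c1 i)).
      apply functional_extensionality; intros x. unfold comb.
      rewrite <- Csum_scal. apply Csum_ext; intros; cbn beta; ring.
  - intros f (c & ->). apply comb_mem; auto.
  - intros f (c & ->) (x & Hx).
    assert (Dc : D (comb n c g)) by (apply comb_mem; auto).
    rewrite Eq' by auto. split; [auto|]. apply Pos.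
    apply NNPP. intros Hc. apply Hx. unfold comb.
    rewrite (Csum_ext _ (fun _ => RtoC 0)); [apply Csum_zero|].
    intros i Hi. destruct (classic (c i = RtoC 0)) as [->|Hci]; [ring|].
    exfalso; apply Hc; eauto.
  - exists g. split.
    + intros i Hi. exists (fun j => if Nat.eq_dec j i then RtoC 1 else RtoC 0).
      apply functional_extensionality; intros x. unfold comb.
      rewrite (Csum_single _ n i); auto.
      * destruct (Nat.eq_dec i i); [ring|contradiction].
      * intros j _ Hj. destruct (Nat.eq_dec j i); [contradiction|ring].
    + intros c Hc i Hi. apply NNPP. intros Hci.
      pose proof (Pos c (ex_intro _ i (conj Hi Hci))) as P.
      (* A vanishing combination equals 0 times itself, so the form is zero on it, contrary to
         [P]. *)
      assert (E : comb n c g = (fun x => Cmult (RtoC 0) (comb n c g x))).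
      { apply functional_extensionality; intros x. unfold comb at 1. rewrite Hc. ring. }
      assert (Dc : D (comb n c g)) by (apply comb_mem; auto).
      destruct SB' as (_ & _ & B3 & _).
      rewrite E, B3 in P by (auto; rewrite <- E; auto).
      cbn in P. lra.
Qed.

(** * The spaces S_gamma *)

(** The tangent of ln at [/ eps], from [exp y >= 1 + y] at [y = ln (eps * z)]. *)
Lemma ln_le_linear z eps : 0 < z -> 0 < eps -> ln z <= eps * z - 1 - ln eps.
Proof.
  intros Hz He. pose proof (exp_ineq1_le (ln (eps * z))) as H.
  rewrite exp_ln in H by nra. rewrite ln_mult in H by auto. lra.
Qed.

Lemma Sweight_exp gamma kappa k x : Sweight gamma kappa k x =
  exp ((gamma - 1 / 2 - INR k) * ln x - kappa * ln (1 + Rabs (ln x))).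
Proof. unfold Sweight, Rpower. rewrite <- exp_plus. f_equal. ring. Qed.

Lemma Sweight_pos gamma kappa k x : 0 < Sweight gamma kappa k x.
Proof. rewrite Sweight_exp. apply exp_pos. Qed.

Lemma exp_INR_mult k y : exp (INR k * y) = exp y ^ k.
Proof.
  induction k as [|k IH]; [rewrite Rmult_0_l; apply exp_0|].
  rewrite S_INR. cbn [pow]. rewrite <- IH, <- exp_plus. f_equal; ring.
Qed.

(** The order enters only through a power of [/ x], so weighted bounds are geometric in the order,
    as [prodjet_bound] wants. *)
Lemma Sweight_k gamma kappa k x : 0 < x ->
  Sweight gamma kappa k x = Sweight gamma kappa 0 x * (/ x) ^ k.
Proof.
  intros Hx. rewrite !Sweight_exp.
  replace (/ x) with (exp (- ln x)) by (rewrite exp_Ropp, exp_ln; auto).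
  rewrite <- exp_INR_mult, <- exp_plus. f_equal. cbn [INR]. ring.
Qed.

(** Each weight carries the exponent shift -1/2 and the product must carry it once, whence
    [a + b - 1 / 2]; this is 0 for [a = b = 1 / 4]. *)
Lemma Sweight_mult a b kappa kappa' x :
  Sweight a kappa 0 x * Sweight b kappa' 0 x = Sweight (a + b - 1 / 2) (kappa + kappa') 0 x.
Proof. rewrite !Sweight_exp, <- exp_plus. f_equal. change (INR 0) with 0. field. Qed.

Lemma Sweight_succ_kappa gamma kappa k x :
  Sweight gamma (kappa + 1) k x = Sweight gamma kappa k x * / (1 + Rabs (ln x)).
Proof.
  pose proof (Rabs_pos (ln x)).
  rewrite !Sweight_exp.
  replace (/ (1 + Rabs (ln x))) with (exp (- ln (1 + Rabs (ln x))))
    by (rewrite exp_Ropp, exp_ln; auto; lra).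
  rewrite <- exp_plus. f_equal. ring.
Qed.

(** The exponent of the weight is [- d < 0]: near 0 the weight blows up, while near infinity the
    exponential wins. In [s = ln x] the logarithmic factor is first absorbed into [d * Rabs s]. *)
Lemma exp_le_Sweight c gamma kappa k : 0 < c -> gamma < 1 / 2 + INR k ->
  exists A, 0 < A /\ forall x, 0 < x -> exp (- c * x) <= A * Sweight gamma kappa k x.
Proof.
  intros Hc Hg.
  set (d := 1 / 2 + INR k - gamma).
  assert (Hd : 0 < d) by (unfold d; lra).
  pose proof (Rabs_pos kappa) as Hk.
  (* Chosen so that [Rabs kappa * e <= d]. *)
  set (e := d / (Rabs kappa + 1)).
  assert (He : 0 < e) by (unfold e; apply Rdiv_lt_0_compat; lra).
  (* The sum [d * s + d * Rabs s] is 0 for [s <= 0] and [2 * d * s] otherwise; this slope satisfies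
     [2 * d * e' = c]. *)
  set (e' := c / (2 * d)).
  assert (He' : 0 < e') by (unfold e'; apply Rdiv_lt_0_compat; lra).
  set (A1 := Rabs kappa * Rabs (e - 1 - ln e)).
  set (A2 := 2 * d * Rabs (- 1 - ln e')).
  exists (exp (A1 + A2)). split; [apply exp_pos|]. intros x Hx.
  rewrite Sweight_exp, <- exp_plus.
  apply exp_le.
  set (s := ln x). pose proof (Rabs_pos s) as Hs.
  assert (H1 : kappa * ln (1 + Rabs s) <= d * Rabs s + A1).
  { assert (L0 : 0 <= ln (1 + Rabs s)).
    { rewrite <- ln_1. destruct Hs as [Hs| <-]; [left; apply ln_increasing; lra|].
      right; f_equal; ring. }
    assert (L1 : ln (1 + Rabs s) <= e * (1 + Rabs s) - 1 - ln e) by (apply ln_le_linear; lra).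
    pose proof (Rle_abs (e - 1 - ln e)). pose proof (Rle_abs kappa).
    assert (kappa * ln (1 + Rabs s) <= Rabs kappa * (e * Rabs s + Rabs (e - 1 - ln e))).
    { apply Rle_trans with (Rabs kappa * ln (1 + Rabs s)).
      - apply Rmult_le_compat_r; auto.
      - apply Rmult_le_compat_l; auto. lra. }
    assert (E : e * (Rabs kappa + 1) = d) by (unfold e; field; lra).
    unfold A1. nra. }
  assert (H2 : - c * x + d * s + d * Rabs s <= A2).
  { assert (L : s <= e' * x - 1 - ln e') by (apply ln_le_linear; auto).
    pose proof (Rle_abs (-1 - ln e')).
    assert (E : e' * (2 * d) = c) by (unfold e'; field; lra).
    assert (0 <= A2) by (unfold A2; pose proof (Rabs_pos (-1 - ln e')); nra).
    destruct (Rle_dec 0 s).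
    - rewrite Rabs_pos_eq by auto. unfold A2 in *. nra.
    - rewrite Rabs_left by lra. nra. }
  replace (gamma - 1 / 2 - INR k) with (- d) by (unfold d; ring). lra.
Qed.

Lemma compact_bounded f a b k : smooth f -> a <= b -> vanishes_outside f a b ->
  exists M, 0 <= M /\ forall t, Cmod (CDerive_n f k t) <= M.
Proof.
  intros S Hab V.
  apply contC_bounded with a b; auto using smooth_contC, CDerive_n_vanishes.
Qed.

(** A class containing the test functions and their Laplace transforms: boundedness at 0 and one
    exponential rate for all orders, which gives S_gamma for every gamma < 1/2. *)
Definition rapid (f : R -> C) : Prop := smooth f /\
  exists c, 0 < c /\ forall k, exists A, forall x, 0 < x ->
    Cmod (CDerive_n f k x) <= A * exp (- c * x).

Lemma Cc_rapid f : Cc f -> rapid f.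
Proof.
  intros (S & a & b & Hab & V). split; auto. exists 1; split; [lra|]. intros k.
  destruct (compact_bounded f a b k S ltac:(lra) V) as (M & HM & H).
  exists (M * exp b). intros x Hx.
  destruct (Rlt_dec b x) as [Hb|Hb].
  - rewrite (CDerive_n_vanishes f a b k V), Cmod_0 by auto.
    apply Rmult_le_pos; [apply Rmult_le_pos|]; auto; left; apply exp_pos.
  - eapply Rle_trans; [apply H|]. rewrite Rmult_assoc, <- exp_plus.
    pose proof (exp_ineq1_le (b + Ropp 1 * x)). nra.
Qed.

Lemma rapid_Sgam gamma f : gamma < 1 / 2 -> rapid f -> Sgam gamma f.
Proof.
  intros Hg (S & c & Hc & H). split; [intros k x _; apply S; exact I|]. intros kappa k.
  destruct (H k) as (A & HA).
  destruct (exp_le_Sweight c gamma kappa k Hc) as (B & HB & HE).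
  { pose proof (pos_INR k); lra. }
  exists (Rabs A * B). intros x Hx. eapply Rle_trans; [now apply HA|].
  pose proof (exp_pos (- c * x)). pose proof (Rle_abs A). pose proof (Rabs_pos A).
  specialize (HE x Hx). rewrite Rmult_assoc.
  eapply Rle_trans with (Rabs A * exp (- c * x)); [nra|]. apply Rmult_le_compat_l; auto.
Qed.

(** [Sgam] constrains functions on the half-line only; smoothness on the whole line lets the rules
    for [CDerive_n] apply without a domain. *)
Definition smooth_Sgam (gamma : R) (f : R -> C) : Prop := smooth f /\ Sgam gamma f.

Lemma uniform_upto (P : nat -> R -> Prop) :
  (forall j A A', A <= A' -> P j A -> P j A') ->
  (forall j, exists A, P j A) ->
  forall k, exists A, 0 <= A /\ forall j, (j <= k)%nat -> P j A.
Proof.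
  intros Mono Ex k; induction k as [|k (A & HA & IH)].
  - destruct (Ex O) as (A & HA). exists (Rabs A). split; [apply Rabs_pos|].
    intros j Hj. replace j with O by lia. apply (Mono _ A); auto. apply Rle_abs.
  - destruct (Ex (S k)) as (A' & HA').
    exists (Rmax A A'). split; [eapply Rle_trans; [apply HA|apply Rmax_l]|].
    intros j Hj. destruct (Nat.eq_dec j (S k)) as [->|].
    + apply (Mono _ A'); auto. apply Rmax_r.
    + apply (Mono _ A); [apply Rmax_l|]. apply IH; lia.
Qed.

Lemma mult_Sweight_bound f g a b kappa kappa' k A B x : smooth f -> smooth g ->
  0 < x -> 0 <= A -> 0 <= B ->
  (forall j, (j <= k)%nat -> Cmod (CDerive_n f j x) <= A * Sweight a kappa j x) ->
  (forall j, (j <= k)%nat -> Cmod (CDerive_n g j x) <= B * Sweight b kappa' j x) ->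
  Cmod (CDerive_n (fun x => Cmult (f x) (g x)) k x) <=
    2 ^ k * (A * B) * Sweight (a + b - 1 / 2) (kappa + kappa') k x.
Proof.
  intros Sf Sg Hx HA HB Hf Hg.
  rewrite (proj2 (smooth_mult f g Sf Sg)), Sweight_k, <- Sweight_mult by auto.
  pose proof (Sweight_pos a kappa 0 x). pose proof (Sweight_pos b kappa' 0 x).
  replace (2 ^ k * (A * B) * (Sweight a kappa 0 x * Sweight b kappa' 0 x * (/ x) ^ k))
   with (2 ^ k * ((A * Sweight a kappa 0 x) * (B * Sweight b kappa' 0 x)) * (/ x) ^ k) by ring.
  apply prodjet_bound.
  - apply Rmult_le_pos; lra.
  - apply Rmult_le_pos; lra.
  - left. now apply Rinv_0_lt_compat.
  - intros j Hj. rewrite Rmult_assoc, <- Sweight_k by auto. auto.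
  - intros j Hj. rewrite Rmult_assoc, <- Sweight_k by auto. auto.
Qed.

Lemma Sgam_bound_upto gamma f kappa k : Sgam gamma f ->
  exists A, 0 <= A /\ forall j, (j <= k)%nat -> forall x, 0 < x ->
    Cmod (CDerive_n f j x) <= A * Sweight gamma kappa j x.
Proof.
  intros [_ H].
  apply (uniform_upto (fun j A => forall x, 0 < x ->
    Cmod (CDerive_n f j x) <= A * Sweight gamma kappa j x)); [|auto].
  intros j A A' HA P x Hx. eapply Rle_trans; [now apply P|].
  pose proof (Sweight_pos gamma kappa j x). nra.
Qed.

Lemma smooth_Sgam_mult a b f g : smooth_Sgam a f -> smooth_Sgam b g ->
  smooth_Sgam (a + b - 1 / 2) (fun x => Cmult (f x) (g x)).
Proof.
  intros [Sf Hf] [Sg Hg].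
  destruct (smooth_mult f g Sf Sg) as [S _].
  split; auto. split; [intros k x _; apply S; exact I|]. intros kappa k.
  destruct (Sgam_bound_upto a f kappa k Hf) as (A & HA & HfA).
  destruct (Sgam_bound_upto b g 0 k Hg) as (B & HB & HgB).
  exists (2 ^ k * (A * B)). intros x Hx.
  replace kappa with (kappa + 0) by ring. apply mult_Sweight_bound; auto.
Qed.

Lemma smooth_Sgam_plus gamma f g : smooth_Sgam gamma f -> smooth_Sgam gamma g -> smooth_Sgam gamma (fun x => Cplus (f x) (g x)).
Proof.
  intros [Sf Hf] [Sg Hg]. destruct (smooth_plus f g Sf Sg) as [S E].
  split; auto. split; [intros k x _; apply S; exact I|]. intros kappa k.
  destruct (proj2 Hf kappa k) as (A & HA). destruct (proj2 Hg kappa k) as (B & HB).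
  exists (A + B). intros x Hx. rewrite E. eapply Rle_trans; [apply Cmod_triangle|].
  specialize (HA x Hx). specialize (HB x Hx). lra.
Qed.

Lemma smooth_Sgam_scal gamma c f : smooth_Sgam gamma f -> smooth_Sgam gamma (fun x => Cmult c (f x)).
Proof.
  intros [Sf Hf]. destruct (smooth_scal c f Sf) as [S E].
  split; auto. split; [intros k x _; apply S; exact I|]. intros kappa k.
  destruct (proj2 Hf kappa k) as (A & HA).
  exists (Cmod c * A). intros x Hx. rewrite E, Cmod_mult, Rmult_assoc.
  apply Rmult_le_compat_l; [apply Cmod_ge_0|]. auto.
Qed.

Lemma smooth_Sgam_minus gamma f g : smooth_Sgam gamma f -> smooth_Sgam gamma g -> smooth_Sgam gamma (fun x => Cminus (f x) (g x)).
Proof.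
  intros Hf Hg. assert (E : (fun x => Cminus (f x) (g x)) =
    (fun x => Cplus (f x) (Cmult (RtoC (-1)) (g x)))).
  { apply functional_extensionality; intros x. apply C_eq; cbn; unfold Re, Im; ring. }
  rewrite E. apply smooth_Sgam_plus; auto. now apply smooth_Sgam_scal.
Qed.

Lemma smooth_Sgam_conj gamma f : smooth_Sgam gamma f -> smooth_Sgam gamma (fun x => Cconj (f x)).
Proof.
  intros [Sf Hf]. destruct (smooth_conj f Sf) as [S E].
  split; auto. split; [intros k x _; apply S; exact I|]. intros kappa k.
  destruct (proj2 Hf kappa k) as (A & HA).
  exists A. intros x Hx. rewrite E, Cmod_conj. auto.
Qed.

(** * Null sequences and their products *)

Lemma null_plus gamma u v : (forall n, smooth (u n)) -> (forall n, smooth (v n)) ->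
  Sgam_null gamma u -> Sgam_null gamma v ->
  Sgam_null gamma (fun n x => Cplus (u n x) (v n x)).
Proof.
  intros Su Sv Hu Hv kappa k eps He. assert (He2 : 0 < eps / 2) by lra.
  generalize (filter_and _ _ (Hu kappa k (eps / 2) He2) (Hv kappa k (eps / 2) He2)).
  apply filter_imp. intros n [H1 H2] x Hx.
  rewrite (proj2 (smooth_plus _ _ (Su n) (Sv n))).
  eapply Rle_trans; [apply Cmod_triangle|].
  specialize (H1 x Hx). specialize (H2 x Hx). lra.
Qed.

Lemma null_conj gamma u : (forall n, smooth (u n)) -> Sgam_null gamma u ->
  Sgam_null gamma (fun n x => Cconj (u n x)).
Proof.
  intros Su Hu kappa k eps He. generalize (Hu kappa k eps He).
  apply filter_imp. intros n H x Hx.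
  rewrite (proj2 (smooth_conj _ (Su n))), Cmod_conj. auto.
Qed.

(** No logarithmic gain ([kappa = 0]) is asked: in a product the null factor supplies it. *)
Definition eventually_bounded (gamma : R) (v : nat -> R -> C) : Prop :=
  forall k, exists A, eventually (fun n => forall x, 0 < x ->
    Cmod (CDerive_n (v n) k x) <= A * Sweight gamma 0 k x).

Lemma eventually_upto (P : nat -> nat -> Prop) k :
  (forall j, (j <= k)%nat -> eventually (P j)) ->
  eventually (fun n => forall j, (j <= k)%nat -> P j n).
Proof.
  induction k as [|k IH]; intros H.
  - generalize (H O (le_n _)). apply filter_imp. intros n Hn j Hj. now replace j with O by lia.
  - assert (H' : forall j, (j <= k)%nat -> eventually (P j)) by auto.
    generalize (filter_and _ _ (IH H') (H (S k) (le_n _))).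
    apply filter_imp. intros n [H1 H2] j Hj.
    destruct (Nat.eq_dec j (S k)) as [->|]; auto. apply H1; lia.
Qed.

Lemma null_mult a b u v : (forall n, smooth (u n)) -> (forall n, smooth (v n)) ->
  Sgam_null a u -> eventually_bounded b v ->
  Sgam_null (a + b - 1 / 2) (fun n x => Cmult (u n x) (v n x)).
Proof.
  intros Su Sv Hu Hv kappa k eps He.
  destruct (uniform_upto (fun j A => eventually (fun n => forall x, 0 < x ->
    Cmod (CDerive_n (v n) j x) <= A * Sweight b 0 j x))) with (k := k) as (B & HB & HvB); auto.
  { intros j A A' HA. apply filter_imp. intros n P x Hx. eapply Rle_trans; [now apply P|].
    pose proof (Sweight_pos b 0 j x). nra. }
  set (eta := eps / (2 ^ k * (B + 1))).
  assert (H2 : 0 < 2 ^ k) by (apply pow_lt; lra).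
  assert (Heta : 0 < eta) by (unfold eta; apply Rdiv_lt_0_compat; nra).
  assert (Eeta : 2 ^ k * (eta * (B + 1)) = eps) by (unfold eta; field; split; lra).
  assert (Hu' := eventually_upto _ k (fun j _ => Hu kappa j eta Heta)).
  generalize (filter_and _ _ Hu' (eventually_upto _ k HvB)).
  apply filter_imp. intros n [H3 H4] x Hx.
  eapply Rle_trans.
  - apply (mult_Sweight_bound (u n) (v n) a b kappa 0 k eta B x); auto; lra.
  - rewrite Rplus_0_r. apply Rmult_le_compat_r; [left; apply Sweight_pos|].
    nra.
Qed.

Lemma eventually_bounded_const gamma f : smooth_Sgam gamma f -> eventually_bounded gamma (fun _ => f).
Proof.
  intros [_ [_ H]] k. destruct (H 0 k) as (A & HA). exists A. now exists O.
Qed.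

Lemma null_eventually_bounded gamma u : Sgam_null gamma u -> eventually_bounded gamma u.
Proof. intros H k. exists 1. apply H; lra. Qed.

Lemma null_conj_mult f g u v : smooth_Sgam (1 / 4) f -> smooth_Sgam (1 / 4) g ->
  (forall n, smooth_Sgam (1 / 4) (u n)) -> (forall n, smooth_Sgam (1 / 4) (v n)) ->
  Sgam_null (1 / 4) (fun n x => Cminus (u n x) (f x)) ->
  Sgam_null (1 / 4) (fun n x => Cminus (v n x) (g x)) ->
  Sgam_null 0 (fun n x => Cminus (Cmult (u n x) (Cconj (v n x))) (Cmult (f x) (Cconj (g x)))).
Proof.
  intros Hf Hg Hu Hv Nu Nv.
  set (p := fun n x => Cminus (u n x) (f x)).
  set (q := fun n x => Cconj (Cminus (v n x) (g x))).
  assert (Sp : forall n, smooth (p n)) by (intros n; apply smooth_minus; [apply Hu|apply Hf]).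
  assert (Sv' : forall n, smooth (fun x => Cminus (v n x) (g x)))
    by (intros n; apply smooth_minus; [apply Hv|apply Hg]).
  assert (Sq : forall n, smooth (q n)) by (intros n; apply smooth_conj; auto).
  assert (Nq : Sgam_null (1 / 4) q) by (apply null_conj; auto).
  assert (Hg' : smooth_Sgam (1 / 4) (fun x => Cconj (g x))) by now apply smooth_Sgam_conj.
  assert (E0 : 1 / 4 + 1 / 4 - 1 / 2 = 0) by field.
  (* Expansion around [f] and [g] into [p conj(g) + p q + q f]. In the quadratic term the null
     sequence [q] counts as the bounded factor. *)
  assert (E : (fun n x => Cminus (Cmult (u n x) (Cconj (v n x))) (Cmult (f x) (Cconj (g x)))) =
    (fun n x => Cplus (Cplus (Cmult (p n x) (Cconj (g x))) (Cmult (p n x) (q n x)))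
       (Cmult (q n x) (f x)))).
  { apply functional_extensionality; intros n. apply functional_extensionality; intros x.
    unfold p, q. rewrite Cminus_conj. ring. }
  rewrite E, <- E0. apply null_plus; [| |apply null_plus|]; try apply null_mult; auto.
  - intros n. apply (smooth_plus (fun x => Cmult (p n x) (Cconj (g x)))
      (fun x => Cmult (p n x) (q n x))); apply smooth_mult; auto; apply Hg'.
  - intros n. apply smooth_mult; auto. apply Hf.
  - intros n. apply smooth_mult; auto. apply Hg'.
  - intros n. apply smooth_mult; auto.
  - intros n. apply Hg'.
  - now apply eventually_bounded_const.
  - now apply null_eventually_bounded.
  - intros n. apply Hf.
  - now apply eventually_bounded_const.
Qed.

Lemma antilinear_minus {X} (D : (X -> C) -> Prop) T f g : antilinear_on D T ->
  D f -> D g -> D (fun x => Cmult (RtoC (-1)) (g x)) ->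
  T (fun x => Cminus (f x) (g x)) = Cminus (T f) (T g).
Proof.
  intros [Tp Ts] Df Dg Dg'.
  assert (E : (fun x => Cminus (f x) (g x)) =
    (fun x => Cplus (f x) (Cmult (RtoC (-1)) (g x)))).
  { apply functional_extensionality; intros x. apply C_eq; cbn; unfold Re, Im; ring. }
  rewrite E, Tp, Ts by auto. apply C_eq; cbn; unfold Re, Im; cbn; ring.
Qed.

Lemma Sgam_dual_lim gamma T f u : Sgam_dual gamma T -> smooth_Sgam gamma f -> (forall n, smooth_Sgam gamma (u n)) ->
  Sgam_null gamma (fun n x => Cminus (u n x) (f x)) ->
  forall eps, 0 < eps -> eventually (fun n => Cmod (Cminus (T (u n)) (T f)) <= eps).
Proof.
  intros [Ta Tc] Hf Hu N eps He.
  assert (Hl := Tc _ (fun n => proj2 (smooth_Sgam_minus gamma _ _ (Hu n) Hf)) N).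
  apply is_lim_seq_spec in Hl. generalize (Hl (mkposreal eps He)).
  apply filter_imp. intros n Hn. cbn in Hn. rewrite Rminus_0_r, Rabs_pos_eq in Hn by apply Cmod_ge_0.
  rewrite (antilinear_minus _ T _ _ Ta) in Hn; [lra| | |].
  - apply Hu.
  - apply Hf.
  - apply smooth_Sgam_scal, Hf.
Qed.

Lemma Cc_linear_set : linear_set Cc.
Proof.
  split; [|split].
  - split; [apply smooth_const|]. exists 1, 2. split; [lra|auto].
  - intros f g (Sf & a & b & Hab & Vf) (Sg & a' & b' & Hab' & Vg). split.
    + now apply smooth_plus.
    + exists (Rmin a a'), (Rmax b b').
      pose proof (Rmin_l a a'). pose proof (Rmin_r a a').
      pose proof (Rmax_l b b'). pose proof (Rmax_r b b').
      split; [split; [apply Rmin_pos; lra|lra]|].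
      intros t Ht. rewrite Vf, Vg by lra. ring.
  - intros c f (Sf & a & b & Hab & Vf). split.
    + now apply smooth_scal.
    + exists a, b. split; auto. intros t Ht. rewrite Vf by auto. ring.
Qed.

(** * Forms induced by a transform *)

Definition transform_form (sigma0 : (R -> C) -> C) (T : (R -> C) -> R -> C)
  (f g : R -> C) : C := sigma0 (fun x => Cmult (T f x) (Cconj (T g x))).

Definition admissible (T : (R -> C) -> R -> C) : Prop :=
  (forall f, Cc f -> smooth_Sgam (1 / 4) (T f)) /\
  (forall f g x, Cc f -> Cc g -> T (fun t => Cplus (f t) (g t)) x = Cplus (T f x) (T g x)) /\
  (forall a f x, Cc f -> T (fun t => Cmult a (f t)) x = Cmult a (T f x)).

(** One-sided: images under [T] are limits of images under [T'], which bounds the indices of the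
    form of [T] by those of the form of [T']. *)
Definition approximates (T T' : (R -> C) -> R -> C) : Prop :=
  forall f, Cc f -> exists u : nat -> R -> C, (forall n, Cc (u n)) /\
    Sgam_null (1 / 4) (fun n x => Cminus (T' (u n) x) (T f x)).

Lemma smooth_Sgam_conj_mult f g : smooth_Sgam (1 / 4) f -> smooth_Sgam (1 / 4) g ->
  smooth_Sgam 0 (fun x => Cmult (f x) (Cconj (g x))).
Proof.
  intros Hf Hg. replace 0 with (1 / 4 + 1 / 4 - 1 / 2) by field.
  apply smooth_Sgam_mult; auto. now apply smooth_Sgam_conj.
Qed.

Lemma transform_form_sesquilinear sigma0 T : Sgam_dual 0 sigma0 -> admissible T ->
  sesquilinear Cc (transform_form sigma0 T).
Proof.
  intros [[Sp Ss] _] (AT & Tp & Ts). unfold transform_form.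
  assert (M : forall f g, Cc f -> Cc g -> Sgam 0 (fun x => Cmult (T f x) (Cconj (T g x)))).
  { intros; apply smooth_Sgam_conj_mult; auto. }
  split; [|split; [|split]].
  - intros f g h Hf Hg Hh. rewrite <- Sp by auto. f_equal.
    apply functional_extensionality; intros x. rewrite Tp by auto. ring.
  - intros f g h Hf Hg Hh. rewrite <- Sp by auto. f_equal.
    apply functional_extensionality; intros x. rewrite Tp, Cplus_conj by auto. ring.
  - intros a f h Hf Hh. rewrite <- Ss by auto. f_equal.
    apply functional_extensionality; intros x. rewrite Ts by auto. ring.
  - intros a f h Hf Hh. 
    transitivity (Cmult (Cconj (Cconj a)) (sigma0 (fun x => Cmult (T h x) (Cconj (T f x)))));
      [|now rewrite Cconj_conj].
    rewrite <- Ss by auto. f_equal.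
    apply functional_extensionality; intros x. rewrite Ts, Cmult_conj by auto. ring.
Qed.

Lemma transform_form_lim sigma0 T T' f g u v : Sgam_dual 0 sigma0 ->
  admissible T -> admissible T' -> Cc f -> Cc g -> (forall n, Cc (u n)) -> (forall n, Cc (v n)) ->
  Sgam_null (1 / 4) (fun n x => Cminus (T' (u n) x) (T f x)) ->
  Sgam_null (1 / 4) (fun n x => Cminus (T' (v n) x) (T g x)) ->
  forall eps, 0 < eps -> eventually (fun n =>
    Cmod (Cminus (transform_form sigma0 T' (u n) (v n)) (transform_form sigma0 T f g)) <= eps).
Proof.
  intros Ds (AT & _) (AT' & _) Hf Hg Hu Hv Nu Nv. unfold transform_form.
  apply (Sgam_dual_lim 0 sigma0 _ (fun n x => Cmult (T' (u n) x) (Cconj (T' (v n) x)))); auto.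
  - apply smooth_Sgam_conj_mult; auto.
  - intros n. apply smooth_Sgam_conj_mult; auto.
  - apply null_conj_mult; auto.
Qed.

(** An imaginary part that vanishes along the approximants vanishes in the limit. This passes
    reality from the Hankel form, where it comes from [h], to the sigma form. *)
Lemma transform_form_real sigma0 T T' : Sgam_dual 0 sigma0 ->
  admissible T -> admissible T' -> approximates T T' ->
  (forall f, Cc f -> Im (transform_form sigma0 T' f f) = 0) ->
  forall f, Cc f -> Im (transform_form sigma0 T f f) = 0.
Proof.
  intros Ds AT AT' App R' f Hf. destruct (App f Hf) as (u & Hu & Nu).
  apply NNPP. intros Hn.
  set (B := transform_form sigma0 T f f) in *.
  assert (Hp : 0 < Rabs (Im B) / 2) by (pose proof (Rabs_pos_lt _ Hn); lra).
  destruct (transform_form_lim sigma0 T T' f f u u Ds AT AT' Hf Hf Hu Hu Nu Nu _ Hp) as (N & HN).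
  specialize (HN N (le_n _)). fold B in HN.
  pose proof (im_le_Cmod (Cminus (transform_form sigma0 T' (u N) (u N)) B)) as H.
  assert (E : Im (Cminus (transform_form sigma0 T' (u N) (u N)) B) = - Im B).
  { transitivity (Im (transform_form sigma0 T' (u N) (u N)) - Im B); [reflexivity|].
    rewrite R' by auto. ring. }
  rewrite E, Rabs_Ropp in H. lra.
Qed.

Lemma inertia_le_of_approximates sigma0 T T' q q' s : Sgam_dual 0 sigma0 ->
  admissible T -> admissible T' -> approximates T T' -> Rabs s = 1 ->
  (forall f, Cc f -> q f = transform_form sigma0 T f f) ->
  (forall f, Cc f -> q' f = transform_form sigma0 T' f f) ->
  (forall f, Cc f -> Im (transform_form sigma0 T f f) = 0) ->
  (forall f, Cc f -> Im (transform_form sigma0 T' f f) = 0) ->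
  forall n M, linear_set M -> (forall f, M f -> Cc f) -> form_positive s q M -> dim_ge M n ->
  exists M', linear_set M' /\ (forall f, M' f -> Cc f) /\ form_positive s q' M' /\ dim_ge M' n.
Proof.
  intros Ds AT AT' App Hs Eq Eq' Rq Rq'.
  apply (inertia_transfer Cc (transform_form sigma0 T) (transform_form sigma0 T'));
    auto using Cc_linear_set, transform_form_sesquilinear.
  intros n e eps He De.
  destruct (functional_choice (fun i u => (i < n)%nat -> (forall m, Cc (u m)) /\
    Sgam_null (1 / 4) (fun m x => Cminus (T' (u m) x) (T (e i) x)))) as (g & Hg).
  { intros i. destruct (Compare_dec.lt_dec i n) as [Hi|Hi].
    - destruct (App (e i) (De i Hi)) as (u & Hu). exists u. auto.
    - exists (fun _ _ => RtoC 0). intros; contradiction. }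
  (* One index serves all pairs. The bounds [<= n] are the format of [eventually_upto]; the pairs
     that count are guarded by [< n]. *)
  assert (Ev : eventually (fun m => forall i, (i <= n)%nat -> forall j, (j <= n)%nat ->
    (i < n)%nat -> (j < n)%nat ->
    Cmod (Cminus (transform_form sigma0 T' (g i m) (g j m)) (transform_form sigma0 T (e i) (e j))) <= eps)).
  { apply eventually_upto. intros i Hi. apply eventually_upto. intros j Hj.
    destruct (Compare_dec.lt_dec i n) as [Hi'|Hi']; [|exists O; intros; contradiction].
    destruct (Compare_dec.lt_dec j n) as [Hj'|Hj']; [|exists O; intros; contradiction].
    destruct (Hg i Hi') as [Hgi Ni]. destruct (Hg j Hj') as [Hgj Nj].
    generalize (transform_form_lim sigma0 T T' (e i) (e j) (g i) (g j) Ds AT AT'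
      (De i Hi') (De j Hj') Hgi Hgj Ni Nj eps He).
    apply filter_imp. auto. }
  destruct Ev as (N & HN). exists (fun i => g i N). split.
  - intros i Hi. now apply Hg.
  - intros i j Hi Hj. apply (HN N (le_n _)); lia.
Qed.

(** * Laplace transforms of test functions *)

Lemma Cexp_plus a b : Cexp (Cplus a b) = Cmult (Cexp a) (Cexp b).
Proof.
  destruct a as [x y], b as [u v]. unfold Cexp; cbn.
  rewrite exp_plus, cos_plus, sin_plus. apply C_eq; cbn; ring.
Qed.

Lemma Cmod_Cexp z : Cmod (Cexp z) = exp (Re z).
Proof.
  unfold Cmod, Cexp; cbn.
  replace (_ + _) with ((exp (Re z)) * exp (Re z)).
  - apply sqrt_square. left; apply exp_pos.
  - pose proof (sin2_cos2 (Im z)) as H. unfold Rsqr in H.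
    transitivity (exp (Re z) * exp (Re z) * (sin (Im z) * sin (Im z) + cos (Im z) * cos (Im z)));
      [rewrite H; ring | ring].
Qed.

Lemma Cexp_0 : Cexp (RtoC 0) = RtoC 1.
Proof. unfold Cexp; cbn. rewrite exp_0, cos_0, sin_0. apply C_eq; cbn; ring. Qed.

Lemma Cexp_RtoC x : Cexp (RtoC x) = RtoC (exp x).
Proof. unfold Cexp; cbn. rewrite cos_0, sin_0. apply C_eq; cbn; ring. Qed.

Lemma is_deriveC_Cexp w t :
  is_deriveC (fun t => Cexp (Cmult (RtoC t) w)) t (Cmult w (Cexp (Cmult (RtoC t) w))).
Proof.
  destruct w as [x y].
  apply is_deriveC_pair; cbn; auto_derive; auto; unfold Rminus; ring.
Qed.

Lemma is_deriveC_kernel z t :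
  is_deriveC (fun t => Cexp (Cmult (RtoC (- t)) z)) t
    (Cmult (Copp z) (Cexp (Cmult (RtoC (- t)) z))).
Proof.
  assert (E : forall t, Cexp (Cmult (RtoC t) (Copp z)) = Cexp (Cmult (RtoC (- t)) z)).
  { intros s. rewrite RtoC_opp. f_equal. ring. }
  eapply is_deriveC_ext; [apply E| |apply is_deriveC_Cexp]. cbn beta. now rewrite E.
Qed.

(** Taylor's formula for exp (t w) on 0 <= t <= 1, whose second derivative in [t] is at most
    [Cmod w ^ 2 * exp (Cmod w)] in modulus. *)
Lemma Cexp_taylor w : Cmod (Cminus (Cminus (Cexp w) (RtoC 1)) w) <= exp (Cmod w) * Cmod w ^ 2.
Proof.
  set (f := fun t => Cexp (Cmult (RtoC t) w)).
  set (f1 := fun t => Cmult w (f t)).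
  set (f2 := fun t => Cmult w (f1 t)).
  assert (D : forall t, is_deriveC f t (f1 t)) by (intros; apply is_deriveC_Cexp).
  assert (D1 : forall g g', (forall t, is_deriveC g t (g' t)) ->
    forall t, is_deriveC (fun t => Cmult w (g t)) t (Cmult w (g' t))).
  { intros g g' Hg t. eapply is_deriveC_ext; [reflexivity| |
      apply is_deriveC_mult; [apply is_deriveC_const|apply Hg]]. cbn beta; ring. }
  pose proof (taylor1_C f f1 f2 (exp (Cmod w) * Cmod w ^ 2) D (D1 _ _ D)) as T.
  assert (Hc : contC f2).
  { apply contC_of_derive with (fun t => Cmult w (f2 t)). apply D1, D1, D. }
  specialize (T Hc 0 1). unfold f, f1 in T. rewrite Rplus_0_l in T.
  unfold f in T.  rewrite !Cmult_1_l, !Cmult_0_l, Cexp_0, Cmult_1_r in T.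
  replace (exp (Cmod w) * Cmod w ^ 2 * 1 ^ 2) with (exp (Cmod w) * Cmod w ^ 2) in T by ring.
  apply T. intros t Ht. unfold f2, f1, f. rewrite !Cmod_mult, Cmod_Cexp.
  rewrite Rmin_left, Rmax_right in Ht by lra.
  replace (Cmod w * (Cmod w * exp (Re (Cmult (RtoC t) w)))) with
    (exp (Re (Cmult (RtoC t) w)) * Cmod w ^ 2) by ring.
  apply Rmult_le_compat_r; [apply pow2_ge_0|].
  apply exp_le.
  cbn. pose proof (re_le_Cmod w) as H. apply Rabs_le_between in H.
  pose proof (Cmod_ge_0 w). unfold Re in *. nra.
Qed.

Lemma RInt_wide k a b a' b' : contC k -> a <= b -> a' <= a -> b <= b' ->
  vanishes_outside k a b -> is_RIntC k a' b' (RIntC k a b).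
Proof.
  intros Hc Hab Ha Hb V.
  replace (RIntC k a b) with (plus (plus (RtoC 0 : C_R_NormedModule) (RIntC k a b)) (RtoC 0)).
  - apply (is_RInt_Chasles (V := C_R_NormedModule) k a' b b').
    + apply (is_RInt_Chasles (V := C_R_NormedModule) k a' a b).
      * apply is_RIntC_zero. rewrite Rmin_left, Rmax_right by lra. intros; apply V; lra.
      * now apply contC_RInt.
    + apply is_RIntC_zero. rewrite Rmin_left, Rmax_right by lra. intros; apply V; lra.
  - change (Cplus (Cplus (RtoC 0) (RIntC k a b)) (RtoC 0) = RIntC k a b). ring.
Qed.

Definition laplace_integrand (f : R -> C) (z : C) (t : R) : C :=
  Cmult (Cexp (Cmult (RtoC (- t)) z)) (f t).

Lemma laplace_integrand_contC f z : contC f -> contC (laplace_integrand f z).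
Proof.
  intros H. apply contC_mult; auto. eapply contC_of_derive. intros; apply is_deriveC_kernel.
Qed.

Lemma laplace_integrand_vanishes f z a b : vanishes_outside f a b ->
  vanishes_outside (laplace_integrand f z) a b.
Proof. intros V t Ht. unfold laplace_integrand. rewrite V by auto. ring. Qed.

(** The improper integral is eventually constant: every interval containing [a, b] gives the same
    value, so [laplace] may be computed on whichever is convenient. *)
Lemma laplace_is_RInt f a b z : contC f -> 0 < a < b -> vanishes_outside f a b ->
  forall a' b', a' <= a -> b <= b' -> is_RIntC (laplace_integrand f z) a' b' (laplace f z).
Proof.
  intros Hc Hab V.
  assert (W : forall a' b', a' <= a -> b <= b' ->
    is_RIntC (laplace_integrand f z) a' b' (RIntC (laplace_integrand f z) a b)).
  { intros a' b' Ha Hb. apply RInt_wide; auto; try lra.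
    - now apply laplace_integrand_contC.
    - now apply laplace_integrand_vanishes. }
  assert (E : laplace f z = RIntC (laplace_integrand f z) a b).
  { unfold laplace. apply (is_RInt_gen_unique (V := C_R_CompleteNormedModule)).
    intros P HP.
    apply (Filter_prod (at_right 0) (Rbar_locally p_infty) _ (fun x => x < a) (fun x => b < x)).
    - apply (locally_Rabs (fun y => 0 < y -> y < a) 0 a); [lra|]. intros y Hy _.
      apply Rabs_def2 in Hy. lra.
    - exists b. auto.
    - intros x y Hx Hy. cbn. exists (RIntC (laplace_integrand f z) a b). split.
      + apply W; lra.
      + now apply locally_singleton. }
  rewrite E. exact W.
Qed.

Lemma kernel_bound t z b : 0 <= t <= b -> Cmod (Cexp (Cmult (RtoC (- t)) z)) <= exp (b * Rabs (Re z)).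
Proof.
  intros Ht. rewrite Cmod_Cexp. apply exp_le. cbn.
  pose proof (Rle_abs (- Re z)) as H. rewrite Rabs_Ropp in H. pose proof (Rabs_pos (Re z)).
  unfold Re in *. nra.
Qed.

Lemma laplace_bound f a b M z : contC f -> 0 < a < b -> vanishes_outside f a b ->
  (forall t, Cmod (f t) <= M) ->
  (0 <= Re z -> Cmod (laplace f z) <= (b - a) * M * exp (- a * Rabs (Re z))) /\
  (Re z <= 0 -> Cmod (laplace f z) <= (b - a) * M * exp (b * Rabs (Re z))).
Proof.
  intros Hc Hab V HM.
  assert (HI := laplace_is_RInt f a b z Hc Hab V a b (Rle_refl _) (Rle_refl _)).
  assert (M0 : 0 <= M) by (eapply Rle_trans; [apply Cmod_ge_0|apply (HM 0)]).
  split; intros Hz; rewrite Rmult_assoc;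
    (eapply Cmod_RIntC_le; [lra| |exact HI]); intros t Ht; unfold laplace_integrand;
    rewrite Cmod_mult, Rmult_comm; apply Rmult_le_compat; auto using Cmod_ge_0.
  - rewrite Cmod_Cexp. apply exp_le. cbn. rewrite Rabs_pos_eq by auto. unfold Re in *. nra.
  - apply kernel_bound. lra.
Qed.

Lemma contC_RtoC (u : R -> R) : (forall t, continuous u t) -> contC (fun t => RtoC (u t)).
Proof. intros H. apply contC_pair; auto. intros; apply continuous_const. Qed.

(** The Laplace transform turns this multiplication into differentiation. *)
Definition tmul (f : R -> C) : R -> C := fun t => Cmult (RtoC (- t)) (f t).

Lemma tmul_vanishes f a b : vanishes_outside f a b -> vanishes_outside (tmul f) a b.
Proof. intros V t Ht. unfold tmul. rewrite V by auto. ring. Qed.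

Lemma tmul_contC f : contC f -> contC (tmul f).
Proof.
  intros H. apply contC_mult; auto. apply contC_RtoC. intros.
  apply (continuous_opp (V := R_NormedModule) (fun t => t)). apply continuous_id.
Qed.

(** The integrand factors as exp (- t z) times [exp w - 1 - w] times [f t], where [w = - t (y - z)].
    An increment of modulus at most 1 gives [Cmod w <= b], so [Cexp_taylor] is uniform. The estimate
    serves both the complex and the real derivative. *)
Lemma laplace_taylor f a b M z : contC f -> 0 < a < b -> vanishes_outside f a b ->
  (forall t, Cmod (f t) <= M) ->
  exists K, 0 <= K /\ forall y, Cmod (Cminus y z) <= 1 ->
    Cmod (Cminus (Cminus (laplace f y) (laplace f z)) (Cmult (Cminus y z) (laplace (tmul f) z)))
      <= K * Cmod (Cminus y z) ^ 2.
Proof.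
  intros Hc Hab V HM.
  assert (M0 : 0 <= M) by (eapply Rle_trans; [apply Cmod_ge_0|apply (HM 0)]).
  set (K := (b - a) * (exp (b * Rabs (Re z)) * (exp b * b ^ 2) * M)).
  exists K. split.
  { unfold K. pose proof (exp_pos (b * Rabs (Re z))). pose proof (exp_pos b).
    pose proof (pow2_ge_0 b). apply Rmult_le_pos; [lra|]. apply Rmult_le_pos; auto.
    apply Rmult_le_pos; [lra|]. apply Rmult_le_pos; lra. }
  intros y Hy. set (d := Cminus y z) in *.
  assert (HI : is_RIntC (fun t => Cminus (Cminus (laplace_integrand f y t) (laplace_integrand f z t))
      (Cmult d (laplace_integrand (tmul f) z t))) a b
      (Cminus (Cminus (laplace f y) (laplace f z)) (Cmult d (laplace (tmul f) z)))).
  { apply is_RIntC_minus; [apply is_RIntC_minus|apply is_RIntC_scal];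
      apply laplace_is_RInt with a b; auto using tmul_contC, tmul_vanishes; lra. }
  replace (K * Cmod d ^ 2) with ((b - a) * ((exp (b * Rabs (Re z)) * (exp b * b ^ 2) * M) * Cmod d ^ 2))
    by (unfold K; ring).
  apply (Cmod_RIntC_le _ a b _ _ ltac:(lra)) with (2 := HI). intros t Ht.
  unfold laplace_integrand, tmul.
  set (w := Cmult (RtoC (- t)) d).
  replace (Cexp (Cmult (RtoC (- t)) y)) with (Cmult (Cexp (Cmult (RtoC (- t)) z)) (Cexp w)).
  2:{ rewrite <- Cexp_plus. f_equal. unfold w, d. ring. }
  replace (Cminus _ _) with (Cmult (Cmult (Cexp (Cmult (RtoC (- t)) z))
     (Cminus (Cminus (Cexp w) (RtoC 1)) w)) (f t)) by (unfold w; ring).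
  rewrite !Cmod_mult.
  assert (Hw : Cmod w <= b * Cmod d).
  { unfold w. rewrite Cmod_mult, Cmod_R, Rabs_Ropp, Rabs_pos_eq by lra.
    apply Rmult_le_compat_r; [apply Cmod_ge_0|lra]. }
  pose proof (Cmod_ge_0 d) as Hd. pose proof (Cmod_ge_0 w) as Hw0.
  replace (exp (b * Rabs (Re z)) * (exp b * b ^ 2) * M * Cmod d ^ 2) with
    ((exp (b * Rabs (Re z)) * (exp b * (b * Cmod d) ^ 2)) * M) by ring.
  apply Rmult_le_compat; auto using Cmod_ge_0.
  { apply Rmult_le_pos; apply Cmod_ge_0. }
  apply Rmult_le_compat; auto using Cmod_ge_0.
  { apply kernel_bound; lra. }
  eapply Rle_trans; [apply Cexp_taylor|].
  apply Rmult_le_compat.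
  - left; apply exp_pos.
  - apply pow2_ge_0.
  - apply exp_le. nra.
  - apply pow_incr. lra.
Qed.

Lemma quadratic_eps K eps : 0 <= K -> 0 < eps ->
  exists delta, 0 < delta /\ forall r, 0 <= r < delta -> r <= 1 /\ K * r ^ 2 <= eps * r.
Proof.
  intros HK He. set (d := eps / (K + 1)).
  assert (Hd : 0 < d) by (unfold d; apply Rdiv_lt_0_compat; lra).
  assert (E : d * (K + 1) = eps) by (unfold d; field; lra).
  exists (Rmin 1 d). split; [apply Rmin_pos; lra|]. intros r Hr.
  pose proof (Rmin_l 1 d). pose proof (Rmin_r 1 d). split; [lra|].
  assert (K * r <= eps) by nra. nra.
Qed.

Lemma laplace_is_derive f a b z : contC f -> 0 < a < b -> vanishes_outside f a b ->
  is_derive (K := C_AbsRing) (V := C_NormedModule) (laplace f) z (laplace (tmul f) z).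
Proof.
  intros Hc Hab V. destruct (contC_bounded f a b Hc ltac:(lra) V) as (M & _ & HM).
  destruct (laplace_taylor f a b M z Hc Hab V HM) as (K & HK & HT).
  apply is_derive_CC_eps. intros eps He.
  destruct (quadratic_eps K eps HK He) as (d & Hd & P). exists d. split; auto.
  intros y Hy. destruct (P (Cmod (Cminus y z)) (conj (Cmod_ge_0 _) Hy)) as [P1 P2].
  eapply Rle_trans; [apply HT|]; auto.
Qed.

Lemma laplace_is_deriveC f a b x : contC f -> 0 < a < b -> vanishes_outside f a b ->
  is_deriveC (fun x => laplace f (RtoC x)) x (laplace (tmul f) (RtoC x)).
Proof.
  intros Hc Hab V. destruct (contC_bounded f a b Hc ltac:(lra) V) as (M & _ & HM).
  destruct (laplace_taylor f a b M (RtoC x) Hc Hab V HM) as (K & HK & HT).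
  apply is_deriveC_eps. intros eps He.
  destruct (quadratic_eps K eps HK He) as (d & Hd & P). exists d. split; auto.
  intros y Hy. specialize (HT (RtoC y)). rewrite <- RtoC_minus, Cmod_R in HT.
  destruct (P (Rabs (y - x)) (conj (Rabs_pos _) Hy)) as [P1 P2].
  eapply Rle_trans; [apply HT|]; auto.
Qed.

Definition laplace_R (f : R -> C) (x : R) : C := laplace f (RtoC x).

Fixpoint tmul_n (k : nat) (f : R -> C) : R -> C :=
  match k with O => f | S k => tmul (tmul_n k f) end.

Lemma tmul_n_contC k f : contC f -> contC (tmul_n k f).
Proof. intros H; induction k; cbn; auto using tmul_contC. Qed.

Lemma tmul_n_vanishes k f a b : vanishes_outside f a b -> vanishes_outside (tmul_n k f) a b.
Proof. intros H; induction k; cbn; auto using tmul_vanishes. Qed.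

Lemma laplace_R_smooth f a b : contC f -> 0 < a < b -> vanishes_outside f a b ->
  smooth (laplace_R f) /\ forall k x, CDerive_n (laplace_R f) k x = laplace_R (tmul_n k f) x.
Proof.
  intros Hc Hab V. apply jet_of with (F := fun k => laplace_R (tmul_n k f)); auto.
  intros k x. cbn [tmul_n]. apply laplace_is_deriveC with a b;
    auto using tmul_n_contC, tmul_n_vanishes.
Qed.

(** The decay comes from the support being away from 0. Its rate is the lower end [a], the same for
    all orders since [tmul] keeps the support. *)
Lemma laplace_R_rapid f a b : contC f -> 0 < a < b -> vanishes_outside f a b ->
  rapid (laplace_R f).
Proof.
  intros Hc Hab V. destruct (laplace_R_smooth f a b Hc Hab V) as [S E].
  split; auto. exists a. split; [lra|]. intros k.
  assert (Hck := tmul_n_contC k f Hc). assert (Vk := tmul_n_vanishes k f a b V).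
  destruct (contC_bounded _ a b Hck ltac:(lra) Vk) as (M & _ & HM).
  exists ((b - a) * M). intros x Hx. rewrite E.
  destruct (laplace_bound _ a b M (RtoC x) Hck Hab Vk HM) as [H _].
  unfold laplace_R. cbn [Re RtoC fst] in H. cbn in H. rewrite Rabs_pos_eq in H by lra. apply H. lra.
Qed.

Lemma laplace_parts f a b z : smooth f -> 0 < a < b -> vanishes_outside f a b ->
  laplace (CDerive_n f 1) z = Cmult z (laplace f z).
Proof.
  intros S Hab V.
  assert (Hc0 := smooth_contC0 f S). assert (Hc1 := smooth_contC f 1 S).
  assert (V1 := CDerive_n_vanishes f a b 1 V).
  assert (D : forall t, is_deriveC (laplace_integrand f z) t
    (Cplus (Cmult (Copp z) (laplace_integrand f z t)) (laplace_integrand (CDerive_n f 1) z t))).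
  { intros t. unfold laplace_integrand.
    eapply is_deriveC_ext; [reflexivity| |apply is_deriveC_mult; [apply is_deriveC_kernel|]].
    2:{ eapply is_deriveC_ext; [apply CDerive_n_0|reflexivity|apply (smooth_jet f S)]. }
    cbn beta. ring. }
  (* Both endpoints 0 and [b + 1] are strictly outside the support, where [vanishes_outside]
     applies, so the boundary terms vanish. *)
  assert (HI : is_RIntC (fun t => Cplus (Cmult (Copp z) (laplace_integrand f z t))
     (laplace_integrand (CDerive_n f 1) z t)) 0 (b + 1)
     (Cplus (Cmult (Copp z) (laplace f z)) (laplace (CDerive_n f 1) z))).
  { apply is_RIntC_plus; [apply is_RIntC_scal|]; apply laplace_is_RInt with a b; auto; lra. }
  assert (Hd : contC (fun t => Cplus (Cmult (Copp z) (laplace_integrand f z t))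
     (laplace_integrand (CDerive_n f 1) z t))).
  { intros t; apply (continuous_plus (V := C_R_NormedModule)).
    - apply contC_mult; [intros u; apply continuous_const|now apply laplace_integrand_contC].
    - now apply laplace_integrand_contC. }
  pose proof (eq_trans (eq_sym (is_RIntC_unique _ _ _ _ HI))
    (is_RIntC_unique _ _ _ _ (is_RIntC_derive _ _ 0 (b + 1) D Hd))) as E.
  rewrite !(laplace_integrand_vanishes f z a b V) in E by lra.
  replace (laplace (CDerive_n f 1) z) with (Cplus (Cmult z (laplace f z))
    (Cplus (Cmult (Copp z) (laplace f z)) (laplace (CDerive_n f 1) z))) by ring.
  rewrite E. ring.
Qed.

(** Each factor [1 + Cmod z] is paid for by one derivative of [f], because [z L f = L f']. *)
Lemma laplace_Ybound_n a b : 0 < a < b -> forall n f, smooth f -> vanishes_outside f a b ->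
  exists A, 0 <= A /\ forall z,
    (0 <= Re z -> (1 + Cmod z) ^ n * Cmod (laplace f z) <= A * exp (- a * Rabs (Re z))) /\
    (Re z <= 0 -> (1 + Cmod z) ^ n * Cmod (laplace f z) <= A * exp (b * Rabs (Re z))).
Proof.
  intros Hab n; induction n as [|n IH]; intros f Sf V.
  - destruct (compact_bounded f a b 0 Sf ltac:(lra) V) as (M & M0 & HM).
    exists ((b - a) * M). split; [apply Rmult_le_pos; lra|]. intros z. rewrite Rmult_1_l.
    apply laplace_bound; auto using smooth_contC0.
  - destruct (IH f Sf V) as (A & HA & H).
    destruct (IH (CDerive_n f 1) (proj1 (smooth_shift f Sf)) (CDerive_n_vanishes f a b 1 V))
      as (A' & HA' & H').
    exists (A + A'). split; [lra|]. intros z.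
    destruct (H z) as [Hp Hm]. destruct (H' z) as [Hp' Hm'].
    rewrite (laplace_parts f a b z Sf Hab V), Cmod_mult in Hp', Hm'. cbn [pow].
    split; intros Hz; [specialize (Hp Hz); specialize (Hp' Hz)|specialize (Hm Hz); specialize (Hm' Hz)]; lra.
Qed.

Lemma laplace_Yspace f : Cc f -> Yspace (laplace f).
Proof.
  intros (S & a & b & Hab & V). split.
  - intros z. eexists. apply laplace_is_derive with a b; auto using smooth_contC0.
  - pose proof (fun n => laplace_Ybound_n a b Hab n f S V) as HA.
    apply functional_choice in HA. destruct HA as (A & HA).
    exists A, (- a), b. split; [lra|]. intros n z. destruct (HA n) as [_ H].
    assert (P : 0 < (1 + Cmod z) ^ n) by (apply pow_lt; pose proof (Cmod_ge_0 z); lra).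
    destruct (H z) as [Hp Hm].
    split; intros Hz; [specialize (Hp Hz)|specialize (Hm Hz)];
      apply (Rmult_le_reg_l _ _ _ P); (eapply Rle_trans; [eassumption|]); right; field; lra.
Qed.

Lemma Cc_common_support f g : Cc f -> Cc g -> exists a b, 0 < a < b /\
  vanishes_outside f a b /\ vanishes_outside g a b.
Proof.
  intros (_ & a & b & Hab & Vf) (_ & a' & b' & Hab' & Vg).
  pose proof (Rmin_l a a'). pose proof (Rmin_r a a').
  pose proof (Rmax_l b b'). pose proof (Rmax_r b b').
  exists (Rmin a a'), (Rmax b b'). split; [split; [apply Rmin_pos; lra|lra]|].
  split; intros t Ht; [apply Vf|apply Vg]; lra.
Qed.

Lemma laplace_plus f g z : Cc f -> Cc g ->
  laplace (fun t => Cplus (f t) (g t)) z = Cplus (laplace f z) (laplace g z).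
Proof.
  intros Hf Hg. destruct (Cc_common_support f g Hf Hg) as (a & b & Hab & Vf & Vg).
  assert (Sf := proj1 Hf). assert (Sg := proj1 Hg).
  assert (H := laplace_is_RInt (fun t => Cplus (f t) (g t)) a b z
    (smooth_contC0 _ (proj1 (smooth_plus f g Sf Sg))) Hab
    ltac:(intros t Ht; rewrite Vf, Vg by auto; ring) a b (Rle_refl _) (Rle_refl _)).
  rewrite <- (is_RIntC_unique _ _ _ _ H). apply is_RIntC_unique.
  apply is_RIntC_ext with (fun t => Cplus (laplace_integrand f z t) (laplace_integrand g z t)).
  { intros t _. unfold laplace_integrand. ring. }
  apply is_RIntC_plus; apply laplace_is_RInt with a b; auto using smooth_contC0; lra.
Qed.

Lemma laplace_scal c f z : Cc f -> laplace (fun t => Cmult c (f t)) z = Cmult c (laplace f z).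
Proof.
  intros (Sf & a & b & Hab & Vf).
  assert (H := laplace_is_RInt (fun t => Cmult c (f t)) a b z
    (smooth_contC0 _ (proj1 (smooth_scal c f Sf))) Hab
    ltac:(intros t Ht; rewrite Vf by auto; ring) a b (Rle_refl _) (Rle_refl _)).
  rewrite <- (is_RIntC_unique _ _ _ _ H). apply is_RIntC_unique.
  apply is_RIntC_ext with (fun t => Cmult c (laplace_integrand f z t)).
  { intros t _. unfold laplace_integrand. ring. }
  apply is_RIntC_scal; apply laplace_is_RInt with a b; auto using smooth_contC0; lra.
Qed.

Lemma laplace_R_admissible : admissible laplace_R.
Proof.
  split; [|split].
  - intros f (S & a & b & Hab & V).
    assert (H := laplace_R_rapid f a b (smooth_contC0 f S) Hab V).
    split; [apply H|]. apply rapid_Sgam; auto; lra.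
  - intros; now apply laplace_plus.
  - intros; now apply laplace_scal.
Qed.

Lemma id_admissible : admissible (fun f => f).
Proof.
  split; [|auto]. intros f Hf. split; [apply Hf|].
  apply rapid_Sgam; [lra|]. now apply Cc_rapid.
Qed.

(** * Laplace convolution *)

(** A fixed window instead of [0, t]: differentiation in [t] then produces no boundary term. *)
Definition conv_on (a b : R) (p g : R -> C) (t : R) : C :=
  RIntC (fun s => Cmult (p s) (g (t - s))) a b.

Lemma conv_on_contC p g t : contC p -> contC g -> contC (fun s => Cmult (p s) (g (t - s))).
Proof.
  intros Hp Hg. apply contC_mult; auto. apply contC_comp; auto. intros s.
  apply (continuous_minus (V := R_NormedModule) (fun _ => t) (fun s => s));
    [apply continuous_const|apply continuous_id].
Qed.

(** Differentiation under the integral sign: the Taylor remainder of [g] is quadratic in the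
    increment, uniformly in [s]. *)
Lemma conv_on_derive a b p g g1 g2 M t : a <= b -> contC p ->
  (forall t, is_deriveC g t (g1 t)) -> (forall t, is_deriveC g1 t (g2 t)) -> contC g2 ->
  (forall t, Cmod (g2 t) <= M) ->
  is_deriveC (conv_on a b p g) t (conv_on a b p g1 t).
Proof.
  intros Hab Hp D D1 Hc2 HM.
  assert (Hc : contC g) by (eapply contC_of_derive; apply D).
  assert (Hc1 : contC g1) by (eapply contC_of_derive; apply D1).
  destruct (contC_bounded_on p a b Hp Hab) as (P & P0 & HP).
  assert (M0 : 0 <= M) by (eapply Rle_trans; [apply Cmod_ge_0|apply (HM 0)]).
  apply is_deriveC_eps. intros eps He.
  destruct (quadratic_eps ((b - a) * (P * M)) eps) as (d & Hd & Q); auto.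
  { apply Rmult_le_pos; [lra|]. apply Rmult_le_pos; auto. }
  exists d. split; auto. intros y Hy.
  destruct (Q (Rabs (y - t)) (conj (Rabs_pos _) Hy)) as [_ Q2].
  eapply Rle_trans; [|exact Q2].
  rewrite pow2_abs, Rmult_assoc.
  assert (HI : is_RIntC (fun s => Cminus (Cminus (Cmult (p s) (g (y - s))) (Cmult (p s) (g (t - s))))
      (Cmult (RtoC (y - t)) (Cmult (p s) (g1 (t - s))))) a b
      (Cminus (Cminus (conv_on a b p g y) (conv_on a b p g t))
        (Cmult (RtoC (y - t)) (conv_on a b p g1 t)))).
  { apply is_RIntC_minus; [apply is_RIntC_minus|apply is_RIntC_scal];
      apply contC_RInt; now apply conv_on_contC. }
  apply (Cmod_RIntC_le _ a b _ _ Hab) with (2 := HI). intros s Hs.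
  replace (Cminus _ _) with (Cmult (p s) (Cminus (Cminus (g ((t - s) + (y - t))) (g (t - s)))
     (Cmult (RtoC (y - t)) (g1 (t - s))))).
  2:{ replace (t - s + (y - t)) with (y - s) by ring. ring. }
  rewrite Cmod_mult, (Rmult_assoc P). apply Rmult_le_compat; auto using Cmod_ge_0.
  apply taylor1_C with g2; auto.
Qed.

Lemma conv_on_smooth a b p g a' b' : a <= b -> contC p -> smooth g -> a' <= b' ->
  vanishes_outside g a' b' -> smooth (conv_on a b p g).
Proof.
  intros Hab Hp Sg Hab' Vg.
  apply (jet_of (conv_on a b p g) (fun k => conv_on a b p (CDerive_n g k))).
  - intros k x. destruct (compact_bounded g a' b' (S (S k)) Sg Hab' Vg) as (M & _ & HM).
    apply conv_on_derive with (CDerive_n g (S (S k))) M; auto.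
    + intros; apply (smooth_jet g Sg).
    + intros; apply (smooth_jet g Sg).
    + now apply smooth_contC.
  - intros x. f_equal. apply functional_extensionality; intros t; apply CDerive_n_0.
Qed.

Lemma conv_on_vanishes a b p g a' b' : a <= b -> vanishes_outside g a' b' ->
  vanishes_outside (conv_on a b p g) (a + a') (b + b').
Proof.
  intros Hab Vg t Ht. apply is_RIntC_unique, is_RIntC_zero.
  rewrite Rmin_left, Rmax_right by lra. intros s Hs. rewrite Vg by lra. ring.
Qed.

Lemma laplace_conv_eq f g a b t : contC f -> contC g -> 0 < a < b ->
  vanishes_outside f a b -> vanishes_outside g a b ->
  laplace_conv f g t = conv_on a b (fun s => Cconj (f s)) g t.
Proof.
  intros Hf Hg Hab Vf Vg.
  assert (Hk := conv_on_contC (fun s => Cconj (f s)) g t (contC_conj f Hf) Hg).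
  set (k := fun s => Cmult (Cconj (f s)) (g (t - s))) in Hk.
  assert (Kf : forall s, s < a \/ b < s -> k s = RtoC 0).
  { intros s Hs. unfold k. rewrite Vf by auto. apply C_eq; cbn; ring. }
  assert (Kg : forall s, t - a < s -> k s = RtoC 0).
  { intros s Hs. unfold k. rewrite (Vg (t - s)) by lra. ring. }
  change (RIntC k 0 t = RIntC k a b).
  destruct (Rle_dec a t) as [Ht|Ht].
  (* The integrand lives on [a, c], which is contained in both ranges of integration: for [s] beyond
     [t] the argument [t - s] is negative. *)
  - set (c := Rmin b t).
    assert (Hc1 : c <= b) by apply Rmin_l. assert (Hc2 : c <= t) by apply Rmin_r.
    assert (Hc3 : a <= c) by (apply Rmin_glb; lra).
    assert (V : vanishes_outside k a c).
    { intros s [Hs|Hs]; [auto|]. destruct (Rlt_dec b s); [auto|].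
      apply Kg. assert (t < s); [|lra].
      unfold c, Rmin in Hs. destruct (Rle_dec b t); lra. }
    rewrite (is_RIntC_unique _ _ _ _ (RInt_wide k a c 0 t Hk Hc3 ltac:(lra) Hc2 V)).
    now rewrite (is_RIntC_unique _ _ _ _ (RInt_wide k a c a b Hk Hc3 ltac:(lra) Hc1 V)).
  - assert (Z : forall s, k s = RtoC 0).
    { intros s. destruct (Rlt_dec s a); [auto|]. apply Kg. lra. }
    rewrite (is_RIntC_unique _ _ _ _ (is_RIntC_zero k 0 t (fun s _ => Z s))).
    now rewrite (is_RIntC_unique _ _ _ _ (is_RIntC_zero k a b (fun s _ => Z s))).
Qed.

Lemma laplace_conv_Cc f g : Cc f -> Cc g -> Cc (laplace_conv f g).
Proof.
  intros Hf Hg. destruct (Cc_common_support f g Hf Hg) as (a & b & Hab & Vf & Vg).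
  assert (Sf := smooth_contC0 f (proj1 Hf)). assert (Sg := smooth_contC0 g (proj1 Hg)).
  assert (E : laplace_conv f g = conv_on a b (fun s => Cconj (f s)) g).
  { apply functional_extensionality; intros t. now apply laplace_conv_eq. }
  rewrite E. split.
  - apply conv_on_smooth with a b; auto using contC_conj; try lra. apply Hg.
  - exists (a + a), (b + b). split; [lra|]. apply conv_on_vanishes; auto; lra.
Qed.

(* Fubini's theorem for a convolution: if [G] is a primitive of [g], the
   convolution with [G] is a primitive of the convolution with [g]. *)
Lemma conv_on_integral a b p g a' b' A B : a <= b -> contC p -> smooth g -> a' <= b' ->
  vanishes_outside g a' b' -> A <= a + a' -> b + b' <= B ->
  is_RIntC (conv_on a b p g) A B (Cmult (RIntC p a b) (RIntC g a' b')).
Proof.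
  intros Hab Hp Sg Hab' Vg HA HB.
  assert (Hg := smooth_contC0 g Sg).
  set (G := fun t => RIntC g a' t).
  assert (DG : forall t, is_deriveC G t (g t)).
  { intros t. apply (is_derive_RInt (V := C_R_NormedModule) g G a' t); [|apply Hg].
    apply filter_forall. intros s. now apply contC_RInt. }
  destruct (compact_bounded g a' b' 1 Sg Hab' Vg) as (M & _ & HM).
  assert (D : forall t, is_deriveC (conv_on a b p G) t (conv_on a b p g t)).
  { intros t. apply conv_on_derive with (CDerive_n g 1) M; auto.
    - intros s. eapply is_deriveC_ext; [apply CDerive_n_0|reflexivity|apply (smooth_jet g Sg)].
    - now apply smooth_contC. }
  assert (Hc : contC (conv_on a b p g)).
  { apply smooth_contC0. now apply conv_on_smooth with a' b'. }
  assert (HG : contC G) by (eapply contC_of_derive; apply DG).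
  change (is_RIntC (conv_on a b p g) A B (Cmult (RIntC p a b) (G b'))).
  replace (Cmult (RIntC p a b) (G b')) with
    (Cminus (conv_on a b p G B) (conv_on a b p G A)); [now apply is_RIntC_derive|].
  (* At [A] each [G (A - s)] is still 0; at [B] each [G (B - s)] has reached the total integral of
     [g]. *)
  assert (EA : conv_on a b p G A = RtoC 0).
  { apply is_RIntC_unique, is_RIntC_zero. rewrite Rmin_left, Rmax_right by lra.
    intros s Hs. unfold G. rewrite (is_RIntC_unique g a' (A - s) (RtoC 0)); [ring|].
    apply is_RIntC_zero. rewrite Rmin_right, Rmax_left by lra. intros; apply Vg; lra. }
  assert (EB : conv_on a b p G B = Cmult (RIntC p a b) (G b')).
  { apply is_RIntC_unique.
    apply is_RIntC_ext with (fun s => Cmult (RIntC g a' b') (p s)).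
    - rewrite Rmin_left, Rmax_right by lra. intros s Hs. unfold G.
      rewrite (is_RIntC_unique _ _ _ _ (RInt_wide g a' b' a' (B - s) Hg Hab' (Rle_refl _) ltac:(lra) Vg)).
      ring.
    - rewrite Cmult_comm. apply is_RIntC_scal. now apply contC_RInt. }
  rewrite EA, EB. ring.
Qed.

Lemma smooth_kernel z : smooth (fun t => Cexp (Cmult (RtoC (- t)) z)).
Proof.
  apply (jet_of _ (fun k t => Cmult (Cpow (Copp z) k) (Cexp (Cmult (RtoC (- t)) z)))).
  - intros k t. eapply is_deriveC_ext; [reflexivity| |
      apply is_deriveC_mult; [apply is_deriveC_const|apply is_deriveC_kernel]].
    cbn [Cpow]. ring.
  - intros t. cbn. ring.
Qed.

(** For real [x] the kernel exp (- t x) splits into exp (- s x) and exp (- (t - s) x), both real. So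
    the transform is the integral of the convolution of [conj e] with [e], which factors by
    [conv_on_integral]. *)
Lemma laplace_R_conv f x : Cc f ->
  laplace_R (laplace_conv f f) x = Cmult (laplace_R f x) (Cconj (laplace_R f x)).
Proof.
  intros Hf. destruct Hf as (Sf & a & b & Hab & Vf).
  assert (Hf : Cc f) by (split; auto; exists a, b; auto).
  assert (Cf := smooth_contC0 f Sf).
  set (e := laplace_integrand f (RtoC x)).
  assert (Se : smooth e) by (apply smooth_mult; auto using smooth_kernel).
  assert (Ve : vanishes_outside e a b) by now apply laplace_integrand_vanishes.
  assert (Ce := smooth_contC0 e Se).
  assert (Ie : RIntC e a b = laplace_R f x).
  { apply is_RIntC_unique. apply laplace_is_RInt with a b; auto; lra. }
  assert (Iec : RIntC (fun s => Cconj (e s)) a b = Cconj (laplace_R f x)).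
  { rewrite <- Ie. apply is_RIntC_unique, is_RIntC_conj, contC_RInt, Ce. }
  assert (H1 := conv_on_integral a b (fun s => Cconj (e s)) e a b 0 (b + b) ltac:(lra)
    (contC_conj e Ce) Se ltac:(lra) Ve ltac:(lra) ltac:(lra)).
  rewrite Ie, Iec in H1.
  assert (V2 : vanishes_outside (laplace_conv f f) (a + a) (b + b)).
  { intros t Ht. rewrite (laplace_conv_eq f f a b) by auto.
    apply (conv_on_vanishes a b _ f a b); auto; lra. }
  assert (H2 := laplace_is_RInt (laplace_conv f f) (a + a) (b + b) (RtoC x)
    (smooth_contC0 _ (proj1 (laplace_conv_Cc f f Hf Hf))) ltac:(lra) V2 0 (b + b) ltac:(lra) ltac:(lra)).
  rewrite Cmult_comm.
  rewrite <- (is_RIntC_unique _ _ _ _ H1). symmetry. apply is_RIntC_unique.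
  apply is_RIntC_ext with (2 := H2). intros t _.
  unfold laplace_integrand. rewrite (laplace_conv_eq f f a b) by auto.
  unfold conv_on. symmetry. apply is_RIntC_unique.
  apply is_RIntC_ext with (fun s => Cmult (Cexp (Cmult (RtoC (- t)) (RtoC x)))
    (Cmult (Cconj (f s)) (f (t - s)))).
  - intros s _. unfold e, laplace_integrand.
    rewrite <- !RtoC_mult, !Cexp_RtoC, Cmult_conj.
    replace (Cconj (RtoC (exp (- s * x)))) with (RtoC (exp (- s * x)))
      by (apply C_eq; cbn; ring).
    replace (- t * x) with (- s * x + - (t - s) * x) by ring.
    rewrite exp_plus, RtoC_mult. ring.
  - apply is_RIntC_scal, contC_RInt, conv_on_contC; auto using contC_conj.
Qed.

Lemma Cc_conj f : Cc f -> Cc (fun t => Cconj (f t)).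
Proof.
  intros (S & a & b & Hab & V). split; [now apply smooth_conj|].
  exists a, b. split; auto. intros t Ht. rewrite V by auto. apply C_eq; cbn; ring.
Qed.

Lemma laplace_R_conj f x : Cc f -> laplace_R (fun t => Cconj (f t)) x = Cconj (laplace_R f x).
Proof.
  intros Hf. assert (Hf' := Cc_conj f Hf). destruct (Cc_common_support _ _ Hf Hf') as (a & b & Hab & V & V').
  assert (H := laplace_is_RInt f a b (RtoC x) (smooth_contC0 _ (proj1 Hf)) Hab V a b (Rle_refl _) (Rle_refl _)).
  assert (H' := laplace_is_RInt _ a b (RtoC x) (smooth_contC0 _ (proj1 Hf')) Hab V' a b (Rle_refl _) (Rle_refl _)).
  unfold laplace_R. rewrite <- (is_RIntC_unique _ _ _ _ H'). apply is_RIntC_unique.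
  apply is_RIntC_ext with (2 := is_RIntC_conj _ _ _ _ H). intros t _. unfold laplace_integrand.
  rewrite <- RtoC_mult, Cexp_RtoC, Cmult_conj. f_equal. apply C_eq; cbn; ring.
Qed.

Lemma sigma_function_eval h sigma sigma0 F : is_sigma_function h sigma ->
  acts_through_Sgam 0 sigma sigma0 -> Cc F -> h F = sigma0 (laplace_R F).
Proof.
  intros [_ Hs] [_ Ha] HF. rewrite <- Hs by auto. unfold laplace_adj.
  rewrite Ha by now apply laplace_Yspace. reflexivity.
Qed.

Lemma hankel_form_eq h sigma sigma0 f : is_sigma_function h sigma ->
  acts_through_Sgam 0 sigma sigma0 -> Cc f ->
  hankel_form h f = transform_form sigma0 laplace_R f f.
Proof.
  intros Hs Ha Hf. unfold hankel_form, transform_form.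
  rewrite (sigma_function_eval h sigma sigma0) by (auto; now apply laplace_conv_Cc).
  f_equal. apply functional_extensionality; intros x. now apply laplace_R_conv.
Qed.

(** The convolution and its conjugate have the same Laplace transform |L f|^2 on the real line, so
    [h] takes the same value on both, and reality of [h] makes this value real. *)
Lemma hankel_form_real h sigma sigma0 f : real_functional h -> is_sigma_function h sigma ->
  acts_through_Sgam 0 sigma sigma0 -> Cc f ->
  Im (transform_form sigma0 laplace_R f f) = 0.
Proof.
  intros Hr Hs Ha Hf. rewrite <- (hankel_form_eq h sigma) by auto. unfold hankel_form.
  assert (HF : Cc (laplace_conv f f)) by now apply laplace_conv_Cc.
  assert (E : Cconj (h (laplace_conv f f)) = h (laplace_conv f f)).
  { rewrite Hr by auto. rewrite !(sigma_function_eval h sigma sigma0) by auto using Cc_conj.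
    f_equal. apply functional_extensionality; intros x.
    rewrite laplace_R_conj, laplace_R_conv, Cmult_conj, Cconj_conj by auto. apply Cmult_comm. }
  apply (f_equal Im) in E. rewrite im_conj in E. lra.
Qed.

Lemma sigma_form_eq sigma0 f : sigma_form sigma0 f = transform_form sigma0 (fun f => f) f f.
Proof.
  unfold sigma_form, transform_form. f_equal. apply functional_extensionality; intros x.
  rewrite <- Cmod2_conj, RtoC_pow. reflexivity.
Qed.

(** * Bump functions and truncation *)

(** The span of this family is closed under differentiation, so [flat 0], the classical flat
    function, is smooth. *)
Definition flat (n : nat) (t : R) : R :=
  if Rlt_dec 0 t then (/ t) ^ n * exp (- / t) else 0.

(** The inequality [u <= m exp (u / m)], raised to the power [m]. For [m = 0] the bound is 0^0 =
    1. *)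
Lemma pow_exp_neg_bound m u : 0 <= u -> u ^ m * exp (- u) <= INR m ^ m.
Proof.
  intros Hu. destruct m as [|m].
  - cbn. rewrite Rmult_1_l. rewrite <- exp_0. apply exp_le. lra.
  - set (M := INR (S m)). assert (HM : 0 < M) by (apply lt_0_INR; lia).
    assert (E : exp u = exp (u / M) ^ (S m)).
    { rewrite <- exp_INR_mult. f_equal. fold M. field. lra. }
    assert (H1 : u <= M * exp (u / M)).
    { pose proof (exp_ineq1_le (u / M)). assert (u = M * (u / M)) by (field; lra). nra. }
    assert (H2 : u ^ S m <= (M * exp (u / M)) ^ S m) by (apply pow_incr; lra).
    rewrite Rpow_mult_distr, <- E in H2.
    rewrite exp_Ropp. pose proof (exp_pos u).
    apply (Rmult_le_reg_r (exp u)); auto.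
    rewrite Rmult_assoc, Rinv_l by lra. lra.
Qed.

Lemma flat_pos_derive n t : 0 < t ->
  is_derive (fun t => (/ t) ^ n * exp (- / t)) t
    (- INR n * ((/ t) ^ (S n) * exp (- / t)) + (/ t) ^ (S (S n)) * exp (- / t)).
Proof.
  intros Ht. auto_derive; [lra|]. destruct n as [|n].
  - cbn. field. lra.
  - rewrite S_INR. cbn [pow Nat.pred]. set (p := (/ t) ^ n). field. lra.
Qed.

Lemma flat_derive n t :
  is_deriveC (fun t => RtoC (flat n t)) t (RtoC (- INR n * flat (S n) t + flat (S (S n)) t)).
Proof.
  destruct (Rtotal_order t 0) as [Ht|[->|Ht]].
  - eapply is_derive_ext_loc; [|].
    2:{ replace (RtoC (- INR n * flat (S n) t + flat (S (S n)) t)) with (RtoC 0).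
        - apply is_deriveC_const.
        - unfold flat. destruct (Rlt_dec 0 t); [lra|]. f_equal; ring. }
    apply locally_Rabs with (- t); [lra|]. intros u Hu.
    apply Rabs_def2 in Hu. unfold flat. destruct (Rlt_dec 0 u); [lra|reflexivity].
  (* At the origin [flat n y] equals [y ^ 2 * flat (n + 2) y] with a bounded second factor, so the
     remainder is quadratic. *)
  - apply is_deriveC_eps. intros eps He.
    destruct (quadratic_eps (INR (S (S n)) ^ S (S n)) eps) as (d & Hd & Q); auto.
    { apply pow_le, pos_INR. }
    exists d. split; auto. intros y Hy. rewrite Rminus_0_r in Hy |- *.
    destruct (Q (Rabs y) (conj (Rabs_pos _) Hy)) as [_ Q2]. eapply Rle_trans; [|exact Q2].
    replace (Cminus _ _) with (RtoC (flat n y)).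
    2:{ assert (Z : forall m, flat m 0 = 0) by (intros m; unfold flat; destruct (Rlt_dec 0 0); lra).
        rewrite !Z, Rmult_0_r, Rplus_0_l. ring. }
    rewrite Cmod_R, pow2_abs. unfold flat. destruct (Rlt_dec 0 y) as [Hy0|Hy0].
    + rewrite Rabs_pos_eq.
      2:{ apply Rmult_le_pos; [apply pow_le; left; now apply Rinv_0_lt_compat|left; apply exp_pos]. }
      replace ((/ y) ^ n * exp (- / y)) with (((/ y) ^ (S (S n)) * exp (- / y)) * y ^ 2).
      2:{ cbn [pow]. field. lra. }
      apply Rmult_le_compat_r; [apply pow2_ge_0|].
      apply pow_exp_neg_bound. left; now apply Rinv_0_lt_compat.
    + rewrite Rabs_R0. apply Rmult_le_pos; [apply pow_le, pos_INR|apply pow2_ge_0].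
  - eapply is_derive_ext_loc; [|apply is_deriveC_RtoC].
    2:{ eapply is_derive_ext_loc; [|].
        2:{ replace (- INR n * flat (S n) t + flat (S (S n)) t) with
             (- INR n * ((/ t) ^ (S n) * exp (- / t)) + (/ t) ^ (S (S n)) * exp (- / t)).
            - now apply flat_pos_derive.
            - unfold flat. destruct (Rlt_dec 0 t); [reflexivity|lra]. }
        apply locally_Rabs with t; [exact Ht|]. intros u Hu.
        apply Rabs_def2 in Hu.
        instantiate (1 := flat n). unfold flat. destruct (Rlt_dec 0 u); [reflexivity|lra]. }
    apply filter_forall. reflexivity.
Qed.

Fixpoint flat_jet (k n : nat) (t : R) : R :=
  match k with
  | O => flat n t
  | S k => - INR n * flat_jet k (S n) t + flat_jet k (S (S n)) t
  end.

Lemma flat_smooth : smooth (fun t => RtoC (flat 0 t)).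
Proof.
  apply (jet_of _ (fun k t => RtoC (flat_jet k 0 t))); [|reflexivity].
  intros k. generalize O as n. induction k as [|k IH]; intros n x.
  - apply flat_derive.
  - cbn [flat_jet]. eapply is_deriveC_ext; [| |apply is_deriveC_plus;
      [apply is_deriveC_mult; [apply (is_deriveC_const (RtoC (- INR n)))|apply (IH (S n))]|apply (IH (S (S n)))]].
    + intros t. cbn beta. rewrite RtoC_plus, RtoC_mult. reflexivity.
    + cbn beta. cbn [flat_jet]. rewrite <- !RtoC_mult, <- !RtoC_plus. f_equal. ring.
Qed.

Lemma flat_nonneg t : 0 <= flat 0 t.
Proof. unfold flat. destruct (Rlt_dec 0 t); [|lra]. cbn. pose proof (exp_pos (- / t)). lra. Qed.

Lemma flat_pos t : 0 < t -> 0 < flat 0 t.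
Proof. intros Ht. unfold flat. destruct (Rlt_dec 0 t); [|lra]. cbn. pose proof (exp_pos (- / t)). lra. Qed.

Lemma exists_bump a b : exists r : R -> R, smooth (fun t => RtoC (r t)) /\
  vanishes_outside (fun t => RtoC (r t)) a b /\ (forall t, 0 <= r t) /\
  forall t, a < t < b -> 0 < r t.
Proof.
  exists (fun t => flat 0 (1 * t + - a) * flat 0 (-1 * t + b)). split; [|split; [|split]].
  - assert (E : (fun t => RtoC (flat 0 (1 * t + - a) * flat 0 (-1 * t + b))) =
      (fun t => Cmult (RtoC (flat 0 (1 * t + - a))) (RtoC (flat 0 (-1 * t + b))))).
    { apply functional_extensionality; intros t. apply RtoC_mult. }
    rewrite E. apply smooth_mult.
    + apply (smooth_affine (fun t => RtoC (flat 0 t)) 1 (- a)), flat_smooth.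
    + apply (smooth_affine (fun t => RtoC (flat 0 t)) (-1) b), flat_smooth.
  - intros t Ht. f_equal. unfold flat.
    destruct (Rlt_dec 0 (1 * t + - a)); [|ring].
    destruct (Rlt_dec 0 (-1 * t + b)); [|ring]. destruct Ht; exfalso; lra.
  - intros t. apply Rmult_le_pos; apply flat_nonneg.
  - intros t Ht. apply Rmult_lt_0_compat; apply flat_pos; lra.
Qed.

(** The normalized primitive of a bump on [1, 2]. The bounds in the last clause survive dilations,
    which the cutoffs need. *)
Lemma exists_step : exists th : R -> R, smooth (fun t => RtoC (th t)) /\
  (forall t, t <= 1 -> th t = 0) /\ (forall t, 2 <= t -> th t = 1) /\
  forall k, exists A, 0 <= A /\ forall t, 0 < t -> Cmod (CDerive_n (fun t => RtoC (th t)) k t) * t ^ k <= A.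
Proof.
  destruct (exists_bump 1 2) as (r & Sr & Vr & Nr & Pr).
  set (rC := fun t => RtoC (r t)) in *.
  assert (Cr := smooth_contC0 rC Sr).
  assert (Hr : forall t, continuous r t) by (intros t; apply (contC_Re rC Cr)).
  assert (Er : forall a b, ex_RInt r a b) by (intros; apply (ex_RInt_continuous (V := R_CompleteNormedModule)); auto).
  set (c := RInt r 1 2).
  assert (Hc : 0 < c) by (apply RInt_gt_0; auto; lra).
  set (th := fun t => RInt r 1 t / c).
  assert (Vr' : forall t, t < 1 \/ 2 < t -> r t = 0) by (intros t Ht; apply (f_equal Re (Vr t Ht))).
  assert (Z : forall a b, (forall t, Rmin a b < t < Rmax a b -> r t = 0) -> RInt r a b = 0).
  { intros a b H. transitivity (RInt (fun _ => 0) a b).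
    - now apply RInt_ext.
    - rewrite RInt_const. unfold scal; cbn; unfold mult; cbn; ring. }
  assert (T1 : forall t, t <= 1 -> th t = 0).
  { intros t Ht. unfold th. rewrite Z; [field; lra|]. rewrite Rmin_right, Rmax_left by lra.
    intros; apply Vr'; lra. }
  assert (T2 : forall t, 2 <= t -> th t = 1).
  { intros t Ht. unfold th. rewrite <- (RInt_Chasles r 1 2 t), (Z 2 t) by
     (auto; rewrite Rmin_left, Rmax_right by lra; intros; apply Vr'; lra).
    change ((c + 0) / c = 1). field. lra. }
  assert (J : smooth (fun t => RtoC (th t)) /\ forall k x, CDerive_n (fun t => RtoC (th t)) k x =
    match k with O => RtoC (th x) | S k => Cmult (RtoC (/ c)) (CDerive_n rC k x) end).
  { apply jet_of with (F := fun k x =>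
      match k with O => RtoC (th x) | S k => Cmult (RtoC (/ c)) (CDerive_n rC k x) end); auto.
    intros [|k] x.
    - rewrite CDerive_n_0. unfold rC. rewrite <- RtoC_mult. apply is_deriveC_RtoC.
      apply (is_derive_ext (fun t => / c * RInt r 1 t)).
      { intros t. change (/ c * RInt r 1 t = RInt r 1 t * / c). ring. }
      apply (is_derive_scal (fun t => RInt r 1 t)).
      apply (is_derive_RInt (V := R_NormedModule) r _ 1); auto.
      apply filter_forall. intros. apply (RInt_correct (V := R_CompleteNormedModule)). auto.
    - eapply is_deriveC_ext; [reflexivity| |apply is_deriveC_mult;
       [apply is_deriveC_const|apply (smooth_jet rC Sr)]]. cbn beta. ring. }
  destruct J as [Sth Eth].
  exists th. split; [auto|split; [auto|split; [auto|]]].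
  intros [|k].
  - destruct (contC_bounded_on _ 1 2 (smooth_contC _ 0 Sth) ltac:(lra)) as (M & M0 & HM).
    exists (M + 1). split; [lra|]. intros t Ht. rewrite Rmult_1_r.
    destruct (Rle_dec t 1); [|destruct (Rle_dec 2 t)].
    + rewrite Eth, T1, Cmod_0 by auto. lra.
    + rewrite Eth, T2, Cmod_1 by auto. lra.
    + specialize (HM t ltac:(lra)). lra.
  (* Derivatives of positive order are supported in [1, 2], where the power of [t] is at most
     [2 ^ S k]. *)
  - destruct (compact_bounded rC 1 2 k Sr ltac:(lra) Vr) as (M & M0 & HM).
    assert (Hc' : 0 < / c) by now apply Rinv_0_lt_compat.
    assert (P2 : 0 < 2 ^ S k) by (apply pow_lt; lra).
    exists (/ c * M * 2 ^ S k).
    assert (HA : 0 <= / c * M * 2 ^ S k) by (apply Rmult_le_pos; [apply Rmult_le_pos|]; lra).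
    split; auto. intros t Ht. rewrite Eth, Cmod_mult, Cmod_R, Rabs_pos_eq by lra.
    destruct (Rle_dec t 2) as [Ht2|Ht2].
    + apply Rmult_le_compat; [apply Rmult_le_pos; [lra|apply Cmod_ge_0]|apply pow_le; lra| |].
      * apply Rmult_le_compat_l; [lra|auto].
      * apply pow_incr; lra.
    + rewrite (CDerive_n_vanishes rC 1 2 k Vr), Cmod_0 by lra. lra.
Qed.

(* The seminorms [sup x^k |u^(k)(x)|] are invariant under dilations. *)
Definition scale_bounded (u : nat -> R -> C) : Prop :=
  (forall n, smooth (u n)) /\
  forall k, exists A, forall n x, 0 < x -> Cmod (CDerive_n (u n) k x) <= A * (/ x) ^ k.

Lemma scale_bounded_upto u k : scale_bounded u -> exists A, 0 <= A /\
  forall j, (j <= k)%nat -> forall n x, 0 < x -> Cmod (CDerive_n (u n) j x) <= A * (/ x) ^ j.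
Proof.
  intros [_ H].
  apply (uniform_upto (fun j A => forall n x, 0 < x -> Cmod (CDerive_n (u n) j x) <= A * (/ x) ^ j)); auto.
  intros j A A' HA P n x Hx. eapply Rle_trans; [now apply P|].
  apply Rmult_le_compat_r; auto. apply pow_le. left; now apply Rinv_0_lt_compat.
Qed.

Lemma scale_bounded_const c : scale_bounded (fun _ _ => c).
Proof.
  split; [intros; apply smooth_const|]. intros [|k].
  - exists (Cmod c). intros n x _. rewrite CDerive_n_0. cbn. lra.
  - exists 0. intros n x _. rewrite (proj2 (smooth_const c)), Cmod_0. lra.
Qed.

Lemma scale_bounded_minus u v : scale_bounded u -> scale_bounded v ->
  scale_bounded (fun n x => Cminus (u n x) (v n x)).
Proof.
  intros [Su Hu] [Sv Hv]. split; [intros; now apply smooth_minus|]. intros k.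
  destruct (Hu k) as (A & HA). destruct (Hv k) as (B & HB). exists (A + B). intros n x Hx.
  rewrite (proj2 (smooth_minus _ _ (Su n) (Sv n))). unfold Cminus.
  eapply Rle_trans; [apply Cmod_triangle|]. rewrite Cmod_opp.
  specialize (HA n x Hx). specialize (HB n x Hx). lra.
Qed.

Lemma scale_bounded_mult u v : scale_bounded u -> scale_bounded v ->
  scale_bounded (fun n x => Cmult (u n x) (v n x)).
Proof.
  intros Hu Hv. split; [intros n; apply smooth_mult; [apply Hu|apply Hv]|]. intros k.
  destruct (scale_bounded_upto u k Hu) as (A & A0 & HA).
  destruct (scale_bounded_upto v k Hv) as (B & B0 & HB).
  exists (2 ^ k * (A * B)). intros n x Hx.
  rewrite (proj2 (smooth_mult _ _ (proj1 Hu n) (proj1 Hv n))).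
  apply prodjet_bound; auto. left; now apply Rinv_0_lt_compat.
Qed.

Lemma scale_bounded_dilation f (mu : nat -> R) : smooth f -> (forall n, 0 < mu n) ->
  (forall k, exists A, 0 <= A /\ forall t, 0 < t -> Cmod (CDerive_n f k t) * t ^ k <= A) ->
  scale_bounded (fun n x => f (mu n * x + 0)).
Proof.
  intros Sf Hmu H. split; [intros n; now apply smooth_affine|]. intros k.
  destruct (H k) as (A & A0 & HA). exists A. intros n x Hx.
  rewrite (proj2 (smooth_affine f (mu n) 0 Sf)), Cmod_mult, Cmod_R.
  specialize (Hmu n). specialize (HA (mu n * x + 0) ltac:(nra)).
  rewrite Rabs_pos_eq by (apply pow_le; lra).
  rewrite pow_inv. assert (0 < x ^ k) by now apply pow_lt.
  apply (Rmult_le_reg_r (x ^ k)); auto. rewrite (Rmult_assoc A), Rinv_l by lra.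
  rewrite Rplus_0_r, Rpow_mult_distr in HA. rewrite Rplus_0_r. lra.
Qed.

Lemma abs_ln_large Q x m : 0 <= Q -> 2 * exp Q <= m -> 0 < x -> x <= 2 / m \/ m <= x -> Q <= Rabs (ln x).
Proof.
  intros HQ Hm Hx H. pose proof (exp_pos Q). destruct H as [H|H].
  - assert (L : ln x <= - Q).
    { rewrite <- (ln_exp (- Q)). apply Rcomplements.ln_le; auto.
      eapply Rle_trans; [exact H|]. rewrite exp_Ropp.
      apply (Rmult_le_reg_r (m * exp Q)); [nra|].
      replace (2 / m * (m * exp Q)) with (2 * exp Q) by (field; lra).
      replace (/ exp Q * (m * exp Q)) with m by (field; lra). exact Hm. }
    rewrite Rabs_left1 by lra. lra.
  - assert (L : Q <= ln x).
    { rewrite <- (ln_exp Q). apply Rcomplements.ln_le; auto. lra. }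
    eapply Rle_trans; [exact L|apply Rle_abs].
Qed.

(* The seminorms with [kappa + 1] control those with [kappa] up to a factor
   that is small near 0 and near infinity. *)
Lemma cutoff_null w f gamma : scale_bounded w -> smooth_Sgam gamma f ->
  (forall n x, 2 / (INR n + 1) < x < INR n + 1 -> w n x = RtoC 0) ->
  Sgam_null gamma (fun n x => Cmult (w n x) (f x)).
Proof.
  intros Hw [Sf Hf] Z kappa k eps He.
  destruct (scale_bounded_upto w k Hw) as (A & A0 & HA).
  destruct (Sgam_bound_upto gamma f (kappa + 1) k Hf) as (B & B0 & HB).
  set (K := 2 ^ k * (A * B)).
  assert (HK : 0 <= K).
  { unfold K. apply Rmult_le_pos; [apply pow_le; lra|]. now apply Rmult_le_pos. }
  (* Size of the logarithm at which the gain [/ (1 + Rabs (ln x))] brings the constant [K] below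
     [eps]. *)
  set (Q := K / eps). assert (HQ : 0 <= Q) by (unfold Q; apply Rdiv_le_0_compat; lra).
  destruct (INR_unbounded (2 * exp Q)) as (N & HN). exists N. intros n Hn x Hx.
  assert (Hn' : 2 * exp Q <= INR n + 1) by (apply le_INR in Hn; lra).
  (* On the open interval [w n] vanishes locally, hence with all its derivatives; elsewhere the
     logarithm has modulus at least [Q]. *)
  assert (Hor : 2 / (INR n + 1) < x < INR n + 1 \/ (x <= 2 / (INR n + 1) \/ INR n + 1 <= x)) by lra.
  destruct Hor as [Hin|Hout].
  - rewrite (CDerive_n_ext_loc _ (fun _ => RtoC 0)).
    + destruct k as [|k]; [rewrite CDerive_n_0|rewrite (proj2 (smooth_const _))]; rewrite Cmod_0;
      left; apply Rmult_lt_0_compat; auto using Sweight_pos.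
    + destruct Hin as [H1 H2].
      apply locally_Rabs with (Rmin (x - 2 / (INR n + 1)) (INR n + 1 - x));
        [apply Rmin_pos; lra|]. intros u Hu.
      apply Rabs_def2 in Hu.
      pose proof (Rmin_l (x - 2 / (INR n + 1)) (INR n + 1 - x)).
      pose proof (Rmin_r (x - 2 / (INR n + 1)) (INR n + 1 - x)).
      rewrite Z by lra. ring.
  - assert (HL := abs_ln_large Q x (INR n + 1) HQ Hn' Hx Hout).
    assert (Hx' : 0 < / x) by now apply Rinv_0_lt_compat.
    rewrite (proj2 (smooth_mult _ _ (proj1 Hw n) Sf)).
    eapply Rle_trans.
    + apply (prodjet_bound k _ _ A (B * Sweight gamma (kappa + 1) 0 x) (/ x)); auto; try lra.
      * apply Rmult_le_pos; auto. left; apply Sweight_pos.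
      * intros j Hj. rewrite Rmult_assoc, <- Sweight_k by auto. auto.
    + pose proof (Sweight_pos gamma kappa k x) as HS.
      replace (2 ^ k * (A * (B * Sweight gamma (kappa + 1) 0 x)) * (/ x) ^ k)
        with (K * (Sweight gamma (kappa + 1) 0 x * (/ x) ^ k)) by (unfold K; ring).
      rewrite <- Sweight_k, Sweight_succ_kappa by auto.
      apply (Rmult_le_reg_r (1 + Rabs (ln x))); [pose proof (Rabs_pos (ln x)); lra|].
      replace (K * (Sweight gamma kappa k x * / (1 + Rabs (ln x))) * (1 + Rabs (ln x)))
        with (K * Sweight gamma kappa k x) by (field; pose proof (Rabs_pos (ln x)); lra).
      replace (eps * Sweight gamma kappa k x * (1 + Rabs (ln x))) with
       (eps * (1 + Rabs (ln x)) * Sweight gamma kappa k x) by ring.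
      apply Rmult_le_compat_r; [lra|].
      assert (EQ : K = eps * Q) by (unfold Q; field; lra). rewrite EQ.
      apply Rmult_le_compat_l; lra.
Qed.

Lemma cutoff_approximation f : smooth_Sgam (1 / 4) f -> exists u : nat -> R -> C,
  (forall n, Cc (u n)) /\ Sgam_null (1 / 4) (fun n x => Cminus (u n x) (f x)).
Proof.
  intros Hf. destruct exists_step as (th & Sth & T1 & T2 & Bth).
  (* [A n] is 0 up to [1 / (n + 1)] and 1 from [2 / (n + 1)] on; [B n] is 0 up to [n + 1] and 1 from
     [2 (n + 1)] on. Thus [chi n] cuts off at both ends. *)
  set (A := fun (n : nat) x => RtoC (th ((INR n + 1) * x + 0))).
  set (B := fun (n : nat) x => RtoC (th (/ (INR n + 1) * x + 0))).
  assert (HP : forall n, 0 < INR n + 1) by (intros n; pose proof (pos_INR n); lra).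
  assert (HP' : forall n, 0 < / (INR n + 1)) by (intros; now apply Rinv_0_lt_compat).
  assert (HA : scale_bounded A)
    by (apply (scale_bounded_dilation (fun t => RtoC (th t)) (fun n => INR n + 1)); auto).
  assert (HB : scale_bounded B)
    by (apply (scale_bounded_dilation (fun t => RtoC (th t)) (fun n => / (INR n + 1))); auto).
  set (chi := fun n x => Cmult (A n x) (Cminus (RtoC 1) (B n x))).
  assert (Hchi : scale_bounded chi)
    by (apply scale_bounded_mult; auto; apply scale_bounded_minus; auto; apply scale_bounded_const).
  exists (fun n x => Cmult (chi n x) (f x)). split.
  - intros n. specialize (HP n). specialize (HP' n). split.
    + apply smooth_mult; [apply Hchi|apply Hf].
    + exists (/ (INR n + 1)), (2 * (INR n + 1)).
      assert (E : / (INR n + 1) * (INR n + 1) = 1) by (apply Rinv_l; lra).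
      pose proof (pos_INR n).
      split; [split; [lra|nra]|]. intros t [Ht|Ht]; unfold chi, A, B.
      * rewrite T1 by nra. ring.
      * rewrite (T2 (/ (INR n + 1) * t + 0)) by nra. ring.
  - assert (E : (fun n x => Cminus (Cmult (chi n x) (f x)) (f x)) =
      (fun n x => Cmult (Cminus (chi n x) (RtoC 1)) (f x))).
    { apply functional_extensionality; intros n. apply functional_extensionality; intros x. ring. }
    rewrite E. apply (cutoff_null (fun n x => Cminus (chi n x) (RtoC 1))); auto.
    + apply scale_bounded_minus; auto. apply scale_bounded_const.
    + intros n x [H1 H2]. specialize (HP n). specialize (HP' n).
      assert (En : / (INR n + 1) * (INR n + 1) = 1) by (apply Rinv_l; lra).
      assert (H3 : 2 <= (INR n + 1) * x) by (unfold Rdiv in H1; nra).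
      unfold chi, A, B. rewrite T2 by lra. rewrite (T1 (/ (INR n + 1) * x + 0)) by nra. ring.
Qed.

Lemma laplace_approximated_by_id : approximates laplace_R (fun f => f).
Proof. intros f Hf. apply cutoff_approximation. now apply laplace_R_admissible. Qed.

(** * Approximation by exponential sums *)

(** The expectation of [g] under the binomial law with parameters [n] and [u], by conditioning on
    one trial. When [g i] is the value of a function at [i / n], this is its Bernstein polynomial at
    [u]; [expectC] is the complex version. *)
Fixpoint expect (n : nat) (g : nat -> R) (u : R) : R :=
  match n with
  | O => g O
  | S n => (1 - u) * expect n g u + u * expect n (fun i => g (S i)) u
  end.

Fixpoint expectC (n : nat) (g : nat -> C) (u : R) : C :=
  match n with
  | O => g O
  | S n => Cplus (Cmult (RtoC (1 - u)) (expectC n g u))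
             (Cmult (RtoC u) (expectC n (fun i => g (S i)) u))
  end.

Lemma expect_le n u : 0 <= u <= 1 -> forall f g, (forall i, f i <= g i) ->
  expect n f u <= expect n g u.
Proof.
  intros Hu; induction n as [|n IH]; intros f g H; cbn; auto.
  apply Rplus_le_compat; apply Rmult_le_compat_l; try lra; apply IH; auto.
Qed.

Lemma expect_affine n u c d f : expect n (fun i => c + d * f i) u = c + d * expect n f u.
Proof.
  revert f; induction n as [|n IH]; intros f; cbn; auto.
  rewrite (IH f), (IH (fun i => f (S i))). ring.
Qed.

(** The center [a] is arbitrary for the induction: a successful trial moves it to [a - 1]. At
    [a = n u] this is the binomial variance. *)
Lemma expect_variance n u : forall a,
  expect n (fun i => (INR i - a) ^ 2) u = (INR n * u - a) ^ 2 + INR n * u * (1 - u).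
Proof.
  induction n as [|n IH]; intros a; [cbn; ring|]. cbn [expect]. rewrite IH.
  replace (expect n (fun i => (INR (S i) - a) ^ 2) u) with (expect n (fun i => (INR i - (a - 1)) ^ 2) u).
  - rewrite IH, S_INR. ring.
  - f_equal. apply functional_extensionality; intros i. rewrite S_INR. ring.
Qed.

Lemma Cmod_expectC_le n u c : 0 <= u <= 1 -> forall g,
  Cmod (Cminus (expectC n g u) c) <= expect n (fun i => Cmod (Cminus (g i) c)) u.
Proof.
  intros Hu; induction n as [|n IH]; intros g; cbn; [lra|].
  replace (Cminus _ c) with (Cplus (Cmult (RtoC (1 - u)) (Cminus (expectC n g u) c))
    (Cmult (RtoC u) (Cminus (expectC n (fun i => g (S i)) u) c))).
  - eapply Rle_trans; [apply Cmod_triangle|]. rewrite !Cmod_mult, !Cmod_R, !Rabs_pos_eq by lra.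
    apply Rplus_le_compat; apply Rmult_le_compat_l; try lra; apply IH.
  - rewrite RtoC_minus. ring.
Qed.

(* Bernstein's theorem, with Chebyshev's bound
   [|d| <= delta + d^2 / delta] for the deviations [d = i / n - u]. *)
Lemma bernstein V L eps : 0 <= L -> 0 < eps ->
  (forall s u, Cmod (Cminus (V s) (V u)) <= L * Rabs (s - u)) ->
  exists n, forall u, 0 <= u <= 1 ->
    Cmod (Cminus (expectC n (fun i => V (INR i / INR n)) u) (V u)) <= eps.
Proof.
  (* The constant and the variance term are at most [L * d] each, the latter once
     [N * (d * d) >= 1]; the [+ 1] covers [L = 0]. *)
  intros HL He HV. set (d := eps / (2 * L + 1)).
  assert (Hd : 0 < d) by (unfold d; apply Rdiv_lt_0_compat; lra).
  assert (Ed : d * (2 * L + 1) = eps) by (unfold d; field; lra).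
  destruct (INR_unbounded (/ (d * d))) as (n & Hn). exists n. intros u Hu.
  assert (Hdd : 0 < / (d * d)) by (apply Rinv_0_lt_compat; nra).
  set (N := INR n) in *. assert (HN : 0 < N) by lra.
  assert (HNd : 1 <= N * (d * d)).
  { assert (/ (d * d) * (d * d) = 1) by (field; lra). nra. }
  eapply Rle_trans; [now apply Cmod_expectC_le|].
  eapply Rle_trans; [apply (expect_le n u Hu _
    (fun i => L * d + (L / (d * N ^ 2)) * (INR i - N * u) ^ 2))|].
  - intros i. eapply Rle_trans; [apply HV|].
    set (z := INR i / N - u).
    replace ((INR i - N * u) ^ 2) with (N ^ 2 * (Rabs z) ^ 2).
    2:{ rewrite pow2_abs. unfold z. field. lra. }
    replace (L * d + L / (d * N ^ 2) * (N ^ 2 * Rabs z ^ 2)) with (L * (d + Rabs z ^ 2 / d))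
      by (field; split; lra).
    apply Rmult_le_compat_l; auto.
    apply (Rmult_le_reg_r d); auto.
    replace ((d + Rabs z ^ 2 / d) * d) with (d ^ 2 + Rabs z ^ 2) by (field; lra).
    pose proof (Rabs_pos z). pose proof (pow2_ge_0 (d - Rabs z)). nra.
  - rewrite expect_affine, expect_variance. fold N.
    replace (N * u - N * u) with 0 by ring.
    replace (L * d + L / (d * N ^ 2) * (0 ^ 2 + N * u * (1 - u))) with
      (L * (d + (u * (1 - u)) / (d * N))) by (field; split; lra).
    assert (H : u * (1 - u) / (d * N) <= d).
    { apply (Rmult_le_reg_r (d * N)); [nra|].
      replace (u * (1 - u) / (d * N) * (d * N)) with (u * (1 - u)) by (field; split; lra). nra. }
    nra.
Qed.

(** The pair [(c, i)] stands for c exp (- (i + 1) x), so every term decays at infinity; [k] is the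
    order of differentiation. *)
Fixpoint expsum (l : list (C * nat)) (k : nat) (x : R) : C :=
  match l with
  | [] => RtoC 0
  | (c, i) :: l => Cplus (Cmult c (RtoC ((- INR (S i)) ^ k * exp (- INR (S i) * x))))
                     (expsum l k x)
  end.

Lemma expsum_jet l : jet (expsum l).
Proof.
  intros k x; induction l as [|[c i] l IH]; cbn [expsum].
  - apply is_deriveC_const.
  - apply is_deriveC_plus; [|exact IH].
    eapply is_deriveC_ext; [reflexivity| |apply is_deriveC_mult; [apply is_deriveC_const|]].
    2:{ apply is_deriveC_RtoC with (b := (- INR (S i)) ^ S k * exp (- INR (S i) * x)).
        generalize (- INR (S i)); intros q. auto_derive; auto. cbn [pow].  ring. }
    cbn beta. ring.
Qed.

Lemma expsum_app l l' k x : expsum (l ++ l') k x = Cplus (expsum l k x) (expsum l' k x).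
Proof. induction l as [|[c i] l IH]; cbn [expsum app]; [ring|]. rewrite IH. ring. Qed.

Definition times_exp (l : list (C * nat)) := map (fun p => (fst p, S (snd p))) l.
Definition negate (l : list (C * nat)) := map (fun p => (Copp (fst p), snd p)) l.
(** The K-fold primitive that decays at infinity; all exponents are nonzero, so the division is
    legitimate. *)
Definition primitive (K : nat) (l : list (C * nat)) :=
  map (fun p => (Cmult (fst p) (RtoC (/ (- INR (S (snd p))) ^ K)), snd p)) l.

Lemma expsum_times_exp l x : expsum (times_exp l) 0 x = Cmult (RtoC (exp (- x))) (expsum l 0 x).
Proof.
  induction l as [|[c i] l IH]; cbn [expsum times_exp map fst snd]; [ring|].
  unfold times_exp in IH. rewrite IH.
  replace (- INR (S (S i)) * x) with (- x + - INR (S i) * x) by (rewrite (S_INR (S i)); ring).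
  rewrite exp_plus. cbn [pow]. rewrite !RtoC_mult. ring.
Qed.

Lemma expsum_negate l k x : expsum (negate l) k x = Copp (expsum l k x).
Proof.
  induction l as [|[c i] l IH]; cbn [expsum negate map fst snd]; [ring|].
  unfold negate in IH. rewrite IH. ring.
Qed.

Lemma expsum_primitive K l x : expsum (primitive K l) K x = expsum l 0 x.
Proof.
  induction l as [|[c i] l IH]; cbn [expsum primitive map fst snd]; [ring|].
  unfold primitive in IH. rewrite IH. f_equal. rewrite <- Cmult_assoc. f_equal.
  rewrite <- RtoC_mult. f_equal. cbn [pow]. field. apply pow_nonzero.
  pose proof (lt_0_INR (S i) (Nat.lt_0_succ i)). lra.
Qed.

Lemma expsum_decay l k : exists A, 0 <= A /\ forall x, 0 <= x -> Cmod (expsum l k x) <= A * exp (- x).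
Proof.
  induction l as [|[c i] l (A & A0 & HA)]; cbn [expsum].
  - exists 0. split; [lra|]. intros x _. rewrite Cmod_0. lra.
  - exists (Cmod c * Rabs ((- INR (S i)) ^ k) + A). split.
    { pose proof (Cmod_ge_0 c). pose proof (Rabs_pos ((- INR (S i)) ^ k)). nra. }
    intros x Hx. eapply Rle_trans; [apply Cmod_triangle|]. specialize (HA x Hx).
    rewrite Cmod_mult, Cmod_R, Rabs_mult, (Rabs_pos_eq (exp _)) by (left; apply exp_pos).
    assert (exp (- INR (S i) * x) <= exp (- x)).
    { apply exp_le. rewrite S_INR. pose proof (pos_INR i). nra. }
    pose proof (Cmod_ge_0 c). pose proof (Rabs_pos ((- INR (S i)) ^ k)).
    assert (0 <= Cmod c * Rabs ((- INR (S i)) ^ k)) by now apply Rmult_le_pos. nra.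
Qed.

(** Expansion of [u] times the Bernstein polynomial at [u = exp (- x)], with [1 - u] distributed.
    The extra factor [u] keeps all exponents at least 1. *)
Fixpoint bernstein_list (n : nat) (g : nat -> C) : list (C * nat) :=
  match n with
  | O => [(g O, O)]
  | S n => bernstein_list n g ++ times_exp (negate (bernstein_list n g))
             ++ times_exp (bernstein_list n (fun i => g (S i)))
  end.

Lemma expsum_bernstein_list n : forall g x,
  expsum (bernstein_list n g) 0 x = Cmult (RtoC (exp (- x))) (expectC n g (exp (- x))).
Proof.
  induction n as [|n IH]; intros g x.
  - cbn. replace (-(1) * x) with (- x) by ring. rewrite Rmult_1_l. ring.
  - cbn [bernstein_list expectC].
    rewrite !expsum_app, !expsum_times_exp, expsum_negate, !IH, RtoC_minus. ring.
Qed.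

(** [g x] is minus the integral of [g'] from [x] to infinity, and the integral of exp (- s) there is
    exp (- x), so the bound passes down with the same [eps]. The assumed decay of [g] fixes the
    constant of integration. *)
Lemma decay_of_derivative g g' eps : (forall x, is_deriveC g x (g' x)) -> contC g' ->
  (forall x, 0 < x -> Cmod (g' x) <= eps * exp (- x)) ->
  (exists A, forall x, 0 < x -> Cmod (g x) <= A * exp (- x)) ->
  forall x, 0 < x -> Cmod (g x) <= eps * exp (- x).
Proof.
  intros D Hc H (A & HA) x Hx. apply le_epsilon. intros d Hd.
  (* Far enough that the decay of [g] gives [Cmod (g y) <= d], since [exp y >= 1 + y]. *)
  set (y := x + Rabs A / d).
  assert (Hxy : x <= y).
  { unfold y. assert (0 <= Rabs A / d) by (apply Rdiv_le_0_compat; auto; apply Rabs_pos). lra. }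
  assert (Hy : Cmod (g y) <= d).
  { eapply Rle_trans; [apply HA; lra|]. rewrite exp_Ropp.
    pose proof (exp_ineq1_le y) as Hexp. pose proof (exp_pos y).
    apply (Rmult_le_reg_r (exp y)); auto.
    rewrite Rmult_assoc, Rinv_l by lra.
    assert (E : d * (Rabs A / d) = Rabs A) by (field; lra).
    pose proof (Rle_abs A). unfold y in *. nra. }
  assert (He : 0 <= eps).
  { specialize (H x Hx). pose proof (Cmod_ge_0 (g' x)). pose proof (exp_pos (- x)). nra. }
  assert (HI : is_RInt (fun s => eps * exp (- s)) x y (minus (- eps * exp (- y)) (- eps * exp (- x)))).
  { apply (is_RInt_derive (V := R_CompleteNormedModule) (fun s => - eps * exp (- s))).
    - intros s _. auto_derive; auto. ring.
    - intros s _. apply (ex_derive_continuous (K := R_AbsRing) (V := R_NormedModule)). auto_derive; auto. }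
  assert (HM : Cmod (Cminus (g y) (g x)) <= minus (- eps * exp (- y)) (- eps * exp (- x))).
  { rewrite <- norm_C_R.
    apply (norm_RInt_le (V := C_R_NormedModule) g' (fun s => eps * exp (- s)) x y); auto.
    - intros s Hs. rewrite norm_C_R. apply H. lra.
    - now apply is_RIntC_derive. }
  change (minus (- eps * exp (- y)) (- eps * exp (- x))) with
    (- eps * exp (- y) + - (- eps * exp (- x))) in HM.
  replace (g x) with (Cplus (g y) (Copp (Cminus (g y) (g x)))) by ring.
  eapply Rle_trans; [apply Cmod_triangle|]. rewrite Cmod_opp.
  pose proof (exp_pos (- y)). nra.
Qed.

(** The [j]-th derivative of [v] in the variable [u = exp (- x)], divided by [u ^ p]. Bernstein's
    theorem is applied with [p = 1], so that the factor exp (- x) can be restored afterwards; larger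
    [p] arise by differentiation. For compactly supported [v] the extension by 0 stays smooth at
    [u = 0]. *)
Definition log_transform (v : R -> C) (j p : nat) (u : R) : C :=
  if Rlt_dec 0 u then Cmult (RtoC ((/ u) ^ p)) (CDerive_n v j (- ln u)) else RtoC 0.

Lemma log_transform_vanishes v a b j p u : vanishes_outside v a b -> u < exp (- b) ->
  log_transform v j p u = RtoC 0.
Proof.
  intros V Hu. unfold log_transform. destruct (Rlt_dec 0 u) as [H0|]; auto.
  rewrite (CDerive_n_vanishes v a b j V); [ring|]. right.
  apply (ln_increasing u) in Hu; auto. rewrite ln_exp in Hu. lra.
Qed.

Lemma log_transform_derive v a b j p u : smooth v -> vanishes_outside v a b ->
  is_deriveC (log_transform v j p) u
    (Copp (Cplus (log_transform v (S j) (S p) u)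
      (Cmult (RtoC (INR p)) (log_transform v j (S p) u)))).
Proof.
  intros Sv V. destruct (Rlt_dec 0 u) as [Hu|Hu].
  - eapply is_derive_ext_loc.
    { apply locally_Rabs with u; [exact Hu|]. intros t Ht.
      apply Rabs_def2 in Ht.
      instantiate (1 := fun t => Cmult (RtoC ((/ t) ^ p)) (CDerive_n v j (- ln t))).
      unfold log_transform. destruct (Rlt_dec 0 t); [reflexivity|lra]. }
    eapply is_deriveC_ext; [reflexivity| |apply is_deriveC_mult;
      [apply (is_deriveC_RtoC _ _ (- INR p * (/ u) ^ S p))
      |apply is_deriveC_comp with (u := fun t => - ln t) (b := - / u); [apply (smooth_jet v Sv)|]]].
    + cbn beta. unfold log_transform. destruct (Rlt_dec 0 u); [|lra].
      cbn [pow]. rewrite !RtoC_mult, !RtoC_opp. ring.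
    + auto_derive; [lra|]. destruct p as [|p]; [cbn; ring|]. cbn [pow Nat.pred].
      set (q := (/ u) ^ p). field. lra.
    + auto_derive; [lra|]. field. lra.
  - eapply is_derive_ext_loc; [|].
    2:{ eapply is_deriveC_ext; [reflexivity| |apply (is_deriveC_const (RtoC 0))].
        rewrite !(log_transform_vanishes v a b) by (auto; pose proof (exp_pos (- b)); lra). ring. }
    apply locally_Rabs with (exp (- b)); [apply exp_pos|]. intros t Ht.
    apply Rabs_def2 in Ht. symmetry. apply (log_transform_vanishes v a b); auto. lra.
Qed.

Lemma log_transform_bounded v a b j p : smooth v -> a <= b -> vanishes_outside v a b ->
  exists M, 0 <= M /\ forall u, Cmod (log_transform v j p u) <= M.
Proof.
  intros Sv Hab V. destruct (compact_bounded v a b j Sv Hab V) as (M & M0 & HM).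
  assert (Hp : 0 <= exp b ^ p) by (apply pow_le; left; apply exp_pos).
  exists (exp b ^ p * M). split; [now apply Rmult_le_pos|]. intros u.
  destruct (Rlt_dec u (exp (- b))) as [Hu|Hu].
  - rewrite (log_transform_vanishes v a b), Cmod_0 by auto. now apply Rmult_le_pos.
  - pose proof (exp_pos (- b)). unfold log_transform. destruct (Rlt_dec 0 u); [|lra].
    assert (0 < / u) by now apply Rinv_0_lt_compat.
    rewrite Cmod_mult, Cmod_R, Rabs_pos_eq by (apply pow_le; lra).
    apply Rmult_le_compat; auto using Cmod_ge_0; [apply pow_le; lra|].
    apply pow_incr. split; [lra|]. replace (exp b) with (/ exp (- b)).
    + apply Rinv_le_contravar; lra.
    + rewrite exp_Ropp. apply Rinv_inv.
Qed.

Lemma log_transform_lipschitz v a b j p : smooth v -> a <= b -> vanishes_outside v a b ->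
  exists L, 0 <= L /\ forall s u,
    Cmod (Cminus (log_transform v j p s) (log_transform v j p u)) <= L * Rabs (s - u).
Proof.
  intros Sv Hab V.
  destruct (log_transform_bounded v a b (S j) (S p) Sv Hab V) as (M1 & M10 & H1).
  destruct (log_transform_bounded v a b j (S p) Sv Hab V) as (M2 & M20 & H2).
  pose proof (pos_INR p) as Hp.
  exists (M1 + INR p * M2). split; [nra|]. intros s u. rewrite Rmult_comm.
  apply (mean_value_C (log_transform v j p) _ u s _ (fun t => log_transform_derive v a b j p t Sv V)).
  - assert (Hl : forall j p, contC (log_transform v j p))
      by (intros; eapply contC_of_derive; intros t; now apply log_transform_derive with a b).
    intros t. apply (continuous_opp (V := C_R_NormedModule)), (continuous_plus (V := C_R_NormedModule)).
    + apply Hl.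
    + apply (contC_mult (fun _ => RtoC (INR p))); auto. intros ?; apply continuous_const.
  - intros t _. rewrite Cmod_opp. eapply Rle_trans; [apply Cmod_triangle|].
    rewrite Cmod_mult, Cmod_R, Rabs_pos_eq by auto. specialize (H1 t). specialize (H2 t). nra.
Qed.

(* The top derivative is approximated by Bernstein polynomials in [exp (- x)];
   the lower ones follow by integration from infinity. *)
Lemma expsum_approximation v a b K eps : smooth v -> 0 < a < b -> vanishes_outside v a b ->
  0 < eps -> exists l, forall k, (k <= K)%nat -> forall x, 0 < x ->
    Cmod (Cminus (expsum l k x) (CDerive_n v k x)) <= eps * exp (- x).
Proof.
  intros Sv Hab V He.
  destruct (log_transform_lipschitz v a b K 1 Sv ltac:(lra) V) as (L & HL & Lip).
  destruct (bernstein _ L eps HL He Lip) as (n & Hn).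
  set (l := bernstein_list n (fun i => log_transform v K 1 (INR i / INR n))).
  exists (primitive K l).
  assert (Top : forall x, 0 < x ->
    Cmod (Cminus (expsum (primitive K l) K x) (CDerive_n v K x)) <= eps * exp (- x)).
  { intros x Hx. rewrite expsum_primitive. unfold l. rewrite expsum_bernstein_list.
    pose proof (exp_pos (- x)) as P.
    assert (Hu : 0 <= exp (- x) <= 1).
    { split; [lra|]. rewrite <- exp_0. apply exp_le. lra. }
    specialize (Hn _ Hu).
    assert (E : CDerive_n v K x = Cmult (RtoC (exp (- x))) (log_transform v K 1 (exp (- x)))).
    { unfold log_transform. destruct (Rlt_dec 0 (exp (- x))); [|lra].
      rewrite ln_exp, Ropp_involutive, Cmult_assoc, <- RtoC_mult.
      replace (exp (- x) * (/ exp (- x)) ^ 1) with 1 by (field; lra). ring. }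
    rewrite E.
    replace (Cminus (Cmult _ _) (Cmult _ _)) with (Cmult (RtoC (exp (- x)))
      (Cminus (expectC n (fun i => log_transform v K 1 (INR i / INR n)) (exp (- x)))
        (log_transform v K 1 (exp (- x))))) by ring.
    rewrite Cmod_mult, Cmod_R, Rabs_pos_eq by lra. nra. }
  (* Descending induction: [j] counts the integrations down from order [K]. *)
  assert (Down : forall j, (j <= K)%nat -> forall x, 0 < x ->
    Cmod (Cminus (expsum (primitive K l) (K - j) x) (CDerive_n v (K - j) x)) <= eps * exp (- x)).
  { intros j; induction j as [|j IH]; intros Hj; [now rewrite Nat.sub_0_r|].
    set (m := (K - S j)%nat). assert (Em : (K - j)%nat = S m) by lia.
    rewrite Em in IH.
    assert (D : forall k x, is_deriveC (fun x => Cminus (expsum (primitive K l) k x) (CDerive_n v k x)) x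
       (Cminus (expsum (primitive K l) (S k) x) (CDerive_n v (S k) x))).
    { intros k x. apply (is_derive_minus (K := R_AbsRing) (V := C_R_NormedModule)).
      - apply expsum_jet.
      - apply (smooth_jet v Sv). }
    apply decay_of_derivative with (2 := contC_of_derive _ _ (D (S m))); auto.
    { apply IH. lia. }
    (* Both parts are bounded by multiples of exp (- x), so the difference has no constant left at
       infinity. *)
    destruct (expsum_decay (primitive K l) m) as (A & A0 & HA).
    destruct (Cc_rapid v ltac:(split; auto; exists a, b; auto)) as (_ & c & Hc & _).
    destruct (compact_bounded v a b m Sv ltac:(lra) V) as (M & M0 & HM).
    exists (A + M * exp b). intros x Hx. unfold Cminus.
    eapply Rle_trans; [apply Cmod_triangle|]. rewrite Cmod_opp, Rmult_plus_distr_r.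
    apply Rplus_le_compat; [apply HA; lra|].
    destruct (Rlt_dec b x) as [Hbx|Hbx].
    - rewrite (CDerive_n_vanishes v a b m V), Cmod_0 by auto.
      apply Rmult_le_pos; [apply Rmult_le_pos|]; auto; left; apply exp_pos.
    - eapply Rle_trans; [apply HM|]. rewrite Rmult_assoc, <- exp_plus.
      pose proof (exp_ineq1_le (b + - x)). nra. }
  intros k Hk. replace k with (K - (K - k))%nat by lia. apply Down. lia.
Qed.

(** * Density of the Laplace transforms *)

(* [quotjet E q k W n] is the k-th derivative of [W 0 * q ^ n] when [W] and [E]
   are jets and [q = 1 / E 0]. *)
Fixpoint quotjet (E : nat -> R -> C) (q : R -> C) (k : nat) (W : nat -> R -> C) (n : nat) (x : R) : C :=
  match k with
  | O => Cmult (W O x) (Cpow (q x) n)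
  | S k => Cplus (quotjet E q k (fun j => W (S j)) n x)
     (Cmult (RtoC (- INR n)) (quotjet E q k (prodjet W (fun j => E (S j))) (S n) x))
  end.

Lemma is_deriveC_pow (q : R -> C) x d n : is_deriveC q x d ->
  is_deriveC (fun t => Cpow (q t) n) x (Cmult (Cmult (RtoC (INR n)) (Cpow (q x) (pred n))) d).
Proof.
  intros H; induction n as [|n IH].
  - apply (is_deriveC_ext (fun _ => RtoC 1) _ x (RtoC 0)); [reflexivity| |apply is_deriveC_const].
    change (INR 0) with 0. ring.
  - eapply is_deriveC_ext; [| |apply (is_deriveC_mult q (fun t => Cpow (q t) n) x d _ H IH)].
    + reflexivity.
    + rewrite S_INR, RtoC_plus. destruct n as [|n]; cbn [Cpow pred]; [cbn; ring|ring].
Qed.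

Lemma quotjet_derive E q : jet E ->
  (forall x, is_deriveC q x (Copp (Cmult (E 1%nat x) (Cpow (q x) 2)))) ->
  forall k W n x, jet W -> is_deriveC (quotjet E q k W n) x (quotjet E q (S k) W n x).
Proof.
  intros JE Dq k; induction k as [|k IH]; intros W n x JW.
  - eapply is_deriveC_ext; [reflexivity| |
      apply is_deriveC_mult; [apply JW|apply is_deriveC_pow, Dq]].
    cbn [quotjet prodjet]. rewrite RtoC_opp.
    destruct n as [|n]; cbn [Cpow pred]; [cbn; ring|ring].
  - cbn [quotjet]. eapply is_deriveC_ext; [reflexivity| |
      apply is_deriveC_plus; [apply IH|apply is_deriveC_mult; [apply is_deriveC_const|apply IH]]].
    + cbn beta. cbn [quotjet]. ring.
    + intros j y; apply JW.
    + apply jet_prodjet; [exact JW|]. intros j y; apply JE.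
Qed.

Lemma smooth_div w e : smooth w -> smooth (fun x => RtoC (e x)) -> (forall x, 0 < e x) ->
  smooth (fun x => Cmult (w x) (RtoC (/ e x))).
Proof.
  intros Sw Se He. set (eC := fun x => RtoC (e x)) in *.
  set (q := fun x => RtoC (/ e x)).
  assert (JE := smooth_jet eC Se).
  assert (De : forall x, is_derive e x (Re (CDerive_n eC 1 x)) /\ Im (CDerive_n eC 1 x) = 0).
  { intros x. assert (D0 : is_deriveC eC x (CDerive_n eC 1 x)).
    { eapply is_deriveC_ext; [apply CDerive_n_0|reflexivity|apply JE]. }
    split; [apply (is_deriveC_Re _ _ _ D0)|].
    rewrite <- (is_derive_unique _ _ _ (is_deriveC_Im _ _ _ D0)). exact (Derive_const 0 x). }
  assert (Dq : forall x, is_deriveC q x (Copp (Cmult (CDerive_n eC 1 x) (Cpow (q x) 2)))).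
  { intros x. destruct (De x) as [D1 D2]. specialize (He x).
    eapply is_deriveC_ext; [reflexivity| |apply is_deriveC_RtoC, is_derive_inv; [exact D1|lra]].
    unfold q. rewrite <- RtoC_pow. revert D2. clear - He.
    destruct (CDerive_n eC 1 x) as [d1 d2]. unfold Im; cbn [snd]. intros ->.
    apply C_eq; cbn; [field; lra|ring]. }
  apply (jet_of _ (fun k => quotjet (CDerive_n eC) q k (CDerive_n w) 1)).
  - intros k x. apply quotjet_derive; auto. now apply smooth_jet.
  - intros x. cbn [quotjet Cpow]. rewrite CDerive_n_0. unfold q. ring.
Qed.

Fixpoint translates (rho : R -> C) (l : list (C * nat)) (t : R) : C :=
  match l with
  | [] => RtoC 0
  | (c, i) :: l => Cplus (Cmult c (rho (1 * t + - INR (S i)))) (translates rho l t)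
  end.

Lemma Cc_translate rho d : Cc rho -> 0 <= d -> Cc (fun t => rho (1 * t + - d)).
Proof.
  intros (S & a & b & Hab & V) Hd. split; [now apply smooth_affine|].
  exists (a + d), (b + d). split; [lra|]. intros t Ht. apply V. lra.
Qed.

Lemma laplace_R_translate rho d x : Cc rho -> 0 <= d ->
  laplace_R (fun t => rho (1 * t + - d)) x = Cmult (RtoC (exp (- d * x))) (laplace_R rho x).
Proof.
  intros Hr Hd. assert (Hr' := Cc_translate rho d Hr Hd).
  destruct Hr as (S & a & b & Hab & V).
  assert (V' : vanishes_outside (fun t => rho (1 * t + - d)) (a + d) (b + d)).
  { intros t Ht. apply V. lra. }
  (* The endpoints [a] and [b] are written in the shape that [is_RInt_comp_lin] matches. *)
  assert (H := laplace_is_RInt rho a b (RtoC x) (smooth_contC0 _ S) Hab V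
    (1 * (a + d) + - d) (1 * (b + d) + - d) ltac:(lra) ltac:(lra)).
  assert (H' := laplace_is_RInt _ (a + d) (b + d) (RtoC x) (smooth_contC0 _ (proj1 Hr')) ltac:(lra) V'
    _ _ (Rle_refl _) (Rle_refl _)).
  apply (is_RInt_comp_lin (V := C_R_NormedModule)) in H.
  unfold laplace_R. rewrite <- (is_RIntC_unique _ _ _ _ H'). apply is_RIntC_unique.
  apply is_RIntC_ext with (2 := is_RIntC_scal _ _ _ (RtoC (exp (- d * x))) _ H). intros t _.
  rewrite (scal_one (K := R_AbsRing) (V := C_R_NormedModule)).
  unfold laplace_integrand. rewrite <- !RtoC_mult, !Cexp_RtoC, Cmult_assoc, <- RtoC_mult, <- exp_plus.
  do 3 f_equal. ring.
Qed.

Lemma Cc_translates rho l : Cc rho -> Cc (translates rho l).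
Proof.
  intros Hr. destruct Cc_linear_set as (L0 & Lp & Ls).
  induction l as [|[c i] l IH]; [exact L0|].
  apply (Lp (fun t => Cmult c (rho (1 * t + - INR (S i)))) (translates rho l)); auto.
  apply (Ls c (fun t => rho (1 * t + - INR (S i)))).
  apply (Cc_translate rho (INR (S i))); [exact Hr|apply pos_INR].
Qed.

Lemma laplace_R_translates rho l x : Cc rho ->
  laplace_R (translates rho l) x = Cmult (expsum l 0 x) (laplace_R rho x).
Proof.
  intros Hr; induction l as [|[c i] l IH].
  - assert (E : translates rho [] = (fun t => Cmult (RtoC 0) (rho t))).
    { apply functional_extensionality; intros t. cbn. ring. }
    rewrite E. unfold laplace_R at 1. rewrite laplace_scal by auto. cbn. ring.
  - assert (Ht : Cc (fun t => rho (1 * t + - INR (S i)))) by (apply Cc_translate; auto; apply pos_INR).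
    transitivity (Cplus (Cmult c (laplace_R (fun t => rho (1 * t + - INR (S i))) x))
      (laplace_R (translates rho l) x)).
    + unfold laplace_R. rewrite <- laplace_scal by auto.
      apply (laplace_plus (fun t => Cmult c (rho (1 * t + - INR (S i))))).
      * apply Cc_linear_set; auto.
      * now apply Cc_translates.
    + rewrite laplace_R_translate, IH by (auto; apply pos_INR). cbn [expsum pow].
      rewrite Rmult_1_l. ring.
Qed.

(** A nonnegative bump that is positive on (1, 2) has a positive transform at every real [x], also
    for [x <= 0], as [smooth_div] asks. *)
Lemma exists_positive_laplace : exists rho e, Cc rho /\
  (forall x, laplace_R rho x = RtoC (e x)) /\ forall x, 0 < e x.
Proof.
  destruct (exists_bump 1 2) as (r & Sr & Vr & Nr & Pr).
  assert (Cr := smooth_contC0 _ Sr).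
  exists (fun t => RtoC (r t)), (fun x => RInt (fun t => exp (- t * x) * r t) 1 2).
  assert (Hc : forall x t, continuous (fun t => exp (- t * x) * r t) t).
  { intros x t. apply (continuous_mult (K := R_AbsRing) (fun t => exp (- t * x))).
    - apply (ex_derive_continuous (K := R_AbsRing) (V := R_NormedModule)). auto_derive; auto.
    - apply (contC_Re _ Cr). }
  assert (Hi : forall x, ex_RInt (fun t => exp (- t * x) * r t) 1 2)
    by (intros; apply (ex_RInt_continuous (V := R_CompleteNormedModule)); auto).
  split; [|split].
  - split; auto. exists 1, 2. split; [lra|auto].
  - intros x.
    assert (H := laplace_is_RInt _ 1 2 (RtoC x) Cr ltac:(lra) Vr 1 2 (Rle_refl _) (Rle_refl _)).
    unfold laplace_R. rewrite <- (is_RIntC_unique _ _ _ _ H). apply is_RIntC_unique.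
    apply is_RIntC_ext with (fun t => RtoC (exp (- t * x) * r t)).
    { intros t _. unfold laplace_integrand. now rewrite <- RtoC_mult, Cexp_RtoC, RtoC_mult. }
    apply (is_RInt_fct_extend_pair (U := R_NormedModule) (V := R_NormedModule)).
    + apply (RInt_correct (V := R_CompleteNormedModule)). apply Hi.
    + exact (eq_ind _ (is_RInt (V := R_NormedModule) (fun _ => 0) 1 2)
        (is_RInt_const (V := R_NormedModule) 1 2 0) _ (Rmult_0_r (2 - 1))).
  - intros x. apply RInt_gt_0; auto; [lra|].
    intros t Ht. apply Rmult_lt_0_compat; [apply exp_pos|auto].
Qed.

(* [w / e] is approximated by exponential sums, where [e] is the Laplace
   transform of a bump function [rho]; multiplication by [e] turns the
   exponentials into Laplace transforms of translates of [rho]. *)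
Lemma laplace_density w K eps : Cc w -> 0 < eps -> exists f, Cc f /\
  forall k, (k <= K)%nat -> forall x, 0 < x ->
    Cmod (CDerive_n (fun x => Cminus (laplace_R f x) (w x)) k x) <= eps * exp (- x).
Proof.
  intros (Sw & a & b & Hab & Vw) He.
  destruct exists_positive_laplace as (rho & e & Hr & Ee & Pe).
  assert (EeC : laplace_R rho = (fun x => RtoC (e x))) by (apply functional_extensionality; auto).
  assert (Rr : rapid (laplace_R rho)).
  { destruct Hr as (S & a' & b' & Hab' & V'). apply laplace_R_rapid with a' b'; auto using smooth_contC0. }
  destruct Rr as (Sr & c & Hc & Br).
  set (v := fun x => Cmult (w x) (RtoC (/ e x))).
  assert (Sv : smooth v) by (apply smooth_div; auto; now rewrite <- EeC).
  assert (Vv : vanishes_outside v a b) by (intros t Ht; unfold v; rewrite Vw by auto; ring).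
  destruct (uniform_upto (fun j A => forall x, 0 < x -> Cmod (CDerive_n (laplace_R rho) j x) <= A))
    with (k := K) as (N & N0 & HN).
  { intros j A A' HA P x Hx. specialize (P x Hx). lra. }
  { intros j. destruct (Br j) as (A & HA). exists (Rabs A). intros x Hx.
    eapply Rle_trans; [now apply HA|].
    assert (exp (- c * x) <= 1) by (rewrite <- exp_0; apply exp_le; nra).
    pose proof (exp_pos (- c * x)). pose proof (Rle_abs A). pose proof (Rabs_pos A). nra. }
  assert (P2 : forall k, 0 < 2 ^ k) by (intros; apply pow_lt; lra).
  (* The Leibniz rule for factors bounded by [d * exp (- x)] and [N] costs at most [2 ^ K]; [N + 1]
     is positive even if [N] is 0. *)
  set (d := eps / (2 ^ K * (N + 1))).
  assert (Hd : 0 < d) by (unfold d; apply Rdiv_lt_0_compat; auto; specialize (P2 K); nra).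
  assert (Ed : 2 ^ K * (d * (N + 1)) = eps).
  { unfold d. field. specialize (P2 K). split; lra. }
  destruct (expsum_approximation v a b K d Sv Hab Vv Hd) as (l & Hl).
  exists (translates rho l). split; [now apply Cc_translates|]. intros k Hk x Hx.
  destruct (jet_of (expsum l 0) (expsum l) (expsum_jet l) (fun _ => eq_refl)) as [Sl El].
  destruct (smooth_minus _ _ Sl Sv) as [Sd Edd].
  assert (E : (fun x => Cminus (laplace_R (translates rho l) x) (w x)) =
    (fun x => Cmult (Cminus (expsum l 0 x) (v x)) (laplace_R rho x))).
  { apply functional_extensionality; intros y. rewrite laplace_R_translates by auto.
    unfold v. rewrite Ee. specialize (Pe y).
    replace (w y) with (Cmult (w y) (Cmult (RtoC (/ e y)) (RtoC (e y)))) at 1.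
    - ring.
    - rewrite <- RtoC_mult, Rinv_l by lra. ring. }
  rewrite E, (proj2 (smooth_mult _ _ Sd Sr)).
  pose proof (exp_pos (- x)) as Px.
  eapply Rle_trans.
  - apply (prodjet_bound k _ _ (d * exp (- x)) N 1); try lra; [nra| |].
    + intros j Hj. rewrite Edd, El, pow1, Rmult_1_r. apply Hl; auto. lia.
    + intros j Hj. rewrite pow1, Rmult_1_r. apply HN; auto. lia.
  - rewrite pow1, Rmult_1_r.
    assert (2 ^ k <= 2 ^ K) by (apply Rle_pow; [lra|auto]).
    rewrite <- Ed. specialize (P2 k).
    apply Rle_trans with (2 ^ K * (d * N * exp (- x))).
    + replace (d * exp (- x) * N) with (d * N * exp (- x)) by ring.
      apply Rmult_le_compat_r; auto. apply Rmult_le_pos; [|lra]. apply Rmult_le_pos; lra.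
    + rewrite (Rmult_assoc (2 ^ K)). apply Rmult_le_compat_l; [apply pow_le; lra|].
      apply Rmult_le_compat_r; [lra|]. nra.
Qed.

Lemma id_approximated_by_laplace : approximates (fun f => f) laplace_R.
Proof.
  intros w Hw.
  (* Diagonal choice: the n-th approximant controls the derivatives up to order [n] with error
     [/ (n + 1)], so every fixed order [k] is controlled once [n >= k]. *)
  assert (H : forall n, exists f, Cc f /\ forall k, (k <= n)%nat -> forall x, 0 < x ->
    Cmod (CDerive_n (fun x => Cminus (laplace_R f x) (w x)) k x) <= / (INR n + 1) * exp (- x)).
  { intros n. apply laplace_density; auto. apply Rinv_0_lt_compat. pose proof (pos_INR n). lra. }
  apply functional_choice in H. destruct H as (u & Hu). exists u. split; [apply Hu|].
  intros kappa k eps He.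
  destruct (exp_le_Sweight 1 (1 / 4) kappa k) as (A & A0 & HA); [lra|pose proof (pos_INR k); lra|].
  destruct (INR_unbounded (A / eps)) as (N & HN).
  exists (max N k). intros n Hn x Hx.
  eapply Rle_trans; [apply (Hu n); auto; lia|].
  specialize (HA x Hx). replace (-(1) * x) with (- x) in HA by ring.
  assert (HNn : INR N <= INR n) by (apply le_INR; lia).
  assert (Hn0 : 0 < INR n + 1) by (pose proof (pos_INR n); lra).
  apply (Rmult_le_reg_l (INR n + 1)); auto.
  rewrite <- Rmult_assoc, Rinv_r, Rmult_1_l by lra.
  eapply Rle_trans; [exact HA|]. rewrite <- Rmult_assoc.
  apply Rmult_le_compat_r; [left; apply Sweight_pos|].
  assert (A = A / eps * eps) by (field; lra). nra.
Qed.

(** * Equality of the indices *)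

Theorem theorem4p6 :
  forall (h : (R -> C) -> C) (sigma : (C -> C) -> C) (sigma0 : (R -> C) -> C),
    Cc_dual h ->
    real_functional h ->
    is_sigma_function h sigma ->
    acts_through_Sgam 0 sigma sigma0 ->
    N_plus (hankel_form h) Cc = N_plus (sigma_form sigma0) Cc /\
    N_minus (hankel_form h) Cc = N_minus (sigma_form sigma0) Cc.
Proof.
  intros h sigma sigma0 _ Hr Hs Ha.
  assert (Ds := proj1 Ha).
  assert (R1 := fun f => hankel_form_real h sigma sigma0 f Hr Hs Ha).
  assert (R2 := transform_form_real sigma0 _ _ Ds id_admissible laplace_R_admissible
    id_approximated_by_laplace R1).
  assert (E1 := fun f => hankel_form_eq h sigma sigma0 f Hs Ha).
  assert (E2 := fun f (_ : Cc f) => sigma_form_eq sigma0 f).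
  assert (Main : forall s, Rabs s = 1 ->
    inertia s (hankel_form h) Cc = inertia s (sigma_form sigma0) Cc).
  { intros s Hs1. apply Lub_Rbar_eqset. intros r.
    split; intros (n & M & Er & LM & MD & PM & DM).
    - destruct (inertia_le_of_approximates sigma0 _ _ _ _ s Ds laplace_R_admissible id_admissible
        laplace_approximated_by_id Hs1 E1 E2 R1 R2 n M LM MD PM DM) as (M' & HM').
      exists n, M'. tauto.
    - destruct (inertia_le_of_approximates sigma0 _ _ _ _ s Ds id_admissible laplace_R_admissible
        id_approximated_by_laplace Hs1 E2 E1 R2 R1 n M LM MD PM DM) as (M' & HM').
      exists n, M'. tauto. }
  split; apply Main; [apply Rabs_R1|].
  rewrite Rabs_left; lra.
Qed.
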